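(* Let $G$ be a first-countable totally disconnected, locally compact group with property (LD) and let $\mathcal{S}$ be a monomial constituent of $G$. Then there is a continuous injective homomorphism $\phi: G_{\mathcal{S}} \rightarrow G$, where $G_{\mathcal{S}}$ is a first-countable totally disconnected, locally compact group, with the following properties: (i) $G_{\mathcal{S}}$ is generated by its compact open subgroups, all of which belong to $\mathcal{S}$. (ii) Given a compact locally normal subgroup $N$ of $G$ such that $N \in \mathcal{S}$, then $\phi$ restricts to a homeomorphism from $\phi^{-1}(N)$ to $N$. (iii) $\phi(G_{\mathcal{S}})$ is characteristic in any open subgroup of $G$ that contains it. Moreover, given an open subgroup $K$ of $G$ containing $\phi(G_{\mathcal{S}})$, then the map $G_{\mathcal{S}} \rightarrow K$ induced by $\phi$ has the same properties (i)--(iii) with respect to $K$ in place of $G$.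
   Context: All groups are locally compact Hausdorff topological groups; ''t.d.l.c.'' means totally disconnected locally compact. Direct products carry the product topology; direct factors are closed subgroups. Characteristic means invariant under all topological group automorphisms. A subgroup of $G$ is locally normal if its normalizer is open in $G$. Property (LD): for every closed locally normal subgroup $K$ of $G$ there is an open subgroup $L$ of $K$ that is a direct factor of an open subgroup of $G$. T.d.l.c. groups $G_1,G_2$ are commensurable if there is an isomorphism from a finite index open subgroup of $G_1$ to a finite index open subgroup of $G_2$; similar if there are positive integers $a_1,a_2$ such that $G_1^{a_1}$ is commensurable with $G_2^{a_2}$ (an equivalence relation). A t.d.l.c. group $G$ is monomial if it is nondiscrete and similar to every infinite closed locally normal subgroup of $G^a$ for all natural numbers $a$; among profinite groups this is invariant under similarity. Monomial constituent: given a t.d.l.c. group $G$, a similarity class $\mathcal{S}$ of profinite groups is a monomial constituent of $G$ if the groups in $\mathcal{S}$ are monomial and there exists $H\in\mathcal{S}$ such that $H$ is isomorphic to a locally normal subgroup of $G$. *)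

(* Defs.v *)
From HB Require Import structures.
From mathcomp Require Import all_boot all_classical topology.

Set Implicit Arguments.
Unset Strict Implicit.
Unset Printing Implicit Defensive.

Local Open Scope classical_set_scope.
Local Open Scope group_scope.

HB.mixin Record isTopGroup G of Topological G & Group G := {
  mulg_continuous : continuous (fun p : G * G => p.1 * p.2);
  invg_continuous : continuous (fun x : G => x^-1)
}.

#[short(type="topGroupType")]
HB.structure Definition TopGroup := {G of isTopGroup G & Topological G & Group G}.

Lemma continuous_mulg (X : topologicalType) (G : topGroupType) (f g : X -> G) :
  continuous f -> continuous g -> continuous (fun x => f x * g x).
Proof.
move=> cf cg x.
apply: (@continuous_comp X (G * G)%type G (fun x => (f x, g x))
  (fun p => p.1 * p.2)); last exact: mulg_continuous.
by apply: cvg_pair; [exact: cf|exact: cg].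
Qed.

Definition is_subgroup (G : groupType) (A : set G) : Prop :=
  [/\ A 1, forall x y, A x -> A y -> A (x * y) & forall x, A x -> A x^-1].

Record subgroup (G : groupType) := Subgroup {
  sg_set :> set G;
  sg_subgroup : is_subgroup sg_set
}.

(* The carrier type is the library's [set_type K], which already carries the
   subspace topology. *)
Section SubgroupGroup.
Variables (G : topGroupType) (K : subgroup G).
Local Notation T := (set_type (sg_set K)).

Lemma sg_one_subproof : 1 \in sg_set K.
Proof. by apply/mem_set; case: (sg_subgroup K). Qed.

Lemma sg_mul_subproof (x y : T) : set_val x * set_val y \in sg_set K.
Proof.
by apply/mem_set; case: (sg_subgroup K) => _ + _; apply; apply: set_valP.
Qed.

Lemma sg_inv_subproof (x : T) : (set_val x)^-1 \in sg_set K.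
Proof.
by apply/mem_set; case: (sg_subgroup K) => _ _; apply; apply: set_valP.
Qed.

Definition sg_one : T := SigSub sg_one_subproof.
Definition sg_mul (x y : T) : T := SigSub (sg_mul_subproof x y).
Definition sg_inv (x : T) : T := SigSub (sg_inv_subproof x).

Lemma sg_mulA : associative sg_mul.
Proof. by move=> x y z; apply: eq_sig_hprop => //=; rewrite mulgA. Qed.
Lemma sg_mul1 : left_id sg_one sg_mul.
Proof. by move=> x; apply: eq_sig_hprop => //=; rewrite mul1g. Qed.
Lemma sg_mulr1 : right_id sg_one sg_mul.
Proof. by move=> x; apply: eq_sig_hprop => //=; rewrite mulg1. Qed.
Lemma sg_mulV : left_inverse sg_one sg_inv sg_mul.
Proof. by move=> x; apply: eq_sig_hprop => //=; rewrite mulVg. Qed.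
Lemma sg_mulrV : right_inverse sg_one sg_inv sg_mul.
Proof. by move=> x; apply: eq_sig_hprop => //=; rewrite mulgV. Qed.

HB.instance Definition _ :=
  isGroup.Build T sg_mulA sg_mul1 sg_mulr1 sg_mulV sg_mulrV.

Lemma sg_val_continuous : continuous (set_val : T -> G).
Proof. exact: initial_continuous. Qed.

Lemma continuous_to_sg (X : topologicalType) (f : X -> T) :
  continuous (set_val \o f) -> continuous f.
Proof.
move=> cf; apply/continuousP => _ [B oB <-].
by rewrite -comp_preimage; move/continuousP: cf; apply.
Qed.

Lemma sg_mul_continuous : continuous (fun p : T * T => p.1 * p.2).
Proof.
apply: continuous_to_sg; apply: (@continuous_mulg _ G) => p.
- by apply: (cvg_comp _ _ cvg_fst); exact: sg_val_continuous.
- by apply: (cvg_comp _ _ cvg_snd); exact: sg_val_continuous.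
Qed.

Lemma sg_inv_continuous : continuous (fun x : T => x^-1).
Proof.
apply: continuous_to_sg => x.
apply: (@continuous_comp T G G set_val (fun x => x^-1)).
  exact: sg_val_continuous.
exact: invg_continuous.
Qed.

HB.instance Definition _ :=
  isTopGroup.Build T sg_mul_continuous sg_inv_continuous.

End SubgroupGroup.

Definition topsub (G : topGroupType) (K : subgroup G) : topGroupType :=
  set_type (sg_set K).

Section ProdTopGroup.
Variables G H : topGroupType.
Local Notation T := (G * H)%type.

Lemma pair_mul_continuous : continuous (fun p : T * T => p.1 * p.2).
Proof.
move=> p; apply: cvg_pair => /=.
- apply: (@continuous_mulg _ G (fun p : T * T => p.1.1) (fun p => p.2.1)) => q.
  + by apply: cvg_comp; exact: cvg_fst.
  + by apply: cvg_comp; [exact: cvg_snd|exact: cvg_fst].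
- apply: (@continuous_mulg _ H (fun p : T * T => p.1.2) (fun p => p.2.2)) => q.
  + by apply: cvg_comp; [exact: cvg_fst|exact: cvg_snd].
  + by apply: cvg_comp; exact: cvg_snd.
Qed.

Lemma pair_inv_continuous : continuous (fun p : T => p^-1).
Proof.
move=> p; apply: cvg_pair => /=.
- by apply: cvg_comp; [exact: cvg_fst|exact: invg_continuous].
- by apply: cvg_comp; [exact: cvg_snd|exact: invg_continuous].
Qed.

HB.instance Definition _ :=
  isTopGroup.Build T pair_mul_continuous pair_inv_continuous.

End ProdTopGroup.

Definition gpower (G : topGroupType) (n : nat) : Type :=
  prod_topology (fun _ : 'I_n => G).

Section GPower.
Variables (G : topGroupType) (n : nat).
Local Notation T := (gpower G n).

HB.instance Definition _ :=
  Topological.copy T (prod_topology (fun _ : 'I_n => G)).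

Definition gpow_one : T := fun=> 1.
Definition gpow_mul (x y : T) : T := fun i => x i * y i.
Definition gpow_inv (x : T) : T := fun i => (x i)^-1.

Lemma gpow_mulA : associative gpow_mul.
Proof. by move=> x y z; apply/funext => i; exact: mulgA. Qed.
Lemma gpow_mul1 : left_id gpow_one gpow_mul.
Proof. by move=> x; apply/funext => i; exact: mul1g. Qed.
Lemma gpow_mulr1 : right_id gpow_one gpow_mul.
Proof. by move=> x; apply/funext => i; exact: mulg1. Qed.
Lemma gpow_mulV : left_inverse gpow_one gpow_inv gpow_mul.
Proof. by move=> x; apply/funext => i; exact: mulVg. Qed.
Lemma gpow_mulrV : right_inverse gpow_one gpow_inv gpow_mul.
Proof. by move=> x; apply/funext => i; exact: mulgV. Qed.

HB.instance Definition _ :=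
  isGroup.Build T gpow_mulA gpow_mul1 gpow_mulr1 gpow_mulV gpow_mulrV.

Lemma gpow_proj_continuous (i : 'I_n) : continuous (fun x : T => x i).
Proof. exact: (@proj_continuous 'I_n (fun=> G) i). Qed.

Lemma continuous_to_gpow (X : topologicalType) (f : X -> T) :
  (forall i, continuous (fun x => f x i)) -> continuous f.
Proof.
move=> cf x; apply/cvg_sup => i U [V [[W oW <-] WfN WU]].
apply: (filterS WU); rewrite nbhs_simpl; apply: (cf i x).
by apply: open_nbhs_nbhs; split.
Qed.

Lemma gpow_mul_continuous : continuous (fun p : T * T => p.1 * p.2).
Proof.
apply: continuous_to_gpow => i; apply: (@continuous_mulg _ G) => p.
- apply: (@continuous_comp (T * T)%type T G fst (fun x => x i)).
    exact: cvg_fst.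
  exact: gpow_proj_continuous.
- apply: (@continuous_comp (T * T)%type T G snd (fun x => x i)).
    exact: cvg_snd.
  exact: gpow_proj_continuous.
Qed.

Lemma gpow_inv_continuous : continuous (fun x : T => x^-1).
Proof.
apply: continuous_to_gpow => i x.
apply: (@continuous_comp T G G (fun x => x i) (fun x => x^-1)).
  exact: gpow_proj_continuous.
exact: invg_continuous.
Qed.

HB.instance Definition _ :=
  isTopGroup.Build T gpow_mul_continuous gpow_inv_continuous.

End GPower.

Definition first_countable (X : topologicalType) : Prop :=
  forall x : X, exists2 B : set (set X), countable B & nbhs x = filter_from B id.

Definition homeomorphism (X Y : topologicalType) (f : X -> Y) : Prop :=
  continuous f /\
  exists g : Y -> X, [/\ cancel f g, cancel g f & continuous g].

Definition restricts_to_homeomorphism (X Y : topologicalType) (f : X -> Y)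
    (A : set X) (B : set Y) : Prop :=
  exists2 g : set_type A -> set_type B,
    homeomorphism g & forall x : set_type A, set_val (g x) = f (set_val x).

Definition open_in (X : topologicalType) (A B : set X) : Prop :=
  A `<=` B /\ open (set_val @^-1` A : set (set_type B)).

Definition closed_in (X : topologicalType) (A B : set X) : Prop :=
  A `<=` B /\ closed (set_val @^-1` A : set (set_type B)).

Definition topgroup_iso (G H : topGroupType) (f : G -> H) : Prop :=
  {morph f : x y / x * y} /\ homeomorphism f.

Definition isomorphic (G H : topGroupType) : Prop :=
  exists f : G -> H, topgroup_iso f.

Definition tdlc (G : topGroupType) : Prop :=
  [/\ hausdorff_space G, locally_compact [set: G]
     & totally_disconnected [set: G]].

Definition profinite (G : topGroupType) : Prop :=
  [/\ hausdorff_space G, compact [set: G] & totally_disconnected [set: G]].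

Definition discrete (G : topGroupType) : Prop := forall A : set G, open A.

Definition finite_index (G : topGroupType) (U : subgroup G) : Prop :=
  finite_set (range (fun g : G => [set g * u | u in sg_set U])).

Definition normalizer (G : topGroupType) (K : subgroup G) : set G :=
  [set g | [set k ^ g | k in sg_set K] = K].

Definition locally_normal (G : topGroupType) (K : subgroup G) : Prop :=
  open (normalizer K).

Definition characteristic (G : topGroupType) (A : set G) : Prop :=
  forall f : G -> G, topgroup_iso f -> f @` A = A.

Definition generated (G : topGroupType) (A : set G) : set G :=
  smallest (@is_subgroup G) A.

(* [f] is necessarily multiplication (l, m) |-> l * m, corestricted to U. *)
Definition direct_factor (G : topGroupType) (L U : subgroup G) : Prop :=
  closed_in L U /\
  exists2 M : subgroup G, closed_in M U &
    exists2 f : (topsub L * topsub M)%type -> topsub U,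
      topgroup_iso f & forall p, set_val (f p) = set_val p.1 * set_val p.2.

Definition property_LD (G : topGroupType) : Prop :=
  forall K : subgroup G, closed K -> locally_normal K ->
  exists L U : subgroup G, [/\ open_in L K, open U & direct_factor L U].

Definition commensurable (G1 G2 : topGroupType) : Prop :=
  exists (U1 : subgroup G1) (U2 : subgroup G2),
    [/\ open U1 /\ finite_index U1, open U2 /\ finite_index U2
       & isomorphic (topsub U1) (topsub U2)].

Definition similar (G1 G2 : topGroupType) : Prop :=
  exists a1 a2 : nat,
    [/\ (0 < a1)%N, (0 < a2)%N & commensurable (gpower G1 a1) (gpower G2 a2)].

Definition monomial (G : topGroupType) : Prop :=
  [/\ tdlc G, ~ discrete G
     & forall (a : nat) (H : subgroup (gpower G a)),
         closed H -> locally_normal H -> infinite_set H ->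
         similar G (topsub H)].

(* A class of groups is represented by its membership predicate. *)
Definition profinite_similarity_class (S : topGroupType -> Prop) : Prop :=
  exists2 H0 : topGroupType, profinite H0 &
    forall H : topGroupType, S H <-> profinite H /\ similar H0 H.

Definition monomial_constituent (G : topGroupType) (S : topGroupType -> Prop) :
    Prop :=
  [/\ profinite_similarity_class S,
      forall H, S H -> monomial H
    & exists2 H : topGroupType, S H &
        exists2 K : subgroup G, locally_normal K & isomorphic H (topsub K)].

Definition generated_by_compact_opens (S : topGroupType -> Prop)
    (GS : topGroupType) : Prop :=
  generated (\bigcup_(U in [set U : subgroup GS | compact U /\ open U])
               sg_set U) = [set: GS] /\
  forall U : subgroup GS, compact U -> open U -> S (topsub U).

Definition homeomorphic_over (S : topGroupType -> Prop)
    (GS G : topGroupType) (phi : GS -> G) : Prop :=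
  forall N : subgroup G, compact N -> locally_normal N -> S (topsub N) ->
  restricts_to_homeomorphism phi (phi @^-1` N) N.

Definition image_characteristic (GS G : topGroupType) (phi : GS -> G) : Prop :=
  forall U : subgroup G, open U -> range phi `<=` U ->
  @characteristic (topsub U) (set_val @^-1` range phi).

Definition monomial_core_properties (S : topGroupType -> Prop)
    (GS G : topGroupType) (phi : GS -> G) : Prop :=
  [/\ generated_by_compact_opens S GS, homeomorphic_over S phi
     & image_characteristic phi].

(* Main.v *)
(* Fix a compact open subgroup U.  The members of S contained and normal in U are
   closed under products, because (LD) makes N1 N2 locally a direct product
   (N1 & N2) x R1 x R2 of pieces similar to members of S.  The crux is that there is
   such a member N0 which contains an open subgroup of every other one.
   If not, they form an infinite chain in which nothing becomes open.  Splitting off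
   one step at a time gives infinitely many commuting independent pieces shrinking
   to 1; the closed subgroup they generate is locally a direct factor, so one of the
   pieces, and in the end a member P of S, has arbitrarily small finite normal
   subgroups.  Applying similarity to the members of S generated by disjoint
   subsequences of simple factors of these, one finds a member generated by normal
   copies of a single finite simple group T.  An infinite closed subgroup of U then
   belongs to S as soon as the homomorphisms onto T separate its points: such a
   group is a product of copies of T, by first countability a countable one, hence
   determined up to isomorphism.  So the closed subgroup generated by all normal
   subgroups of U generated by copies of T (when T is abelian, only by those in a
   suitable open V, to keep it abelian) is again in S, and is N0.
   Given N0, let G_S be the subgroup generated by all compact locally normal members
   of S, with the topology in which N0, with its subspace topology, is open.
   Each such N meets N0 in an open subgroup of N, which gives (ii), and the family
   of these N is invariant under automorphisms, which gives (iii). *)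
Require Import Defs.
From HB Require Import structures.
From mathcomp Require Import all_boot all_classical topology.

Set Implicit Arguments.
Unset Strict Implicit.
Unset Printing Implicit Defensive.

Local Open Scope classical_set_scope.
Local Open Scope group_scope.

(** All arguments concern germs at 1: open subgroups of profinite groups have finite index, so
    commensurability is local isomorphism and membership in S is decided near 1. In splitting a
    chain the obstacle is that a complement must be normalised by the same ambient group as the
    piece, which (LD) does not promise. If S has no abelian member, the centraliser of the piece is
    used: it is canonical, and it meets a small piece in an abelian normal subgroup, which is finite
    since it cannot lie in S, and so trivial when small finite normal subgroups are excluded. If S
    has an abelian member, every member is abelian near 1, and the chain is trimmed until its terms
    commute; inside the abelian group they generate, normality is automatic. When small finite
    normal subgroups do occur, closure under finite products is of no help for a subgroup generated
    by infinitely many members; the homomorphisms onto T supply a criterion that survives this. For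
    abelian T the danger is that abelian normal subgroups need not commute with each other, and (LD)
    is applied once more to make them commute in a suitable open subgroup. *)

Ltac gsimp := rewrite ?(conjgE, invgM, invgK, mulgA, mulgK, mulgVK, mul1g,
  mulg1, mulVg, mulgV, invg1).

(** * Normalising, centralising and multiplying subsets of an abstract group *)

Section Groups.
Variable G : groupType.
Implicit Types A B C V : set G.

(** One-sided: only the inclusion of [A ^ b] in [A] is required, and neither set need contain the
    other. For [B] closed under inverses it gives equality. *)
Definition nrm A B := forall a b, A a -> B b -> A (a ^ b).
Definition cent A B := forall a b, A a -> B b -> a * b = b * a.
Definition smul A B := [set x * y | x in A & y in B].
Definition meet1 A B := forall x, A x -> B x -> x = 1.

Lemma sg1 A : is_subgroup A -> A 1. Proof. by case. Qed.
Lemma sgM A x y : is_subgroup A -> A x -> A y -> A (x * y).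
Proof. by case=> _ h _; apply: h. Qed.
Lemma sgV A x : is_subgroup A -> A x -> A x^-1.
Proof. by case=> _ _; apply. Qed.
Lemma sgD A x y : is_subgroup A -> A x -> A y -> A (x^-1 * y).
Proof. by move=> sA Ax Ay; apply: sgM => //; apply: sgV. Qed.
Lemma sgDr A x y : is_subgroup A -> A x -> A y -> A (x * y^-1).
Proof. by move=> sA Ax Ay; apply: sgM => //; apply: sgV. Qed.
Lemma sgJ A x y : is_subgroup A -> A x -> A y -> A (x ^ y).
Proof. by move=> sA Ax Ay; rewrite conjgE; apply: sgD => //; apply: sgM. Qed.

Lemma sg_nrm A : is_subgroup A -> nrm A A.
Proof. by move=> sA x y; exact: sgJ. Qed.

Lemma sgI A B : is_subgroup A -> is_subgroup B -> is_subgroup (A `&` B).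
Proof.
move=> sA sB; split; first by split; exact: sg1.
- by move=> x y [Ax Bx] [Ay By]; split; apply: sgM.
- by move=> x [Ax Bx]; split; apply: sgV.
Qed.

Lemma sg_smul A B : is_subgroup A -> is_subgroup B -> nrm A B ->
  is_subgroup (smul A B).
Proof.
move=> sA sB nAB; split.
- by exists 1; [exact: sg1|exists 1; [exact: sg1|rewrite mulg1]].
- move=> _ _ [a Aa [b Bb <-]] [c Ac [d Bd <-]].
  exists (a * c ^ b^-1); first by apply: sgM => //; apply: nAB => //; apply: sgV.
  by exists (b * d); [exact: sgM|gsimp].
- move=> _ [a Aa [b Bb <-]].
  exists (a^-1 ^ b); first by apply: nAB => //; apply: sgV.
  by exists b^-1; [exact: sgV|gsimp].
Qed.

Lemma smulSl A B : is_subgroup B -> A `<=` smul A B.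
Proof. by move=> sB x Ax; exists x => //; exists 1; [exact: sg1|rewrite mulg1]. Qed.
Lemma smulSr A B : is_subgroup A -> B `<=` smul A B.
Proof. by move=> sA x Bx; exists 1; [exact: sg1|exists x => //; rewrite mul1g]. Qed.

Lemma smul_sub A B C : is_subgroup C -> A `<=` C -> B `<=` C -> smul A B `<=` C.
Proof. by move=> sC AC BC _ [a /AC Ca [b /BC Cb <-]]; exact: sgM. Qed.

Lemma cent_nrm A B : cent A B -> nrm A B.
Proof. by move=> cAB a b Aa Bb; rewrite conjgE (cAB _ _ Aa Bb) mulKg. Qed.

Lemma cent_sym A B : cent A B -> cent B A.
Proof. by move=> cAB a b Ba Ab; rewrite (cAB b a). Qed.

Lemma centS A B A' B' : A' `<=` A -> B' `<=` B -> cent A B -> cent A' B'.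
Proof. by move=> sA sB c a b /sA Aa /sB Bb; exact: c. Qed.

Lemma nrmI A B C : nrm A C -> nrm B C -> nrm (A `&` B) C.
Proof. by move=> nA nB a c [Aa Ba] Cc; split; [exact: nA|exact: nB]. Qed.

Lemma nrmS A B C : nrm A B -> C `<=` B -> nrm A C.
Proof. by move=> nA CB a c Aa /CB; exact: nA. Qed.

Lemma nrm_smul A B C : nrm A C -> nrm B C -> nrm (smul A B) C.
Proof.
move=> nA nB _ c [a Aa [b Bb <-]] Cc; rewrite conjMg.
by exists (a ^ c); [exact: nA|exists (b ^ c) => //; exact: nB].
Qed.

Lemma nrm_comm A B x y : is_subgroup A -> nrm A B -> A x -> B y ->
  A (x^-1 * x ^ y).
Proof. by move=> sA nA Ax By; apply: sgD => //; exact: nA. Qed.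

Lemma meet1_cent A B : is_subgroup A -> is_subgroup B -> nrm A B -> nrm B A ->
  meet1 A B -> cent A B.
Proof.
move=> sA sB nA nB m a b Aa Bb.
have : [~ a, b] = 1.
  apply: m; first by rewrite commgEl; exact: (nrm_comm sA nA).
  by rewrite commgEr; apply: sgM => //; apply: nB => //; exact: sgV.
by move/eqP/commgP.
Qed.

Definition centr A := [set x : G | forall a, A a -> a * x = x * a].

Lemma sg_centr A : is_subgroup (centr A).
Proof.
split.
- by move=> a _; rewrite mulg1 mul1g.
- by move=> x y cx cy a Aa; rewrite mulgA cx // -!mulgA cy.
- by move=> x cx a Aa; apply: (mulgI x); rewrite mulVKg mulgA -cx // mulgK.
Qed.

Lemma nrm_centr A B : is_subgroup B -> nrm A B -> nrm (centr A) B.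
Proof.
move=> sB nA x b cx Bb a Aa.
have := cx (a ^ b^-1) (nA _ _ Aa (sgV sB Bb)).
move=> /(congr1 (fun z => z ^ b)); rewrite /= (conjMg _ x) (conjMg x) conjgKV.
by [].
Qed.

End Groups.

(** * Compactness and closed subgroups of topological groups *)

Section Topology.
Variable T : topologicalType.
Implicit Types K A : set T.

(** Any cluster point in [K] of the filter generated by the traces [K & A] lies in every closed [A]
    of the family. *)
Lemma compact_directed K (F : set (set T)) : compact K -> F !=set0 ->
  (forall A, F A -> closed A) ->
  (forall A B, F A -> F B -> exists2 C, F C & C `<=` A `&` B) ->
  (forall A, F A -> K `&` A !=set0) ->
  exists2 x, K x & forall A, F A -> A x.
Proof.
move=> cK [A0 FA0] clF dF neF.
pose Fl := filter_from F (fun A => K `&` A).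
have PF : ProperFilter Fl.
  apply: filter_from_proper; last by move=> A /neF.
  apply: filter_from_filter; first by exists A0.
  move=> A B FA FB; have [C FC CAB] := dF _ _ FA FB.
  by exists C => // x [Kx /CAB[]].
have [x [Kx clx]] : K `&` cluster Fl !=set0.
  by apply: cK; exists A0 => // x [].
exists x => // A FA; apply: (clF _ FA) => W nW.
have [y [[_ Ay] Wy]] := clx (K `&` A) W (ex_intro2 _ _ _ FA (fun _ h => h)) nW.
by exists y.
Qed.


End Topology.

Lemma compact_image (X Y : topologicalType) (f : X -> Y) (A : set X) :
  continuous f -> compact A -> compact (f @` A).
Proof.
by move=> cf cA; apply: continuous_compact => //; exact: continuous_subspaceT.
Qed.

Section TopGroupBasics.
Variable G : topGroupType.
Implicit Types A B K V W : set G.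

Lemma mulgl_cont (a : G) : continuous (fun x : G => a * x).
Proof. by apply: continuous_mulg => x; [exact: cvg_cst|exact: cvg_id]. Qed.
Lemma mulgr_cont (a : G) : continuous (fun x : G => x * a).
Proof. by apply: continuous_mulg => x; [exact: cvg_id|exact: cvg_cst]. Qed.
Lemma continuous_invg (X : topologicalType) (f : X -> G) :
  continuous f -> continuous (fun x => (f x)^-1).
Proof.
move=> cf x; apply: (@continuous_comp _ _ _ f (fun y : G => y^-1)).
  exact: cf.
exact: invg_continuous.
Qed.
Lemma conjg_cont (a : G) : continuous (fun x : G => x ^ a).
Proof. by apply: (continuous_mulg (G := G)); [move=> x; exact: cvg_cst|exact: mulgr_cont]. Qed.
Lemma conjgr_cont (a : G) : continuous (fun x : G => a ^ x).
Proof.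
apply: (continuous_mulg (G := G)); last exact: mulgl_cont.
by apply: continuous_invg => x; exact: cvg_id.
Qed.

Lemma nbhs_comp (X : topologicalType) (f : X -> G) x W : continuous f ->
  nbhs (f x) W -> nbhs x (f @^-1` W).
Proof. by move=> cf nW; exact: cf. Qed.

Lemma nbhs_translate (x : G) W : nbhs x W <-> nbhs 1 [set y | W (x * y)].
Proof.
split=> nW; first by apply: (@nbhs_comp _ (fun y => x * y) 1 W (@mulgl_cont x)); rewrite mulg1.
have : nbhs x [set z | W (x * (x^-1 * z))].
  apply: (@nbhs_comp _ (fun z => x^-1 * z) x [set y | W (x * y)]).
    exact: mulgl_cont.
  by rewrite mulVg.
by apply: filterS => z /=; rewrite mulVKg.
Qed.

Lemma nbhs1M W : nbhs (1 : G) W ->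
  exists2 V, nbhs (1 : G) V & forall x y, V x -> V y -> W (x * y).
Proof.
move=> nW; have : nbhs ((1, 1) : G * G) [set p | W (p.1 * p.2)].
  by apply: (@mulg_continuous G); rewrite /= mulg1.
move=> [[P Q] /= [nP nQ] h]; exists (P `&` Q); first exact: filterI.
by move=> x y [Px _] [_ Qy]; exact: (h (x, y)).
Qed.

Lemma nbhs1V W : nbhs (1 : G) W -> nbhs (1 : G) [set x | W x^-1].
Proof.
move=> nW; apply: (@nbhs_comp _ (fun z => z^-1) 1 W (@invg_continuous G)).
by rewrite invg1.
Qed.

Lemma sg_open A : is_subgroup A -> nbhs (1 : G) A -> open A.
Proof.
move=> sA nA; rewrite openE => x Ax; rewrite /interior nbhs_translate.
by apply: filterS nA => y Ay /=; exact: sgM.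
Qed.

Lemma open_sg_nbhs A : is_subgroup A -> open A -> nbhs (1 : G) A.
Proof. by move=> sA oA; apply: open_nbhs_nbhs; split => //; exact: sg1. Qed.

Lemma sg_closed A B W : is_subgroup A -> closed B -> A `<=` B -> is_subgroup B ->
  nbhs (1 : G) W -> B `&` W `<=` A -> closed A.
Proof.
move=> sA cB AB sB nW WA x cx.
have Bx : B x by apply: cB => V /cx[y [/AB By Vy]]; exists y.
have /cx[y [Ay /= Wy]] : nbhs x [set y | W (x^-1 * y)].
  by apply: (@nbhs_comp _ (fun z => x^-1 * z) x W (@mulgl_cont _)); rewrite mulVg.
have : A (x^-1 * y) by apply: WA; split => //; apply: sgD => //; exact: AB.
by move=> /(sgDr sA Ay); rewrite invgM invgK mulVKg.
Qed.

Lemma open_sg_closed A : is_subgroup A -> open A -> closed A.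
Proof.
move=> sA oA; by apply: (@sg_closed A setT A) => //; exact: open_sg_nbhs.
Qed.

Lemma compact_smul A B : compact A -> compact B -> compact (smul A B).
Proof.
move=> cA cB; have -> : smul A B = (fun p : G * G => p.1 * p.2) @` (A `*` B).
  apply/seteqP; split => x; first by case=> a Aa [b Bb <-]; exists (a, b).
  by case=> -[a b] /= [Aa Bb] <-; exists a => //; exists b.
apply: continuous_compact; last exact: compact_setX.
by apply: continuous_subspaceT; exact: mulg_continuous.
Qed.

(** If no finite set of translates sufficed, the uncovered parts of [A] would form a filter base; a
    cluster point [p] of it is excluded by adding the single translate at [p]. *)
Lemma finite_cover A V : compact A -> nbhs (1 : G) V ->
  exists2 s : seq G, (forall x, x \in s -> A x) &
    forall a, A a -> exists2 x, x \in s & V (a * x^-1).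
Proof.
move=> cA nV; apply: contrapT => nc.
pose U (s : seq G) := [set a | A a /\ forall x, x \in s -> ~ V (a * x^-1)].
pose F := filter_from [set s : seq G | forall x, x \in s -> A x] U.
have PF : ProperFilter F.
  apply: filter_from_proper.
    apply: filter_from_filter; first by exists [::].
    move=> s t As At; exists (s ++ t).
      by move=> x; rewrite mem_cat => /orP[]; [exact: As|exact: At].
    move=> x [Ax h]; split; split=> // y ys; apply: h; rewrite mem_cat ys ?orbT //.
  move=> s As; apply: contrapT => e; apply: nc; exists s => // a Aa.
  apply: contrapT => e2; apply: e; exists a; split => // x xs Vx.
  by apply: e2; exists x.
have [p [Ap clp]] : A `&` cluster F !=set0.
  by apply: cA; exists [::] => // x [].
have nW : nbhs p [set y | V (y * p^-1)].
  by apply: (@nbhs_comp _ (fun z => z * p^-1) p V (@mulgr_cont _)); rewrite mulgV.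
have FU : F (U [:: p]) by exists [:: p] => // x; rewrite inE => /eqP->.
have [y [[_ Uy] Vy]] := clp _ _ FU nW.
by apply: (Uy p); rewrite ?inE.
Qed.

Hypothesis hG : hausdorff_space G.

Lemma closed1 (x : G) : closed [set x].
Proof. by apply: accessible_closed_set1; exact: hausdorff_accessible. Qed.

Lemma cpt_closed A : compact A -> closed A.
Proof. exact: compact_closed. Qed.

Lemma nbhs_neq (x : G) : x <> 1 -> nbhs (1 : G) [set y | y <> x].
Proof.
move=> x1; apply: open_nbhs_nbhs; split; last by move=> /esym.
exact/closed_openC/closed1.
Qed.

Lemma closed_eqfun (X : topologicalType) (f g : X -> G) :
  continuous f -> continuous g -> closed [set x | f x = g x].
Proof.
move=> cf cg.
have -> : [set x | f x = g x] = (fun x => f x * (g x)^-1) @^-1` [set 1].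
  apply/seteqP; split => x /=; first by move=> ->; rewrite mulgV.
  exact: divg1_eq.
apply: closed_comp; last exact: closed1.
by move=> x _; apply: continuous_mulg => //; exact: continuous_invg.
Qed.

Lemma closed_centr A : closed (centr A).
Proof.
have -> : centr A = \bigcap_(a in A) [set x | a * x = x * a].
  by apply/seteqP; split => x cx a Aa; exact: cx.
apply: closed_bigI => a _; apply: closed_eqfun; first exact: mulgl_cont.
exact: mulgr_cont.
Qed.

Lemma closed_forall (X : topologicalType) (I : Type) (P : I -> Prop) (f : I -> X -> G)
  (C : I -> set G) : (forall i, P i -> continuous (f i)) ->
  (forall i, P i -> closed (C i)) -> closed [set x | forall i, P i -> C i (f i x)].
Proof.
move=> cf cC; have -> : [set x | forall i, P i -> C i (f i x)] =
   \bigcap_(i in [set i | P i]) (f i @^-1` C i).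
  by apply/seteqP; split => x h i Pi; exact: h.
apply: closed_bigI => i Pi; apply: closed_comp; last exact: cC.
by move=> x _; exact: cf.
Qed.

(** Inverses are required explicitly because [nrm] is one-sided. The result is the normaliser, see
    [normalizerE]. *)
Definition normr A := [set x : G | nrm A [set x] /\ nrm A [set x^-1]].

Lemma nrm_normr A : nrm A (normr A).
Proof. by move=> a x Aa [h _]; exact: h. Qed.

Lemma sg_normr A : is_subgroup (normr A).
Proof.
split.
- by split=> a _ Aa ->; rewrite ?invg1 conjg1.
- move=> x y [x1 x2] [y1 y2]; split=> a _ Aa ->; rewrite ?invgM conjgM.
    by apply: y1 => //; apply: x1.
  by apply: x2 => //; apply: y2.
- by move=> x [x1 x2]; split => //; rewrite invgK.
Qed.

Lemma closed_normr A : closed A -> closed (normr A).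
Proof.
move=> cA; have -> : normr A =
    [set x | forall a, A a -> A (a ^ x)] `&`
    [set x | forall a, A a -> A (a ^ x^-1)].
  apply/seteqP; split => x [h1 h2]; split.
  - by move=> a Aa; exact: h1.
  - by move=> a Aa; exact: h2.
  - by move=> a _ Aa ->; exact: h1.
  - by move=> a _ Aa ->; exact: h2.
apply: closedI.
  by apply: (@closed_forall G G A (fun a x => a ^ x) (fun=> A)) => // a _;
    exact: conjgr_cont.
apply: (@closed_forall G G A (fun a x => a ^ x^-1) (fun=> A)) => // a _ x.
apply: (@continuous_comp G G G (fun x => x^-1) (fun x => a ^ x)).
  exact: invg_continuous.
exact: conjgr_cont.
Qed.

(** The finitely many cosets of [K] that miss 1 are closed, so a neighbourhood of 1 avoids them all
    and meets [A] only in [K]. *)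
Lemma findex_open K A (s : seq G) : closed K -> is_subgroup K ->
  (forall a, A a -> exists2 x, x \in s & K (a * x^-1)) ->
  exists2 W, nbhs (1 : G) W & A `&` W `<=` K.
Proof.
move=> cK sK cov.
suff [W nW h] : exists2 W, nbhs (1 : G) W &
    forall x, x \in s -> forall a, W a -> K (a * x^-1) -> K x.
  exists W => // a [Aa Wa]; have [x xs Kx] := cov _ Aa.
  have Kx' := h _ xs _ Wa Kx.
  by have := sgM sK Kx Kx'; rewrite mulgVK.
elim: s {cov} => [|x s [W nW IH]]; first by exists setT => //; exact: filterT.
have [Kx|nKx] := pselect (K x).
  by exists W => // y; rewrite inE => /orP[/eqP-> //|]; exact: IH.
exists (W `&` [set a | ~ K (a * x^-1)]).
  apply: filterI => //; apply: (@nbhs_comp _ (fun z => z * x^-1) 1 (~` K)).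
    exact: mulgr_cont.
  apply: open_nbhs_nbhs; split; first exact: closed_openC.
  by rewrite mul1g => /(sgV sK); rewrite invgK.
move=> y; rewrite inE => /orP[/eqP-> a [_ /= h1] h2 //|ys a [Wa _]].
exact: IH Wa.
Qed.

Definition cgen (F : set G) := smallest [set A | is_subgroup A /\ closed A] F.

Lemma cgen_sub F : F `<=` cgen F.
Proof. exact: sub_smallest. Qed.

Lemma cgen_min F A : is_subgroup A -> closed A -> F `<=` A -> cgen F `<=` A.
Proof. by move=> sA cA; apply: smallest_sub. Qed.

Lemma cgen_sg F : is_subgroup (cgen F).
Proof.
split; first by move=> A [[sA _] _]; exact: sg1.
- move=> x y gx gy A [[sA cA] FA]; apply: sgM => //; first exact: gx.
  exact: gy.
- by move=> x gx A [[sA cA] FA]; apply: sgV => //; exact: gx.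
Qed.

Lemma cgen_closed F : closed (cgen F).
Proof. by apply: closed_bigI => A [[_ cA] _]. Qed.

Lemma cgenS F F' : F `<=` F' -> cgen F `<=` cgen F'.
Proof.
move=> FF; apply: cgen_min; [exact: cgen_sg|exact: cgen_closed|].
by apply: subset_trans FF _; exact: cgen_sub.
Qed.

Lemma cgen_nrm F B : nrm F B -> nrm (cgen F) B.
Proof.
move=> nF x b gx Bb; apply: (gx [set x | cgen F (x ^ b)]); split; first split.
- split=> [|u v|u] /=; rewrite ?conj1g ?conjMg ?conjVg.
  + exact: (sg1 (cgen_sg F)).
  + exact: (sgM (cgen_sg F)).
  + exact: (sgV (cgen_sg F)).
- apply: (closed_comp (f := fun x => x ^ b)); last exact: cgen_closed.
  by move=> y _; exact: conjg_cont.
- by move=> y Fy; apply: cgen_sub; exact: nF.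
Qed.

Lemma cgen_cent F B : cent F B -> cent (cgen F) B.
Proof.
move=> cF x b gx Bb; symmetry; apply: (gx (centr B)) => //; split; first split.
- exact: sg_centr.
- exact: closed_centr.
- by move=> y Fy c Bc; rewrite (cF y c).
Qed.

(** The elements normalising a closed set form a closed subgroup, so it suffices to test the
    generators and, [nrm] being one-sided, their inverses. *)
Lemma cgen_normal F B : nrm B F -> nrm B [set x^-1 | x in F] -> closed B ->
  nrm B (cgen F).
Proof.
move=> n1 n2 cB; apply: nrmS (@nrm_normr B) _.
apply: cgen_min; [exact: sg_normr|exact: closed_normr|].
move=> y Fy; split=> b _ Bb ->; first exact: n1.
by apply: n2 => //; exists y.
Qed.

End TopGroupBasics.

(** * Van Dantzig's theorem *)

Section Quasicomponent.
Variables (G : topGroupType) (K : set G) (x0 : G).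
Hypotheses (hG : hausdorff_space G) (cK : compact K) (Kx0 : K x0).
Implicit Types A B : set G.

Definition clopen_in A := [/\ A `<=` K, closed A & closed (K `\` A)].

(** The quasicomponent of [x0] in the compact set [K]. *)
Definition quasi := [set x | forall A, clopen_in A -> A x0 -> A x].

Let clK : closed K. Proof. exact: cpt_closed. Qed.

Lemma clopen_inK : clopen_in K.
Proof. by split => //; rewrite setDv; exact: closed0. Qed.

Lemma clopen_inI A B : clopen_in A -> clopen_in B -> clopen_in (A `&` B).
Proof.
move=> [sA cA cA'] [sB cB cB']; split; first by move=> x [/sA].
- exact: closedI.
- by rewrite setDIr; exact: closedU.
Qed.

Lemma quasi_small (O : set G) : open O -> quasi `<=` O ->
  exists A, [/\ clopen_in A, A x0 & A `<=` O].
Proof.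
move=> oO qO; apply: contrapT => nA.
have cKO : compact (K `\` O).
  apply: (subclosed_compact _ cK) => [|x []//].
  by apply: closedI => //; exact: open_closedC.
have [||A B|A|x [Kx nOx] Fx] :=
    @compact_directed _ _ [set A | clopen_in A /\ A x0] cKO.
- by exists K; split=> //; exact: clopen_inK.
- by move=> A [[]].
- move=> [cA Ax] [cB Bx]; exists (A `&` B) => //; split=> //.
  exact: clopen_inI.
- move=> [cA Ax]; apply: contrapT => ne; apply: nA; exists A; split => //.
  move=> y Ay; apply: contrapT => nOy; apply: ne; exists y; split => //.
  by split => //; case: cA => + _ _; apply.
- by apply: nOx; apply: qO => A cA Ax0; apply: Fx.
Qed.

Lemma closed_quasi : closed quasi.
Proof.
have -> : quasi = \bigcap_(A in [set A | clopen_in A /\ A x0]) A.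
  apply/seteqP; split => x qx A; first by case=> ??; exact: qx.
  by move=> cA Ax; apply: qx.
by apply: closed_bigI => A [[]].
Qed.

Lemma quasi_sub : quasi `<=` K.
Proof. by move=> x; apply => //; exact: clopen_inK. Qed.

(** A group argument in place of normality of compact spaces: all sufficiently small translations
    keep [E] off [F], so thickening both sets by a small enough [W] leaves them disjoint. *)
Lemma compact_separate (E F : set G) : compact E -> compact F ->
  (forall x, E x -> ~ F x) ->
  exists OE OF : set G, [/\ open OE, open OF, E `<=` OE, F `<=` OF &
    forall x, OE x -> ~ OF x].
Proof.
move=> cE cF dEF.
have nEF : \forall v \near (1 : G), E `*` F `<=` [set p | p.1 * v <> p.2].
  apply: (iffLR (compact_near_coveringP _) (compact_setX cE cF)) => -[e f] [/= Ee Ff].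
  have : nbhs ((e, f), (1 : G)) [set q : (G * G) * G | q.1.1 * q.2 <> q.1.2].
    apply: open_nbhs_nbhs; split; last by rewrite /= mulg1 => ef; apply: (dEF e) => //; rewrite ef.
    apply: closed_openC; apply: closed_eqfun => //.
      apply: continuous_mulg => q.
        by apply: cvg_comp; exact: cvg_fst.
      exact: cvg_snd.
    by move=> q; apply: cvg_comp; [exact: cvg_fst|exact: cvg_snd].
  by apply: filterS.
have [V nV VV] := nbhs1M (filterI nEF (nbhs1V nEF)).
have nV' := nbhs1V nV.
pose W := V `&` [set x | V x^-1].
have nW : nbhs (1 : G) W by exact: filterI.
pose O (A : set G) := \bigcup_(a in A) [set x | W° (a^-1 * x)].
have oO A : open (O A).
  apply: bigcup_open => a _.
  apply: (@open_comp _ _ (fun x => a^-1 * x)); last exact: open_interior.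
  by move=> x _; exact: mulgl_cont.
exists (O E), (O F); split => //.
- by move=> x Ex; exists x => //=; rewrite mulVg; exact: nbhs_singleton (nbhs_interior nW).
- by move=> x Ex; exists x => //=; rewrite mulVg; exact: nbhs_singleton (nbhs_interior nW).
move=> x [e Ee /= /interior_subset We] [f Ff /= /interior_subset Wf].
have [h _] : ([set v | E `*` F `<=` [set p | p.1 * v <> p.2]] `&`
   [set x | E `*` F `<=` [set p | p.1 * x^-1 <> p.2]]) (e^-1 * x * (f^-1 * x)^-1).
  by apply: VV; [case: We|case: Wf].
by apply: (h (e, f)); [split|rewrite /=; gsimp].
Qed.

(** If the quasicomponent split into closed parts [E] and [F], disjoint open sets around them would
    cut a clopen set inside their union into two clopen pieces. The piece containing [x0] contains
    the whole quasicomponent, so the other part is empty. *)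
Lemma connected_quasi : connected quasi.
Proof.
move=> B [b Bb] [C oC eC] [D cD eD].
pose E := quasi `&` D; pose F := quasi `&` ~` C.
have cE : closed E by apply: closedI => //; exact: closed_quasi.
have cF : closed F.
  by apply: closedI; [exact: closed_quasi|exact: open_closedC].
have BE : B = E by [].
have EF : forall x, E x -> ~ F x.
  by move=> x Ex [_]; apply; move: Ex; rewrite -BE eC => -[].
have qEF x : quasi x -> E x \/ F x.
  move=> qx; have [Cx|nCx] := pselect (C x); last by right.
  by left; rewrite -BE eC.
have cpE : compact E.
  by apply: (subclosed_compact cE cK) => x [/quasi_sub].
have cpF : compact F.
  by apply: (subclosed_compact cF cK) => x [/quasi_sub].
have [OE [OF [oE oF EO FO dO]]] := compact_separate cpE cpF EF.
have [|A [cA Ax AO]] := quasi_small (openU oE oF).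
  by move=> x /qEF[/EO|/FO]; [left|right].
have cl1 : clopen_in (A `&` OE).
  case: cA => AK clA clA'.
  have e1 : A `&` OE = A `&` ~` OF.
    apply/seteqP; split => x [Ax' h]; split => //; first exact: dO.
    by case: (AO _ Ax').
  split; first by move=> x [/AK].
    by rewrite e1; apply: closedI => //; exact: open_closedC.
  have -> : K `\` (A `&` OE) = (K `\` A) `|` (A `&` ~` OE).
    apply/seteqP; split => x.
      move=> [Kx h]; have [Ax'|] := pselect (A x); last by left.
      by right; split => // ?; apply: h.
    by move=> [[Kx h]|[Ax' h]]; split => //; [move=> []|exact: AK|move=> []].
  by apply: closedU => //; apply: closedI => //; exact: open_closedC.
have cl2 : clopen_in (A `&` OF).
  case: cA => AK clA clA'.
  have e1 : A `&` OF = A `&` ~` OE.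
    apply/seteqP; split => x [Ax' h]; split => //; first by move=> /dO.
    by case: (AO _ Ax').
  split; first by move=> x [/AK].
    by rewrite e1; apply: closedI => //; exact: open_closedC.
  have -> : K `\` (A `&` OF) = (K `\` A) `|` (A `&` ~` OF).
    apply/seteqP; split => x.
      move=> [Kx h]; have [Ax'|] := pselect (A x); last by left.
      by right; split => // ?; apply: h.
    by move=> [[Kx h]|[Ax' h]]; split => //; [move=> []|exact: AK|move=> []].
  by apply: closedU => //; apply: closedI => //; exact: open_closedC.
have qx0 : quasi x0 by move=> ?.
rewrite BE; apply/seteqP; split => [x []//|x qx].
have [//|Fx] := qEF _ qx.
case: (AO _ Ax) => O0.
  by have [_ /dO] := qx _ cl1 (conj Ax O0); move=> /(_ (FO _ Fx)).
have qb : quasi b by move: Bb; rewrite eC => -[].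
have [_ h] := qb _ cl2 (conj Ax O0).
by exfalso; apply: (dO b) => //; apply: EO; rewrite -BE.
Qed.

End Quasicomponent.

Section VanDantzig.
Variable G : topGroupType.
Implicit Types A B K V W U : set G.

Definition cposub U := [/\ is_subgroup U, compact U & open U].
Definition onorm U V := [/\ is_subgroup V, open V, V `<=` U & nrm V U].

Lemma onormU U : cposub U -> onorm U U.
Proof. by move=> [sU _ oU]; split => //; exact: sg_nrm. Qed.

Lemma onormI U V V' : onorm U V -> onorm U V' -> onorm U (V `&` V').
Proof.
move=> [sV oV VU nV] [sV' oV' VU' nV']; split.
- exact: sgI.
- exact: openI.
- by move=> x [/VU].
- exact: nrmI.
Qed.

Lemma onorm_nbhs U V : onorm U V -> nbhs (1 : G) V.
Proof. by move=> [sV oV _ _]; exact: open_sg_nbhs. Qed.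

Lemma onorm_closed U V : onorm U V -> closed V.
Proof. by move=> [sV oV _ _]; exact: open_sg_closed. Qed.

(** The intersection of the [U]-conjugates of [V0] is still a neighbourhood of 1 because [U] is
    compact. *)
Lemma onorm_core U W : cposub U ->
  (exists V, [/\ is_subgroup V, open V & V `<=` W]) ->
  exists2 V, onorm U V & V `<=` W.
Proof.
move=> [sU cU oU] [V0 [sV0 oV0 V0W]].
pose V := [set x | U x /\ forall u, U u -> V0 (x ^ u)].
have sV : is_subgroup V.
  split; first by split; [exact: sg1|move=> u _; rewrite conj1g; exact: sg1].
  - move=> x y [Ux hx] [Uy hy]; split; first exact: sgM.
    by move=> u Uu; rewrite conjMg; apply: sgM => //; [exact: hx|exact: hy].
  - move=> x [Ux hx]; split; first exact: sgV.
    by move=> u Uu; rewrite conjVg; apply: sgV => //; exact: hx.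
have nV : nbhs (1 : G) V.
  have h : \forall x \near (1 : G), U `<=` [set u | V0 (x ^ u)].
    apply: (iffLR (compact_near_coveringP _) cU) => u Uu.
    have : nbhs (u, (1 : G)) [set q | V0 (q.2 ^ q.1)].
      apply: (@nbhs_comp _ _ (fun q : G * G => q.2 ^ q.1) (u, 1) V0).
        apply: (continuous_mulg (G := G)).
          by apply: continuous_invg => q; exact: cvg_fst.
        by apply: continuous_mulg => q; [exact: cvg_snd|exact: cvg_fst].
      by rewrite /= conj1g; exact: open_sg_nbhs.
    by apply: filterS.
  by apply: filterS2 h (open_sg_nbhs sU oU) => x hx Ux; split.
exists V; last by move=> x [_ /(_ 1 (sg1 sU))]; rewrite conjg1; exact: V0W.
split => //; [exact: sg_open|by move=> x []|].
move=> x u [Ux hx] Uu; split; first exact: sgJ.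
by move=> v Uv; rewrite -conjgM; apply: hx; exact: sgM.
Qed.

Hypothesis G_tdlc : tdlc G.

(** The component of 1 is trivial, so a compact neighbourhood of 1 has a small compact open part [A]
    containing 1. The right stabiliser of [A] is an open subgroup, and it lies in [A] because 1
    does. *)
Lemma van_dantzig W : nbhs (1 : G) W ->
  exists V, [/\ is_subgroup V, open V, compact V & V `<=` W].
Proof.
case: G_tdlc => hG lcG tdG nW.
have [K [nK cK clK]] : exists K : set G, [/\ nbhs (1 : G) K, compact K & closed K].
  have [K nK [cK clK]] := lcG 1 Logic.I.
  by exists K; split => //; apply: filterS (nK : nbhs (1 : G) (fun x => setT x -> K x)) => x; apply.
have K1 : K 1 by exact: nbhs_singleton.
pose O := (K `&` W)°.
have oO : open O by exact: open_interior.
have O1 : O 1 by apply: nbhs_singleton; apply: nbhs_interior; exact: filterI.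
have q1 : quasi K 1 `<=` O.
  have : quasi K 1 `<=` connected_component [set: G] 1.
    apply: connected_component_max; last exact: connected_quasi.
      by move=> A _ A1.
    exact: subsetT.
  by rewrite tdG // => h x /h ->.
have [A [[AK clA clA'] A1 AO]] := quasi_small hG cK K1 oO q1.
have oA : open A.
  have -> : A = O `&` ~` (K `\` A).
    apply/seteqP; split=> x; first by move=> Ax; split; [exact: AO|move=> []].
    move=> [/interior_subset[Kx _] h]; apply: contrapT => nA; exact: h.
  by apply: openI => //; exact: closed_openC.
have cA : compact A by exact: (subclosed_compact clA cK).
have nA : \forall x \near (1 : G), A `<=` [set y | A (y * x)].
  apply: (iffLR (compact_near_coveringP _) cA) => y Ay.
  have : nbhs (y, (1 : G)) [set q | A (q.1 * q.2)].
    apply: (@nbhs_comp _ _ (fun q : G * G => q.1 * q.2) (y, 1) A).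
      exact: mulg_continuous.
    by rewrite /= mulg1; apply: open_nbhs_nbhs.
  by apply: filterS.
pose V := [set x | (forall y, A y -> A (y * x)) /\ (forall y, A y -> A (y * x^-1))].
have sV : is_subgroup V.
  split; first by split=> y; rewrite ?invg1 mulg1.
  - move=> x y [x1 x2] [y1 y2]; split=> z Az; rewrite ?invgM mulgA.
      by apply: y1; apply: x1.
    by apply: x2; apply: y2.
  - by move=> x [x1 x2]; split => //; rewrite invgK.
have nV : nbhs (1 : G) V.
  by apply: filterS2 nA (nbhs1V nA) => x h1 h2; split.
have VA : V `<=` A by move=> x [/(_ 1 A1)]; rewrite mul1g.
have oV : open V by exact: sg_open.
exists V; split => //; last first.
  by move=> x /VA/AO/interior_subset[].
by apply: (subclosed_compact _ cA) => //; exact: open_sg_closed.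
Qed.

Lemma onorm_small U W : cposub U -> nbhs (1 : G) W ->
  exists2 V, onorm U V & V `<=` W.
Proof.
move=> cU nW; apply: onorm_core => //.
by have [V [sV oV _ VW]] := van_dantzig nW; exists V.
Qed.

End VanDantzig.

(** * Local isomorphism and similarity *)

Section Subgroups.
Variables (G : topGroupType) (K : subgroup G).

Definition tosub (x : G) : topsub K :=
  if pselect (sg_set K x) is left h then SigSub (mem_set h) else 1.

Lemma valK_tosub x : sg_set K x -> set_val (tosub x) = x.
Proof. by rewrite /tosub; case: pselect. Qed.

Lemma tosubK (y : topsub K) : tosub (set_val y) = y.
Proof.
by apply: eq_sig_hprop => //=; apply: valK_tosub; exact: set_valP.
Qed.

Lemma val_injS (x y : topsub K) : set_val x = set_val y -> x = y.
Proof. by move=> e; rewrite -(tosubK x) e tosubK. Qed.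

Lemma subP (y : topsub K) : sg_set K (set_val y).
Proof. exact: set_valP. Qed.

Lemma val_mulS (x y : topsub K) : set_val (x * y) = set_val x * set_val y.
Proof. by []. Qed.

Lemma val_invS (x : topsub K) : set_val x^-1 = (set_val x)^-1.
Proof. by []. Qed.

Lemma val_oneS : set_val (1 : topsub K) = 1.
Proof. by []. Qed.

Lemma tosubM x y : sg_set K x -> sg_set K y -> tosub (x * y) = tosub x * tosub y.
Proof.
move=> Kx Ky; apply: val_injS; rewrite valK_tosub; last exact: (sgM (sg_subgroup K)).
by rewrite val_mulS !valK_tosub.
Qed.

Lemma tosub1 : tosub 1 = 1.
Proof. by apply: val_injS; rewrite valK_tosub //; exact: (sg1 (sg_subgroup K)). Qed.

Lemma sub_nbhs (W : set (topsub K)) : nbhs (1 : topsub K) W <->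
  exists2 V, nbhs (1 : G) V & forall x : topsub K, V (set_val x) -> W x.
Proof.
split.
  case=> _ [[V oV <-] V1 VW]; exists V => //.
  by apply: open_nbhs_nbhs; split.
case=> V nV h; have : nbhs (1 : topsub K) (set_val @^-1` V).
  by apply: (@sg_val_continuous G K).
by apply: filterS => x; exact: h.
Qed.

End Subgroups.

Lemma gpow_mulE (G : topGroupType) n (x y : gpower G n) i : (x * y) i = x i * y i.
Proof. by []. Qed.

Section GPowerNbhs.
Variables (G : topGroupType) (n : nat).

Lemma gpow_nbhs (O : set (gpower G n)) : nbhs (1 : gpower G n) O <->
  exists2 W, nbhs (1 : G) W & forall x : gpower G n, (forall i, W (x i)) -> O x.
Proof.
split; last first.
  case=> W nW h; suff : nbhs (1 : gpower G n) [set x | forall i, W (x i)].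
    exact: filterS.
  have : \forall x \near (1 : gpower G n), forall i, W (x i).
    apply: (@filter_forall _ _ (fun i (x : gpower G n) => W (x i)) (nbhs (1 : gpower G n))) => i.
    exact: (@gpow_proj_continuous G n i 1 W).
  by [].
pose box W := [set x : gpower G n | forall i, W (x i)].
pose F := filter_from (nbhs (1 : G)) box.
have FF : Filter F.
  apply: filter_from_filter; first by exists setT; exact: filterT.
  move=> P Q nP nQ; exists (P `&` Q); first exact: filterI.
  by move=> x h; split => i; have [] := h i.
have cF : F --> (1 : gpower G n).
  apply/cvg_sup => i U [V [[W oW <-] WfN WU]].
  apply: (filterS WU); exists W; first by apply: open_nbhs_nbhs; split.
  by move=> x h; exact: h.
by move=> /cF[W nW WO]; exists W.
Qed.

End GPowerNbhs.

Section LocalIso.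

(** An isomorphism of germs at 1: with the morphism clause, the last two clauses make [f] a
    homeomorphism from [U] onto a neighbourhood of 1 in [B]. No finite index is asked for; for
    compact groups the notion agrees with commensurability. *)
Definition lociso (A B : topGroupType) := exists (f : A -> B) (U : set A),
  [/\ is_subgroup U /\ nbhs (1 : A) U, {in U &, {morph f : x y / x * y}},
     {in U &, injective f},
     forall W, nbhs (1 : B) W -> nbhs (1 : A) (f @^-1` W)
   & forall W, nbhs (1 : A) W -> nbhs (1 : B) (f @` (U `&` W))].

Lemma morph_in1 (A B : groupType) (f : A -> B) (U : set A) : is_subgroup U ->
  {in U &, {morph f : x y / x * y}} -> f 1 = 1.
Proof.
move=> sU fM; have U1 := mem_set (sg1 sU).
by apply: (mulgI (f 1)); rewrite -fM // !mulg1.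
Qed.

Lemma morph_inV (A B : groupType) (f : A -> B) (U : set A) x : is_subgroup U ->
  {in U &, {morph f : x y / x * y}} -> U x -> f x^-1 = (f x)^-1.
Proof.
move=> sU fM Ux; apply: (mulgI (f x)).
rewrite -fM ?mulgV; [exact: morph_in1 fM|exact: mem_set|].
by apply: mem_set; exact: sgV.
Qed.

Lemma morph_inJ (A B : groupType) (f : A -> B) (U : set A) x y : is_subgroup U ->
  {in U &, {morph f : x y / x * y}} -> U x -> U y -> f (x ^ y) = f x ^ f y.
Proof.
move=> sU fM Ux Uy; rewrite !conjgE !fM ?(morph_inV sU fM) //; apply: mem_set => //.
- exact: sgV.
- exact: sgM.
Qed.

Lemma sg_image (A B : groupType) (f : A -> B) (U : set A) : is_subgroup U ->
  {in U &, {morph f : x y / x * y}} -> is_subgroup (f @` U).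
Proof.
move=> sU fM; split.
- by exists 1; [exact: sg1|exact: morph_in1 fM].
- move=> _ _ [x Ux <-] [y Uy <-]; exists (x * y); first exact: sgM.
  by rewrite fM //; exact: mem_set.
- move=> _ [x Ux <-]; exists x^-1; first exact: sgV.
  exact: morph_inV fM Ux.
Qed.

Lemma lociso_sym A B : lociso A B -> lociso B A.
Proof.
move=> [f [U [[sU nU] fM fI fc fo]]].
have : forall y, exists x, (f @` U) y -> U x /\ f x = y.
  move=> y; have [[x Ux <-]|n] := pselect ((f @` U) y); first by exists x.
  by exists 1 => /n.
move=> /choice[g gP].
have gf x : U x -> g (f x) = x.
  move=> Ux; have [|Ug e] := gP (f x); first by exists x.
  by apply: fI => //; exact: mem_set.
exists g, (f @` U); split.
- split; first exact: sg_image.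
  by apply: filterS (fo _ nU) => _ [x [Ux _] <-]; exists x.
- move=> _ _ /set_mem[x Ux <-] /set_mem[y Uy <-].
  by rewrite -fM ?gf //; [exact: sgM|exact: mem_set|exact: mem_set].
- by move=> _ _ /set_mem[x Ux <-] /set_mem[y Uy <-]; rewrite !gf // => ->.
- move=> W nW; apply: filterS (fo _ nW) => _ [x [Ux Wx] <-] /=.
  by rewrite gf.
- move=> W nW; apply: filterS (filterI nU (fc _ nW)) => x [Ux Wx].
  by exists (f x); [split => //; exists x|exact: gf].
Qed.

Lemma lociso_trans B A C : lociso A B -> lociso B C -> lociso A C.
Proof.
move=> [f [U [[sU nU] fM fI fc fo]]] [g [V [[sV nV] gM gI gc go]]].
have f1 := morph_in1 sU fM.
exists (g \o f), (U `&` f @^-1` V).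
have inU x : x \in U `&` f @^-1` V -> x \in U by move=> /set_mem[? _]; exact: mem_set.
have inV x : x \in U `&` f @^-1` V -> f x \in V by move=> /set_mem[_ ?]; exact: mem_set.
split.
- split; last by apply: filterI => //; exact: fc.
  split; first by split; [exact: sg1|rewrite /= f1; exact: sg1].
  + move=> x y [Ux Vx] [Uy Vy]; split; first exact: sgM.
    by rewrite /= fM; [exact: sgM|exact: mem_set|exact: mem_set].
  + move=> x [Ux Vx]; split; first exact: sgV.
    by rewrite /= (morph_inV sU fM Ux); exact: sgV.
- by move=> x y hx hy /=; rewrite fM ?gM; auto.
- by move=> x y hx hy /= e; apply: fI; auto; apply: gI; auto.
- by move=> W /gc /fc.
- move=> W nW; apply: filterS (go _ (fo _ nW)) => _ [y [Vx [x [Ux Wx] e]] <-]; move: Vx; rewrite -e => Vx.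
  by exists x.
Qed.

Lemma lociso_iso (A B : topGroupType) (f : A -> B) (g : B -> A) :
  {morph f : x y / x * y} -> cancel f g -> cancel g f -> continuous f ->
  continuous g -> lociso A B.
Proof.
move=> fM fg gf cf cg.
have sT : is_subgroup [set: A] by [].
have f1 : f 1 = 1 by apply: (@morph_in1 _ _ _ setT) => // x y _ _; exact: fM.
have g1 : g 1 = 1 by rewrite -f1 fg.
exists f, setT; split.
- by split => //; exact: filterT.
- by move=> x y _ _; exact: fM.
- by move=> x y _ _; exact: (can_inj fg).
- by move=> W nW; apply: cf; rewrite f1.
- move=> W nW; have : nbhs (1 : B) (g @^-1` W) by apply: cg; rewrite g1.
  by apply: filterS => y Wy; exists (g y).
Qed.

Lemma lociso_prod A B A' B' : lociso A A' -> lociso B B' ->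
  lociso (A * B)%type (A' * B')%type.
Proof.
move=> [f [U [[sU nU] fM fI fc fo]]] [g [V [[sV nV] gM gI gc go]]].
exists (fun p => (f p.1, g p.2)), (U `*` V).
have in1 p : p \in U `*` V -> p.1 \in U by move=> /set_mem[? _]; exact: mem_set.
have in2 p : p \in U `*` V -> p.2 \in V by move=> /set_mem[_ ?]; exact: mem_set.
split.
- split; last by exists (U, V) => //.
  split; first by split; exact: sg1.
  + by move=> x y [? ?] [? ?]; split; exact: sgM.
  + by move=> x [? ?]; split; exact: sgV.
- move=> p q hp hq; rewrite /= fM ?gM; auto.
- move=> [a b] [c d] hp hq [e1 e2]; congr (_, _).
    by apply: fI => //; [exact: (in1 (a, b))|exact: (in1 (c, d))].
  by apply: gI => //; [exact: (in2 (a, b))|exact: (in2 (c, d))].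
- move=> W [[P Q] [/= nP nQ] PQW].
  exists (f @^-1` P, g @^-1` Q); first by split; [exact: fc|exact: gc].
  by move=> [a b] [/= Pa Qb]; apply: PQW.
- move=> W [[P Q] [/= nP nQ] PQW].
  exists (f @` (U `&` P), g @` (V `&` Q)); first by split; [exact: fo|exact: go].
  move=> [_ _] [/= [a [Ua Pa] <-] [b [Vb Qb] <-]]; exists (a, b) => //.
  by split => //; exact: (PQW (a, b)).
Qed.

Lemma lociso_pow A B n : lociso A B -> lociso (gpower A n) (gpower B n).
Proof.
move=> [f [U [[sU nU] fM fI fc fo]]].
exists (fun x : gpower A n => (fun i => f (x i)) : gpower B n), [set x | forall i, U (x i)].
have inU (x : gpower A n) i : x \in [set x : gpower A n | forall i, U (x i)] -> x i \in U.
  by move=> /set_mem h; apply: mem_set; exact: h.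
split.
- split; last by apply/gpow_nbhs; exists U.
  split; first by move=> i; exact: sg1.
  + by move=> x y hx hy i; apply: sgM.
  + by move=> x hx i; apply: sgV.
- by move=> x y hx hy; apply/funext => i; apply: fM; exact: inU.
- move=> x y hx hy e; apply/funext => i; apply: fI; try exact: inU.
  by have := congr1 (fun z : gpower B n => z i) e.
- move=> W /gpow_nbhs[V nV VW]; apply/gpow_nbhs; exists (f @^-1` V).
    exact: fc.
  by move=> x h; apply: VW.
- move=> W /gpow_nbhs[V nV VW]; apply/gpow_nbhs; exists (f @` (U `&` V)).
    exact: fo.
  move=> y h.
  have /choice[x xP] : forall i, exists x, (U `&` V) x /\ f x = y i.
    by move=> i; have [a UVa e] := h i; exists a.
  exists x; last by apply/funext => i; case: (xP i).
  by split; [move=> i; case: (xP i) => -[]|apply: VW => i; case: (xP i) => -[]].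
Qed.

Lemma continuous_gpow_app (X : topologicalType) (A : topGroupType) n
  (f : X -> gpower A n) i : continuous f -> continuous (fun x => f x i).
Proof.
move=> cf x; apply: (@continuous_comp X (gpower A n) A f (fun y => y i)).
  exact: cf.
exact: gpow_proj_continuous.
Qed.

Lemma ord_bij (T : finType) m : #|T| = m ->
  exists (h : 'I_m -> T) (h' : T -> 'I_m), cancel h h' /\ cancel h' h.
Proof.
move=> <-; exists enum_val, enum_rank; split.
  exact: enum_valK.
exact: enum_rankK.
Qed.

Lemma lociso_powpow A a c : lociso (gpower (gpower A a) c) (gpower A (a * c)%N).
Proof.
have [|h [h' [hK h'K]]] := @ord_bij ('I_a * 'I_c)%type (a * c)%N.
  by rewrite card_prod !card_ord.
apply: (@lociso_iso _ _
  (fun x : gpower (gpower A a) c => (fun k => x (h k).2 (h k).1) : gpower A (a * c)%N)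
  (fun y => (fun j => (fun i => y (h' (i, j))) : gpower A a))).
- by [].
- by move=> x; apply/funext => j; apply/funext => i; rewrite h'K.
- by move=> y; apply/funext => k; rewrite -surjective_pairing hK.
- apply: continuous_to_gpow => k.
  apply: (@continuous_gpow_app _ A a (fun x : gpower (gpower A a) c => x (h k).2) (h k).1).
  exact: gpow_proj_continuous.
- apply: continuous_to_gpow => j; apply: continuous_to_gpow => i.
  exact: gpow_proj_continuous.
Qed.

Lemma continuous_pair (X Y Z : topologicalType) (f : X -> Y) (g : X -> Z) :
  continuous f -> continuous g -> continuous (fun x => (f x, g x)).
Proof. by move=> cf cg x; apply: cvg_pair; [exact: cf|exact: cg]. Qed.

Lemma lociso_powD A a b : lociso (gpower A a * gpower A b)%type (gpower A (a + b)).
Proof.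
apply: (@lociso_iso (gpower A a * gpower A b)%type (gpower A (a + b))
  (fun p : (gpower A a * gpower A b)%type =>
    (fun k => match fintype.split k with inl i => p.1 i | inr j => p.2 j end) : gpower A (a + b))
  (fun z => ((fun i => z (lshift b i)) : gpower A a,
             (fun j => z (rshift a j)) : gpower A b))).
- by move=> p q; apply/funext => k; rewrite [RHS]gpow_mulE /=; case: (fintype.split k).
- move=> [x y]; apply: (f_equal2 pair); apply/funext => i.
    by rewrite /= (unsplitK (inl i)).
  by rewrite /= (unsplitK (inr i)).
- by move=> z; apply/funext => k; rewrite -{2}(splitK k) /=; case: (fintype.split k).
- apply: continuous_to_gpow => k; case: (fintype.split k) => i.
    by apply: (@continuous_gpow_app _ A a fst i) => x; exact: cvg_fst.
  by apply: (@continuous_gpow_app _ A b snd i) => x; exact: cvg_snd.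
- by apply: (@continuous_pair (gpower A (a + b)) (gpower A a) (gpower A b));
    apply: continuous_to_gpow => i; exact: gpow_proj_continuous.
Qed.

Lemma lociso_prodpow A B n :
  lociso (gpower A n * gpower B n)%type (gpower (A * B)%type n).
Proof.
apply: (@lociso_iso (gpower A n * gpower B n)%type (gpower (A * B)%type n)
  (fun p : (gpower A n * gpower B n)%type =>
    (fun k => (p.1 k, p.2 k)) : gpower (A * B)%type n)
  (fun z => ((fun i => (z i).1) : gpower A n, (fun i => (z i).2) : gpower B n))).
- by [].
- by move=> [x y].
- by move=> z; apply/funext => k; rewrite -surjective_pairing.
- apply: continuous_to_gpow => k; apply: (@continuous_pair _ A B).
    by apply: (@continuous_gpow_app _ A n fst k) => x; exact: cvg_fst.
  by apply: (@continuous_gpow_app _ B n snd k) => x; exact: cvg_snd.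
- apply: (@continuous_pair (gpower (A * B)%type n) (gpower A n) (gpower B n));
    apply: continuous_to_gpow => i z.
    apply: (@continuous_comp _ (A * B)%type A (fun z : gpower (A * B)%type n => z i) fst).
      exact: gpow_proj_continuous.
    exact: cvg_fst.
  apply: (@continuous_comp _ (A * B)%type B (fun z : gpower (A * B)%type n => z i) snd).
    exact: gpow_proj_continuous.
  exact: cvg_snd.
Qed.

Definition sim (A B : topGroupType) := exists a b : nat,
  [/\ (0 < a)%N, (0 < b)%N & lociso (gpower A a) (gpower B b)].

Lemma sim_lociso A B : lociso A B -> sim A B.
Proof. by move=> h; exists 1%N, 1%N; split => //; exact: lociso_pow. Qed.

Lemma sim_sym A B : sim A B -> sim B A.
Proof. by move=> [a [b [a0 b0 h]]]; exists b, a; split => //; exact: lociso_sym. Qed.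

Lemma pow_scale A B a b c : lociso (gpower A a) (gpower B b) ->
  lociso (gpower A (a * c)%N) (gpower B (b * c)%N).
Proof.
move=> h; apply: (lociso_trans (lociso_sym (lociso_powpow A a c))).
exact: (lociso_trans (lociso_pow c h) (lociso_powpow B b c)).
Qed.

Lemma sim_trans B A C : sim A B -> sim B C -> sim A C.
Proof.
move=> [a [b [a0 b0 h]]] [c [d [c0 d0 k]]].
exists (a * c)%N, (d * b)%N; split; rewrite ?muln_gt0 ?a0 ?b0 ?c0 ?d0 //.
apply: (lociso_trans (pow_scale c h)); rewrite (mulnC b c).
exact: pow_scale.
Qed.

Lemma sim_prod H A B : sim H A -> sim H B -> sim H (A * B)%type.
Proof.
move=> [a [b [a0 b0 h]]] [c [d [c0 d0 k]]].
(* From [H^a ~ A^b] and [H^c ~ B^d]: both factors are brought to the exponent [b * d], matching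
   [H^(a*d)] with the first and [H^(c*b)] with the second. *)
exists (a * d + c * b)%N, (b * d)%N; split; rewrite ?addn_gt0 ?muln_gt0 ?a0 ?b0 ?c0 ?d0 //.
apply: (lociso_trans (lociso_sym (lociso_powD H (a * d)%N (c * b)%N))).
apply: lociso_trans (lociso_prodpow A B (b * d)%N).
apply: lociso_prod; first exact: pow_scale.
by rewrite [(b * d)%N]mulnC; exact: pow_scale.
Qed.

End LocalIso.

Section Injections.
Variables (X Y : topologicalType) (f : X -> Y).
Hypotheses (cf : continuous f) (fI : injective f).

Lemma inj_hausdorff : hausdorff_space Y -> hausdorff_space X.
Proof.
move=> hY p q cpq; apply: fI; apply: hY => P Q nP nQ.
by have [x [Px Qx]] := cpq _ _ (cf nP) (cf nQ); exists (f x).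
Qed.

Lemma inj_td : totally_disconnected [set: Y] -> totally_disconnected [set: X].
Proof.
move=> tY x _; apply/seteqP; split => [y Cy|_ ->]; last first.
  exact: connected_component_refl.
apply: fI; have : (f @` connected_component [set: X] x) `<=` [set f x].
  rewrite -(tY (f x)) //; apply: connected_component_max.
  - by exists x => //; exact: connected_component_refl.
  - exact: subsetT.
  - apply: connected_continuous_connected; last exact: continuous_subspaceT.
    exact: component_connected.
by apply; exists y.
Qed.

End Injections.

Section LocalIso.

Lemma hom_continuous (A B : topGroupType) (f : A -> B) :
  {morph f : x y / x * y} ->
  (forall W, nbhs (1 : B) W -> nbhs (1 : A) (f @^-1` W)) -> continuous f.
Proof.
move=> fM fc x W /nbhs_translate/fc h; rewrite nbhs_simpl /=.
by apply/nbhs_translate; apply: filterS h => y /=; rewrite /= fM.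
Qed.

(** Closed sets are compact and have compact, hence closed, images; so an injective continuous
    homomorphism from a compact group is open onto its image. *)
Lemma lociso_compact (A B : topGroupType) (f : A -> B) :
  compact [set: A] -> hausdorff_space B -> {morph f : x y / x * y} ->
  injective f -> continuous f -> nbhs (1 : B) (range f) -> lociso A B.
Proof.
move=> cA hB fM fI cf nf.
have sT : is_subgroup [set: A] by [].
have f1 : f 1 = 1 by apply: (@morph_in1 _ _ _ setT) => // x y _ _; exact: fM.
exists f, setT; split.
- by split => //; exact: filterT.
- by move=> x y _ _; exact: fM.
- by move=> x y _ _; exact: fI.
- by move=> W nW; apply: cf; rewrite f1.
- move=> W nW.
  have cC : closed (f @` ~` W°).
    apply: cpt_closed => //; apply: compact_image => //.
    apply: (subclosed_compact _ cA) => //.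
    by apply: open_closedC; exact: open_interior.
  have nC : nbhs (1 : B) (~` (f @` ~` W°)).
    apply: open_nbhs_nbhs; split; first exact: closed_openC.
    move=> [x nWx]; rewrite -f1 => /fI xx; apply: nWx; rewrite xx.
    by apply: nbhs_singleton; exact: nbhs_interior.
  apply: filterS (filterI nf nC) => _ [[x _ <-] h]; exists x => //; split => //.
  apply: interior_subset; apply: contrapT => nx; apply: h; by exists x.
Qed.

Section Sub.
Variables (G : topGroupType) (K : subgroup G).

Lemma compact_topsub : compact (sg_set K) -> compact [set: topsub K].
Proof.
move=> cK F PF _; pose F' := (set_val : topsub K -> G) @ F.
have [x [Kx clx]] : sg_set K `&` cluster F' !=set0.
  apply: (cK F' _); apply: (@filterS _ F _ setT) => [y _|]; last exact: filterT.
  exact: (@subP _ K y).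
exists (tosub K x); split => // A B FA nB.
have [_ [[V oV <-] Vx VB]] := nB.
have : F (set_val @^-1` (set_val @` A)) by apply: filterS FA => y Ay; exists y.
move=> /clx/(_ (open_nbhs_nbhs (conj oV _)))[].
  by move: Vx; rewrite /= valK_tosub.
move=> _ [[y Ay <-] Vy]; exists y; split => //; exact: VB.
Qed.

Lemma topsub_compact : compact [set: topsub K] -> compact (sg_set K).
Proof.
move=> c; have -> : sg_set K = (set_val : topsub K -> G) @` setT.
  apply/seteqP; split => [x Kx|_ [y _ <-]]; last exact: subP.
  by exists (tosub K x) => //; exact: valK_tosub.
by apply: compact_image => //; exact: sg_val_continuous.
Qed.

Lemma topsub_profinite : hausdorff_space G -> totally_disconnected [set: G] ->
  compact (sg_set K) -> profinite (topsub K).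
Proof.
move=> hG tG cK; split.
- exact: (inj_hausdorff (@sg_val_continuous G K) (@val_injS G K)).
- exact: compact_topsub.
- exact: (inj_td (@sg_val_continuous G K) (@val_injS G K)).
Qed.

Lemma lociso_sub (A : topGroupType) (f : A -> G) V :
  hausdorff_space G -> compact [set: A] -> {morph f : x y / x * y} ->
  injective f -> continuous f -> (forall x, sg_set K (f x)) ->
  nbhs (1 : G) V -> sg_set K `&` V `<=` range f -> lociso A (topsub K).
Proof.
move=> hG cA fM fI cf fK nV Vf; apply: (@lociso_compact _ _ (tosub K \o f)) => //.
- exact: (inj_hausdorff (@sg_val_continuous G K) (@val_injS G K)).
- by move=> x y /=; rewrite fM tosubM.
- by move=> x y /= /(congr1 set_val); rewrite !valK_tosub //; exact: fI.
- apply: continuous_to_sg; have -> : set_val \o (tosub K \o f) = f => //.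
  by apply/funext => x /=; rewrite valK_tosub.
- apply/sub_nbhs; exists V => // x Vx.
  have [a _ e] := Vf _ (conj (subP x) Vx).
  by exists a => //=; rewrite e tosubK.
Qed.

End Sub.

Lemma finite_index_compact (A : topGroupType) (U : subgroup A) :
  compact [set: A] -> nbhs (1 : A) U -> finite_index U.
Proof.
move=> cA nU; have [s _ sP] := finite_cover cA nU.
apply: (@sub_finite_set _ _ [set [set g^-1 * u | u in sg_set U] | g in [set` s]]).
  (* [finite_cover] produces right cosets while [finite_index] counts left ones, hence the
     inversions. *)
  move=> _ [g _ <-]; have [x xs Ux] := sP g^-1 Logic.I.
  exists x => //; have sU := sg_subgroup U.
  apply/seteqP; split => _ [u Uu <-].
    by exists (g^-1 * x^-1 * u); [exact: sgM|gsimp].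
  by exists (x * g * u); [apply: sgM => //; move: (sgV sU Ux); rewrite invgM !invgK|gsimp].
by apply: finite_image; exact: finite_seq.
Qed.

Lemma lociso_commensurable (A B : topGroupType) : compact [set: A] ->
  compact [set: B] -> lociso A B -> commensurable A B.
Proof.
move=> cA cB [f [U [[sU nU] fM fI fc fo]]].
have sV := sg_image sU fM.
have nV : nbhs (1 : B) (f @` U).
  by apply: filterS (fo _ nU) => _ [x [Ux _] <-]; exists x.
pose U1 := Subgroup sU; pose U2 := Subgroup sV.
exists U1, U2; split.
- by split; [exact: sg_open|exact: finite_index_compact].
- by split; [exact: sg_open|exact: finite_index_compact].
have : forall y, exists x, (f @` U) y -> U x /\ f x = y.
  move=> y; have [[x Ux <-]|n] := pselect ((f @` U) y); first by exists x.
  by exists 1 => /n.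
move=> /choice[g gP].
have gf x : U x -> g (f x) = x.
  move=> Ux; have [|Ug e] := gP (f x); first by exists x.
  by apply: fI => //; exact: mem_set.
have Uv (x : topsub U1) : U (set_val x) by exact: (@subP _ U1).
have Vv (x : topsub U2) : (f @` U) (set_val x) by exact: (@subP _ U2).
pose F (x : topsub U1) : topsub U2 := tosub U2 (f (set_val x)).
pose H (y : topsub U2) : topsub U1 := tosub U1 (g (set_val y)).
have vF x : set_val (F x) = f (set_val x).
  by apply: (@valK_tosub _ U2); exists (set_val x).
have vH y : set_val (H y) = g (set_val y).
  by apply: (@valK_tosub _ U1); have [] := gP _ (Vv y).
have FM : {morph F : x y / x * y}.
  move=> x y; apply: val_injS; rewrite val_mulS !vF val_mulS fM //; exact: mem_set.
have FH : cancel F H.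
  by move=> x; apply: val_injS; rewrite vH vF gf.
have HF : cancel H F.
  by move=> x; apply: val_injS; rewrite vF vH; have [] := gP _ (Vv x).
have HM : {morph H : x y / x * y}.
  by move=> x y; rewrite -{1}(HF x) -{1}(HF y) -FM FH.
exists F; split => //; split.
  apply: hom_continuous => // W /sub_nbhs[V nV' VW].
  apply/sub_nbhs; exists (f @^-1` V); first exact: fc.
  by move=> x Vx; apply: VW; rewrite vF.
exists H; split => //; apply: hom_continuous => // W /sub_nbhs[V nV' VW].
apply/sub_nbhs; exists (f @` (U `&` V)); first exact: fo.
by move=> y [x [Ux Vx] e]; apply: VW; rewrite vH -e gf.
Qed.

Lemma commensurable_lociso (A B : topGroupType) : commensurable A B -> lociso A B.
Proof.
move=> [U1 [U2 [[oU1 _] [oU2 _] [F [FM [cF [H [FH HF cH]]]]]]]].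
have sU := sg_subgroup U1.
have HM : {morph H : x y / x * y}.
  by move=> x y; rewrite -{1}(HF x) -{1}(HF y) -FM FH.
have F1 : F 1 = 1 by apply: (@morph_in1 _ _ _ setT) => // x y _ _; exact: FM.
have H1 : H 1 = 1 by rewrite -F1 FH.
exists (fun x => set_val (F (tosub U1 x))), U1; split.
- by split => //; exact: open_sg_nbhs.
- by move=> x y /set_mem Ux /set_mem Uy; rewrite tosubM // FM.
- move=> x y /set_mem Ux /set_mem Uy /val_injS/(can_inj FH)/(congr1 set_val).
  by rewrite !valK_tosub.
- move=> W nW; have /cF : nbhs (F 1) (set_val @^-1` W).
    by rewrite F1; apply: (@sg_val_continuous B U2).
  move=> /sub_nbhs[V nV VW]; apply: filterS (filterI nV (open_sg_nbhs sU oU1)).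
  by move=> x [Vx Ux]; apply: (VW (tosub U1 x)); rewrite valK_tosub.
- move=> W nW; have /cH : nbhs (H 1) (set_val @^-1` W).
    by rewrite H1; apply: (@sg_val_continuous A U1).
  move=> /sub_nbhs[V nV VW].
  apply: filterS (filterI nV (open_sg_nbhs (sg_subgroup U2) oU2)) => y [Vy Uy].
  exists (set_val (H (tosub U2 y))).
    by split; [exact: subP|apply: (VW (tosub U2 y)); rewrite valK_tosub].
  by rewrite tosubK HF valK_tosub.
Qed.

Lemma similar_sim A B : similar A B -> sim A B.
Proof.
move=> [a [b [a0 b0 h]]]; exists a, b; split => //.
exact: commensurable_lociso.
Qed.

Lemma compact_gpow (A : topGroupType) n : compact [set: A] -> compact [set: gpower A n].
Proof.
move=> cA; have := @tychonoff 'I_n (fun=> A) (fun=> setT) (fun=> cA).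
by congr compact; apply/seteqP; split.
Qed.

Lemma sim_similar (A B : topGroupType) : compact [set: A] -> compact [set: B] -> sim A B -> similar A B.
Proof.
move=> cA cB [a [b [a0 b0 h]]]; exists a, b; split => //.
by apply: lociso_commensurable => //; exact: compact_gpow.
Qed.

End LocalIso.

Lemma normalizerE (G : topGroupType) (K : subgroup G) : normalizer K = normr K.
Proof.
apply/seteqP; split => g.
  move=> e; split=> a _ Ka ->; first by rewrite -e; exists a.
  have : [set k ^ g | k in sg_set K] a by rewrite e.
  by move=> [k Kk <-]; rewrite conjgK.
move=> [h1 h2]; apply/seteqP; split => [_ [k Kk <-]|k Kk]; first exact: h1.
by exists (k ^ g^-1); [exact: h2|rewrite conjgKV].
Qed.

(** * Subgroups belonging to a similarity class *)

Section Class.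
Variable S : topGroupType -> Prop.
Hypothesis S_class : profinite_similarity_class S.

(** The proof that [A] is a subgroup is hidden inside, so that membership is a predicate on sets;
    its choice is immaterial by proof irrelevance. *)
Definition inS (G : topGroupType) (A : set G) :=
  exists sA : is_subgroup A, S (topsub (Subgroup sA)).

Lemma S_profinite H : S H -> profinite H.
Proof. by case: S_class => H0 _ h /h[]. Qed.

Lemma S_sim H H' : S H -> profinite H' -> sim H H' -> S H'.
Proof.
case: S_class => H0 pH0 h /h[pH sH] pH' sHH'; apply/h; split => //.
apply: sim_similar; [by case: pH0|by case: pH'|].
by apply: sim_trans sHH'; exact: similar_sim.
Qed.

Lemma S_S_sim H H' : S H -> S H' -> sim H H'.
Proof.
case: S_class => H0 pH0 h /h[pH sH] /h[pH' sH'].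
by apply: sim_trans (similar_sim sH'); apply: sim_sym; exact: similar_sim.
Qed.

Lemma inS_sg (G : topGroupType) (A : set G) : inS A -> is_subgroup A.
Proof. by case. Qed.

Lemma inS_compact (G : topGroupType) (A : set G) : inS A -> compact A.
Proof.
by move=> [sA /S_profinite[_ cA _]]; exact: (@topsub_compact G (Subgroup sA)).
Qed.

Section OneGroup.
Variable G : topGroupType.
Hypotheses (hG : hausdorff_space G) (tG : totally_disconnected [set: G]).
Implicit Types A B K V W X : set G.

Lemma inS_closed A : inS A -> closed A.
Proof. by move=> /inS_compact; exact: cpt_closed. Qed.

Lemma S_lociso_inS (H : topGroupType) A (sA : is_subgroup A) : S H -> compact A ->
  lociso H (topsub (Subgroup sA)) -> inS A.
Proof.
move=> SH cA h; exists sA; apply: (S_sim SH); last exact: sim_lociso.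
exact: topsub_profinite.
Qed.

Lemma inS_lociso_S (H : topGroupType) A (sA : is_subgroup A) : inS A ->
  profinite H -> lociso H (topsub (Subgroup sA)) -> S H.
Proof.
move=> [sA' SA] pH h; apply: (S_sim SA) => //; apply: sim_lociso.
by apply: lociso_sym; rewrite (Prop_irrelevance sA' sA).
Qed.

End OneGroup.

Lemma sub_lociso (G1 G2 : topGroupType) (f : G1 -> G2) (A : set G1) (B V : set G2)
    (sA : is_subgroup A) (sB : is_subgroup B) :
  hausdorff_space G2 -> compact A ->
  (forall x y, A x -> A y -> f (x * y) = f x * f y) ->
  (forall x y, A x -> A y -> f x = f y -> x = y) ->
  (forall W, nbhs (1 : G2) W -> exists2 V, nbhs (1 : G1) V &
     forall x, A x -> V x -> W (f x)) ->
  (forall x, A x -> B (f x)) -> nbhs (1 : G2) V -> B `&` V `<=` f @` A ->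
  lociso (topsub (Subgroup sA)) (topsub (Subgroup sB)).
Proof.
move=> hG cA fM fI fc fB nV Vf.
have Av (x : topsub (Subgroup sA)) : A (set_val x) by exact: (@subP _ (Subgroup sA)).
have fM' : {morph (fun x : topsub (Subgroup sA) => f (set_val x)) : x y / x * y}.
  by move=> x y; rewrite val_mulS fM.
apply: (@lociso_sub _ (Subgroup sB) _ (fun x => f (set_val x)) V) => //.
- exact: (@compact_topsub _ (Subgroup sA)).
- by move=> x y /fI e; apply: val_injS; apply: e; exact: Av.
- apply: hom_continuous => // W /fc[V' nV' h]; apply/sub_nbhs; exists V' => //.
  by move=> x; apply: h.
- by move=> x; exact: fB.
- move=> y /Vf[x Ax <-]; exists (tosub (Subgroup sA) x) => //.
  by rewrite (@valK_tosub _ (Subgroup sA)).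
Qed.

Section OneGroup2.
Variable G : topGroupType.
Hypotheses (hG : hausdorff_space G) (tG : totally_disconnected [set: G]).
Implicit Types A B K V W X : set G.

(** Membership depends only on the germ at 1: the inclusion of a relatively open compact subgroup is
    a local isomorphism. *)
Lemma inS_open A B W : is_subgroup A -> compact A -> is_subgroup B -> compact B ->
  A `<=` B -> nbhs (1 : G) W -> B `&` W `<=` A -> inS A <-> inS B.
Proof.
move=> sA cA sB cB AB nW WA.
have h : lociso (topsub (Subgroup sA)) (topsub (Subgroup sB)).
  apply: (@sub_lociso G G id A B W) => //.
  - by move=> V nV; exists V.
  - by move=> x /WA Ax; exists x.
split=> [[sA' SA]|sB'].
  apply: (@S_lociso_inS G hG tG (topsub (Subgroup sA)) B sB) => //.
  by rewrite (Prop_irrelevance sA sA').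
exists sA; apply: (@inS_lociso_S G _ B sB) => //.
exact: topsub_profinite.
Qed.

Lemma inS_iso A B (f : G -> G) : inS A -> compact B ->
  (forall x y, A x -> A y -> f (x * y) = f x * f y) ->
  (forall x y, A x -> A y -> f x = f y -> x = y) ->
  (forall W, nbhs (1 : G) W -> exists2 V, nbhs (1 : G) V &
     forall x, A x -> V x -> W (f x)) ->
  f @` A = B -> inS B.
Proof.
move=> iA cB fM fI fc fAB; have sA := inS_sg iA.
have sB : is_subgroup B.
  rewrite -fAB; apply: sg_image => //.
  by move=> x y /set_mem Ax /set_mem Ay; exact: fM.
case: (iA) => sA' SA.
apply: (@S_lociso_inS G hG tG (topsub (Subgroup sA')) B sB) => //.
apply: (@sub_lociso G G f A B setT) => //.
- exact: inS_compact.
- by move=> x Ax; rewrite -fAB; exists x.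
- exact: filterT.
- by rewrite fAB => x [].
Qed.

Lemma inS_conj A g : inS A -> inS [set x ^ g | x in A].
Proof.
move=> iA; apply: (@inS_iso A _ (fun x => x ^ g)) => //.
- apply: compact_image; [exact: conjg_cont|exact: inS_compact].
- by move=> x y _ _; exact: conjMg.
- by move=> x y _ _ /conjg_inj.
- move=> W nW; exists [set x | W (x ^ g)] => //.
  by apply: (@nbhs_comp G G (fun x => x ^ g) 1 W (@conjg_cont G g)); rewrite conj1g.
Qed.

Lemma inS_smul A B : inS A -> inS B -> cent A B -> meet1 A B -> inS (smul A B).
Proof.
move=> iA iB cAB mAB; case: (iA) => sA SA; case: (iB) => sB SB.
have sAB : is_subgroup (smul A B) by apply: sg_smul => //; exact: cent_nrm.
have cA := inS_compact iA; have cB := inS_compact iB.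
case: (S_class) => H0 pH0 h.
have /h[pA sHA] := SA; have /h[pB sHB] := SB.
pose P : topGroupType := (topsub (Subgroup sA) * topsub (Subgroup sB))%type.
have hP : sim H0 P by apply: sim_prod; exact: similar_sim.
exists sAB; apply/h; have pAB : profinite (topsub (Subgroup sAB)).
  apply: topsub_profinite => //; exact: compact_smul.
split => //; apply: sim_similar; [by case: pH0|by case: pAB|].
apply: (sim_trans hP); apply: sim_lociso.
have Av (x : topsub (Subgroup sA)) : A (set_val x) by exact: (@subP _ (Subgroup sA)).
have Bv (x : topsub (Subgroup sB)) : B (set_val x) by exact: (@subP _ (Subgroup sB)).
pose f (p : P) : G := set_val p.1 * set_val p.2.
have fM : {morph f : x y / x * y}.
  move=> [a b] [c d]; have -> : f ((a, b) * (c, d)) =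
    (set_val a * set_val c) * (set_val b * set_val d) by [].
  rewrite /f /= !mulgA; congr (_ * _).
  by rewrite -!mulgA; congr (_ * _); rewrite (cAB (set_val c) (set_val b)).
have f1K p : f p = 1 -> p = 1.
  case: p => a b; rewrite /f /= => e; have e' : set_val a = (set_val b)^-1.
    by apply: divg1_eq; rewrite invgK.
  have a1 : set_val a = 1.
    by apply: mAB => //; rewrite e'; apply: sgV.
  have b1 : set_val b = 1 by move: e'; rewrite a1 => /esym/eqP; rewrite invg_eq1 => /eqP.
  by apply: (f_equal2 pair); [exact: (@val_injS _ (Subgroup sA) a 1)|exact: (@val_injS _ (Subgroup sB) b 1)].
apply: (@lociso_sub G (Subgroup sAB) P f setT) => //.
- have := compact_setX (@compact_topsub _ (Subgroup sA) cA) (@compact_topsub _ (Subgroup sB) cB).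
  by congr compact; apply/seteqP; split.
- move=> p q e; apply: divg1_eq; apply: f1K; rewrite fM e -fM mulgV.
  by rewrite /f /= mulg1.
- apply: continuous_mulg => p.
    by apply: cvg_comp; [exact: cvg_fst|exact: (@sg_val_continuous G (Subgroup sA))].
  by apply: cvg_comp; [exact: cvg_snd|exact: (@sg_val_continuous G (Subgroup sB))].
- by move=> [a b]; exists (set_val a); [exact: Av|exists (set_val b); [exact: Bv|]].
- exact: filterT.
- move=> x [/= [a Aa [b Bb <-]] _].
  exists (tosub (Subgroup sA) a, tosub (Subgroup sB) b) => //.
  by rewrite /f /= (@valK_tosub _ (Subgroup sA)) // (@valK_tosub _ (Subgroup sB)).
Qed.

Hypothesis S_mono : forall H, S H -> monomial H.

Lemma inS_infinite A : inS A -> infinite_set A.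
Proof.
move=> [sA SA] fA; have [_ nd _] := S_mono SA; apply: nd => D.
have [hD _ _] := S_profinite SA.
rewrite -[D]setCK; apply: closed_openC.
apply: (iffLR accessible_finite_set_closed (hausdorff_accessible hD)).
apply: (@sub_finite_set _ _ (tosub (Subgroup sA) @` A)); last exact: finite_image.
move=> x _; exists (set_val x); last exact: tosubK.
exact: (@subP _ (Subgroup sA)).
Qed.

(** Here similarity of a monomial group to its closed locally normal subgroups enters, at exponent
    1: [K] is transported into [gpower _ 1], where the traces of [W] and of its inverse normalise
    it. *)
Lemma inS_normal A K W : inS A -> is_subgroup K -> closed K -> K `<=` A ->
  nbhs (1 : G) W -> nrm K (A `&` W) -> infinite_set K -> inS K.
Proof.
move=> iA sK clK KA nW nK infK; case: (iA) => sA SA.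
pose TA := topsub (Subgroup sA).
have vA (x : TA) : A (set_val x) by exact: (@subP _ (Subgroup sA)).
pose v (x : gpower TA 1) : G := set_val (x ord0).
have cv : continuous v.
  move=> x; apply: (@continuous_comp (gpower TA 1) TA G (fun x => x ord0) set_val).
    exact: gpow_proj_continuous.
  exact: (@sg_val_continuous G (Subgroup sA)).
pose L0 : set (gpower TA 1) := v @^-1` K.
have sL0 : is_subgroup L0.
  split; first exact: (sg1 sK).
  - by move=> x y Lx Ly; apply: (sgM sK).
  - by move=> x Lx; apply: (sgV sK).
have vJ x y : v (x ^ y) = v x ^ v y by [].
have vI x y : v x = v y -> x = y.
  by move=> e; apply/funext => i; rewrite ord1; exact: val_injS.
pose w (g : G) : gpower TA 1 := fun=> tosub (Subgroup sA) g.
have vw g : A g -> v (w g) = g.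
  by move=> Ag; rewrite /v /w (@valK_tosub _ (Subgroup sA)).
pose L := Subgroup sL0.
have [pA _ mA] := S_mono SA.
have SL : similar TA (topsub L).
  apply: mA.
  - by apply: closed_comp => // x _; exact: cv.
  - rewrite /locally_normal normalizerE; apply: sg_open; first exact: sg_normr.
    have nW' : nbhs (1 : gpower TA 1) [set x | W (v x) /\ W (v x)^-1].
      apply: filterI.
        by apply: (@nbhs_comp _ _ v 1 W).
      by apply: (@nbhs_comp _ _ v 1 [set x | W x^-1]) => //; exact: nbhs1V.
    apply: filterS nW' => y [Wy Wy']; split=> x _ Lx ->.
      exact: (nK (v x) (v y) Lx (conj (vA _) Wy)).
    exact: (nK (v x) (v y)^-1 Lx (conj (sgV sA (vA _)) Wy')).
  - move=> fL; apply: infK; apply: (@sub_finite_set _ _ (v @` L0)); last exact: finite_image.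
    by move=> x Kx; exists (w x); rewrite /L0 /= ?vw //; exact: KA.
have cK : compact K by apply: (subclosed_compact clK (inS_compact iA)).
have cL : compact (sg_set L).
  apply: (@subclosed_compact _ _ setT) => //.
    by apply: closed_comp => // x _; exact: cv.
  by apply: compact_gpow; case: (S_profinite SA).
apply: (@S_lociso_inS G hG tG (topsub L) K sK) => //.
  apply: (S_sim SA); last exact: similar_sim.
  by apply: topsub_profinite => //; [exact: inj_hausdorff cv _ hG|exact: inj_td cv _ tG].
apply: (@sub_lociso _ G v L0 K setT) => //.
- by move=> x y _ _; exact: vI.
- move=> V nV; exists (v @^-1` V); last by [].
  by apply: (@nbhs_comp _ _ v 1 V).
- exact: filterT.
- by move=> x [Kx _]; exists (w x); rewrite /L0 /= ?vw //; exact: KA.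
Qed.

End OneGroup2.

(* An open subgroup of N embeds in a power of X; [g i] are the components. *)
Lemma transfer (G : topGroupType) (U N X : set G) : tdlc G -> cposub U ->
  inS N -> inS X ->
  exists (b : nat) (g : 'I_b -> G -> G) (V2 V : set G),
  [/\ onorm U V2 /\ onorm U V,
     forall i x y, (N `&` V2) x -> (N `&` V2) y -> g i (x * y) = g i x * g i y,
     forall i x, (N `&` V2) x -> (X `&` V) (g i x),
     (forall i O, nbhs (1 : G) O -> exists2 O', nbhs (1 : G) O' &
        forall x, N x -> O' x -> O (g i x)) /\
     (forall x, (N `&` V2) x -> (forall i, g i x = 1) -> x = 1)
   & forall i K, K `<=` N `&` V2 -> nrm K N -> nrm (g i @` K) (X `&` V)].
Proof.
move=> Gt cU [sN SN] [sX SX].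
have [a [b [a0 b0 [f [D [[sD nD] fM fI fc fo]]]]]] := S_S_sim SN SX.
pose TN := topsub (Subgroup sN); pose TX := topsub (Subgroup sX).
pose tN := tosub (Subgroup sN); pose tX := tosub (Subgroup sX).
have vN (x : TN) : N (set_val x) by exact: (@subP _ (Subgroup sN)).
have vX (x : TX) : X (set_val x) by exact: (@subP _ (Subgroup sX)).
pose i0 : 'I_a := Ordinal a0.
pose e (n : G) : gpower TN a := fun i => if i == i0 then tN n else 1.
have eM x y : N x -> N y -> e (x * y) = e x * e y.
  move=> Nx Ny; apply/funext => i; rewrite gpow_mulE /e; case: ifP => _.
    by rewrite /tN tosubM.
  by rewrite mulg1.
have e1 : e 1 = 1.
  by apply/funext => i; rewrite /e /tN tosub1; case: ifP.
have eV x : N x -> e x^-1 = (e x)^-1.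
  by move=> Nx; apply: (mulgI (e x)); rewrite -eM ?mulgV //; exact: sgV.
have enb O : nbhs (1 : gpower TN a) O -> exists2 O', nbhs (1 : G) O' &
    forall x, N x -> O' x -> O (e x).
  move=> /gpow_nbhs[W /sub_nbhs[W' nW' WW'] WO]; exists W' => // x Nx W'x.
  apply: WO => i; rewrite /e; case: ifP => _; apply: WW'.
    by rewrite /tN (@valK_tosub _ (Subgroup sN)).
  by rewrite val_oneS; exact: nbhs_singleton.
have nfD : nbhs (1 : gpower TX b) (f @` D).
  by apply: filterS (fo _ nD) => _ [x [Dx _] <-]; exists x.
have [W /sub_nbhs[W' nW' WW'] WD] := iffLR (gpow_nbhs _) nfD.
have [V oV VW'] := onorm_small Gt cU nW'.
have sV : is_subgroup V by case: oV.
pose Y := [set y : gpower TX b | forall i, V (set_val (y i))].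
have YD : Y `<=` f @` D by move=> y Yy; apply: WD => i; apply: WW'; exact: VW'.
have nY : nbhs (1 : gpower TX b) Y.
  apply/gpow_nbhs; exists (set_val @^-1` V) => //.
  apply/sub_nbhs; exists V => //; exact: onorm_nbhs oV.
have [O1 nO1 hO1] := enb _ (filterI nD (fc _ nY)).
have [V2 oV2 V2O] := onorm_small Gt cU nO1.
have sV2 : is_subgroup V2 by case: oV2.
have De x : (N `&` V2) x -> D (e x).
  by move=> [Nx /V2O Ox]; case: (hO1 _ Nx Ox).
have Ye x : (N `&` V2) x -> Y (f (e x)).
  by move=> [Nx /V2O Ox]; case: (hO1 _ Nx Ox).
have sNV : is_subgroup (N `&` V2) by exact: sgI.
exists b, (fun i x => set_val (f (e x) i)), V2, V; split => //.
- move=> i x y hx hy; have [Nx _] := hx; have [Ny _] := hy.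
  by rewrite eM // fM; [|apply: mem_set; exact: De..].
- by move=> i x hx; split; [exact: vX|exact: Ye].
- split=> [i O nO|x hx h].
    have : nbhs (1 : gpower TX b) [set y | O (set_val (y i))].
      apply/gpow_nbhs; exists (set_val @^-1` O); first by apply/sub_nbhs; exists O.
      by move=> y hy; exact: hy.
    by move=> nO2; have [O2 nO2' h2] := enb _ (fc _ nO2); exists O2.
  have fe : f (e x) = 1 by apply/funext => i; apply: val_injS; rewrite h.
  have : e x = 1.
    apply: fI; [apply: mem_set; exact: De|apply: mem_set; exact: sg1|].
    by rewrite fe (morph_in1 sD fM).
  move=> /(congr1 (fun z : gpower TN a => set_val (z i0))).
  by rewrite /e eqxx /tN (@valK_tosub _ (Subgroup sN)) //; case: hx.
- move=> i K KN nK _ x [k Kk <-] [Xx Vx].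
  pose y : gpower TX b := fun=> tX x.
  have : Y y by move=> j; rewrite /y /tX (@valK_tosub _ (Subgroup sX)).
  move=> /YD[d Dd fd].
  pose n := set_val (d i0); have Nn : N n by exact: vN.
  exists (k ^ n); first exact: nK.
  have [Nk V2k] := KN _ Kk.
  have -> : e (k ^ n) = e k ^ d.
    have Nkn : N (k * n) by exact: sgM.
    rewrite !conjgE; apply/funext => j; rewrite !gpow_mulE /e.
    have gV (z : gpower TN a) : (z^-1) j = (z j)^-1 by [].
    rewrite gV; case: eqP => [->|_]; last by rewrite mul1g mulVg.
    rewrite /tN -[d i0](@tosubK _ (Subgroup sN)) -/n -tosubM //.
    apply: val_injS; rewrite val_mulS val_invS.
    rewrite !(@valK_tosub _ (Subgroup sN)) //.
    by apply: (sgD sN) => //; exact: sgM.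
  rewrite (morph_inJ sD fM (De _ (KN _ Kk)) Dd) fd.
  rewrite !conjgE; have -> : (y^-1 * (f (e k) * y)) i = (tX x)^-1 * (f (e k) i * tX x) by [].
  rewrite !val_mulS val_invS /tX (@valK_tosub _ (Subgroup sX)) //.
Qed.

End Class.

(** * Direct factors from (LD) *)

Section LD.
Variable G : topGroupType.
Hypothesis (G_tdlc : tdlc G).
Implicit Types A B K L N V W U R : set G.

Let hG : hausdorff_space G. Proof. by case: G_tdlc. Qed.
Let tG : totally_disconnected [set: G]. Proof. by case: G_tdlc. Qed.

Lemma direct_factor_split (L U : subgroup G) : open U -> direct_factor L U ->
  exists M : set G, [/\ is_subgroup M, closed M, cent L M, meet1 L M & sg_set U `<=` smul L M].
Proof.
move=> oU [[LU _] [M [MU clM] [f [fM [cf [g [fg gf cg]]]] fE]]].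
exists M; have sM := sg_subgroup M; have sL := sg_subgroup L.
have sU := sg_subgroup U.
have Lv (x : topsub L) : sg_set L (set_val x) by exact: subP.
have Mv (x : topsub M) : sg_set M (set_val x) by exact: subP.
split => //.
- have clU : closed U by exact: open_sg_closed.
  have [O oO eO] := closed_openC clM.
  have -> : sg_set M = sg_set U `&` ~` O.
    apply/seteqP; split => x.
      move=> Mx; have Ux := MU _ Mx; split => // Ox.
      have : (set_val @^-1` O) (tosub U x) by rewrite /= valK_tosub.
      by rewrite eO /= valK_tosub.
    move=> [Ux nOx]; apply: contrapT => nM.
    have : (~` (set_val @^-1` sg_set M)) (tosub U x) by rewrite /= valK_tosub.
    by rewrite -eO /= valK_tosub.
  by apply: closedI => //; exact: open_closedC.
- move=> l m Ll Mm.
  have e1 : f (tosub L l, tosub M m) = f (1, tosub M m) * f (tosub L l, 1).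
    by rewrite -fM; congr f; apply: (f_equal2 pair); rewrite ?mul1g ?mulg1.
  move/(congr1 set_val): e1; rewrite val_mulS !fE /= !valK_tosub //.
  by rewrite mul1g mulg1.
- move=> x Lx Mx.
  have e1 : f (tosub L x, 1) = f (1, tosub M x).
    by apply: val_injS; rewrite !fE /= !valK_tosub // mul1g mulg1.
  have := can_inj fg e1 => /(congr1 fst)/(congr1 set_val) /=.
  by rewrite valK_tosub.
- move=> x Ux; have := fE (g (tosub U x)); rewrite gf valK_tosub // => ->.
  by exists (set_val (g (tosub U x)).1); [exact: Lv|exists (set_val (g (tosub U x)).2)].
Qed.

Variable U : set G.
Hypothesis cU : cposub U.

Let sU : is_subgroup U. Proof. by case: cU. Qed.
Let cptU : compact U. Proof. by case: cU. Qed.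

Lemma sub_compact A : closed A -> A `<=` U -> compact A.
Proof. by move=> cA; exact: subclosed_compact. Qed.

Lemma onorm_sg V : onorm U V -> is_subgroup V. Proof. by case. Qed.
Lemma onorm_sub V : onorm U V -> V `<=` U. Proof. by case. Qed.
Lemma onorm_nrm V : onorm U V -> nrm V U. Proof. by case. Qed.

(* Some open subgroup of K, and then every smaller one of the form K & V, is a
   direct factor of an open subgroup of U. *)
Lemma LD_split K W : property_LD G -> is_subgroup K -> closed K -> K `<=` U ->
  nbhs (1 : G) W -> nrm K W ->
  exists V0 R : set G, [/\ onorm U V0, is_subgroup R, closed R /\ R `<=` U,
    cent (K `&` V0) R /\ meet1 (K `&` V0) R
  & forall V, onorm U V -> V `<=` V0 ->
      exists2 V', onorm U V' & V' `<=` V /\ V' `<=` smul (K `&` V) R].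
Proof.
move=> LD sK clK KU nW nKW.
have [L [U0 [[LK oL] oU0 dL]]] : exists L U0 : subgroup G,
    [/\ open_in L K, open U0 & direct_factor L U0].
  have lnK : locally_normal (Subgroup sK).
    rewrite /locally_normal normalizerE; apply: sg_open; first exact: sg_normr.
    apply: filterS (filterI nW (nbhs1V nW)) => x [Wx Wx'].
    by split=> a _ Ka ->; apply: nKW.
  exact: (LD (Subgroup sK)).
have sL := sg_subgroup L; have sU0 := sg_subgroup U0.
have [M [sM clM cLM mLM ULM]] := direct_factor_split oU0 dL.
have [O oO eO] := oL.
have [W1 nW1 KW1] : exists2 W1, nbhs (1 : G) W1 & K `&` W1 `<=` L.
  have O1 : O 1.
    have : (set_val @^-1` O) (tosub (Subgroup sK) 1).
      by rewrite eO /= tosub1; exact: (sg1 sL).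
    by rewrite /= tosub1.
  exists O; first exact: open_nbhs_nbhs.
  move=> x [Kx Ox]; have : (set_val @^-1` O) (tosub (Subgroup sK) x).
    by rewrite /= (@valK_tosub _ (Subgroup sK)).
  by rewrite eO /= (@valK_tosub _ (Subgroup sK)).
have [V0 oV0 V0W] := onorm_small G_tdlc cU nW1.
have clL : closed L by apply: (@sg_closed _ L K W1).
have cL : compact L by apply: sub_compact => // x /LK /KU.
pose R := M `&` U.
have KL V : V `<=` V0 -> K `&` V `<=` L by move=> VV0 x [Kx /VV0/V0W]; move=> ?; exact: KW1.
exists V0, R; split => //.
- exact: sgI.
- by split; [apply: closedI => //; exact: cpt_closed|move=> x []].
- split; first by apply: centS cLM => // x; [exact: KL|case].
  by move=> x /(KL _ (@subset_refl _ _)) Lx [Mx _]; exact: mLM.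
move=> V oV VV0.
have sV := onorm_sg oV.
have sKV : is_subgroup (K `&` V) by exact: sgI.
have sR : is_subgroup R by exact: sgI.
have clR : closed R by apply: closedI => //; exact: cpt_closed.
have cKVR : cent (K `&` V) R by apply: centS cLM => // x; [exact: KL|case].
have sP : is_subgroup (smul (K `&` V) R) by apply: sg_smul => //; exact: cent_nrm.
have clP : closed (smul (K `&` V) R).
  apply: cpt_closed => //; apply: compact_smul.
    by apply: sub_compact => [|x [/KU]//]; apply: closedI => //; exact: onorm_closed oV.
  by apply: sub_compact => // x [].
(* [K & V] is an open subgroup of the compact [L], and [U0] lies in [L M]; so finitely many
   translates of [(K & V) R] cover [U0 & U]. *)
have [s sL' scov] := finite_cover cL (onorm_nbhs oV).
have [|W2 nW2 W2P] := @findex_open _ _ (U0 `&` U) s clP sP.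
  move=> a [/ULM[l Ll [m Mm <-]] Ua].
  have Ul : U l by exact/KU/LK.
  have [x xs Vx] := scov _ Ll; exists x => //.
  have Rm : R m by split => //; rewrite -(mulKg l m); exact: (sgD sU).
  exists (l * x^-1); first by split => //; apply: (sgDr sK); apply: LK => //; exact: sL'.
  exists m => //; rewrite -!mulgA; congr (_ * _).
  have := cLM _ _ (sgV sL (sL' _ xs)) Mm; move=> ->; by [].
have nU0 : nbhs (1 : G) ((U0 `&` U) `&` W2 `&` V).
  apply: filterI; last exact: onorm_nbhs oV.
  apply: filterI => //; apply: filterI; first exact: open_sg_nbhs.
  by case: cU => _ _; exact: open_sg_nbhs.
have [V' oV' V'W] := onorm_small G_tdlc cU nU0.
by exists V' => //; split => [x /V'W[]|x /V'W[/W2P]].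
Qed.

Variable S : topGroupType -> Prop.
Hypothesis S_class : profinite_similarity_class S.
Hypothesis S_mono : forall H, S H -> monomial H.

Local Notation inS := (inS S).

Lemma inS_cap N V : inS N -> onorm U V -> inS (N `&` V).
Proof.
move=> iN oV; have sN := inS_sg iN.
have cN := inS_compact S_class iN.
have h := @inS_open _ S_class _ hG tG (N `&` V) N V; apply/h => //.
- exact: sgI (onorm_sg oV).
- apply: (subclosed_compact _ cN) => [|x []//].
  by apply: closedI; [exact: cpt_closed|exact: onorm_closed oV].
- exact: onorm_nbhs oV.
Qed.

Lemma inS_up A B W : inS A -> is_subgroup B -> compact B -> A `<=` B ->
  nbhs (1 : G) W -> B `&` W `<=` A -> inS B.
Proof.
move=> iA sB cB AB nW WA; have h := @inS_open _ S_class _ hG tG A B W.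
by apply/h => //; [exact: inS_sg iA|exact: inS_compact S_class _ _ iA].
Qed.

(** The smaller product is a closed subgroup, and products of coset representatives show that
    finitely many of its translates cover [smul N1 N2]. *)
Lemma smul_open N1 N2 V : is_subgroup N1 -> closed N1 -> N1 `<=` U -> is_subgroup N2 ->
  closed N2 -> N2 `<=` U -> nrm N2 U -> nrm N1 U -> onorm U V ->
  exists2 W, nbhs (1 : G) W & smul N1 N2 `&` W `<=` smul (N1 `&` V) (N2 `&` V).
Proof.
move=> s1 c1 N1U s2 c2 N2U n2 n1 oV; have sV := onorm_sg oV.
have clV := onorm_closed oV.
have [t1 t1N cov1] := finite_cover (sub_compact c1 N1U) (onorm_nbhs oV).
have [t2 t2N cov2] := finite_cover (sub_compact c2 N2U) (onorm_nbhs oV).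
apply: (@findex_open _ _ _ [seq x * y | x <- t1, y <- t2]).
- apply: cpt_closed => //; apply: compact_smul; apply: sub_compact.
  + exact: closedI.
  + by move=> x [/N1U].
  + exact: closedI.
  + by move=> x [/N2U].
- apply: sg_smul; try exact: sgI.
  apply: nrmI; first by apply: (nrmS n1) => x [/N2U].
  by apply: (nrmS (onorm_nrm oV)) => x [/N2U].
move=> _ [a Na [b Nb <-]].
have [x xt Vx] := cov1 _ Na; have [y yt Vy] := cov2 _ Nb.
exists (x * y); first by apply/allpairsP; exists (x, y).
exists (a * x^-1); first by split => //; apply: (sgDr s1) => //; exact: t1N.
have Ux : U x^-1 by apply: (sgV sU); apply/N1U/t1N.
exists ((b * y^-1) ^ x^-1).
  split; last exact: (onorm_nrm oV).
  by apply: n2 => //; apply: (sgDr s2) => //; exact: t2N.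
by gsimp.
Qed.

Definition NU N := [/\ inS N, N `<=` U & nrm N U].

Lemma NU_smul N1 N2 : property_LD G -> NU N1 -> NU N2 -> NU (smul N1 N2).
Proof.
move=> LD [i1 N1U n1] [i2 N2U n2].
have s1 := inS_sg i1; have s2 := inS_sg i2.
have c1 := inS_closed S_class hG i1; have c2 := inS_closed S_class hG i2.
have nU : nbhs (1 : G) U by case: cU => _ _; exact: open_sg_nbhs.
have n12 : nrm N1 N2 by exact: nrmS n1 N2U.
have s12 : is_subgroup (smul N1 N2) by exact: sg_smul.
have c12 : compact (smul N1 N2).
  by apply: compact_smul; apply: (inS_compact S_class).
split; last exact: nrm_smul; last exact: smul_sub.
have [|||||V [R [oV sR [clR RU] [cIR mIR] hV]]] := @LD_split (N1 `&` N2) U LD.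
- exact: sgI.
- exact: closedI.
- by move=> x [/N1U].
- exact: nU.
- exact: nrmI.
have [V' oV' [V'V V'P]] := hV _ oV (@subset_refl _ _).
have sV := onorm_sg oV; have sV' := onorm_sg oV'.
set I := N1 `&` N2 `&` V in cIR mIR V'P.
have sI : is_subgroup I by apply: sgI => //; exact: sgI.
(* Near 1, each [N1], [N2] is [I] times its trace on [R]. The two traces meet trivially, since a
   common element lies in [I] and in [R]; each is normalised by the other, so they commute. *)
pose R1 := R `&` N1 `&` V; pose R2 := R `&` N2 `&` V.
have sR1 : is_subgroup R1 by apply: sgI => //; exact: sgI.
have sR2 : is_subgroup R2 by apply: sgI => //; exact: sgI.
have clV := onorm_closed oV.
have clR1 : closed R1 by apply: closedI => //; exact: closedI.
have clR2 : closed R2 by apply: closedI => //; exact: closedI.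
have clI : closed I by apply: closedI => //; exact: closedI.
have IU : I `<=` U by move=> x [[/N1U]].
have R1U : R1 `<=` U by move=> x [[/RU]].
have R2U : R2 `<=` U by move=> x [[/RU]].
have cIR1 : cent I R1 by apply: centS cIR => // x [[]].
have cIR2 : cent I R2 by apply: centS cIR => // x [[]].
have nR (N : set G) : nrm N U -> nrm (R `&` N `&` V) R.
  move=> nN; apply: nrmI; last by apply: (nrmS (onorm_nrm oV)).
  by apply: nrmI; [exact: sg_nrm|exact: nrmS nN RU].
have R1R : R1 `<=` R by move=> x [[]].
have R2R : R2 `<=` R by move=> x [[]].
have m12 : meet1 R1 R2.
  by move=> x [[Rx N1x] Vx] [[_ N2x] _]; apply: mIR.
have c12' : cent R1 R2.
  by apply: meet1_cent => //; [exact: nrmS (nR _ n1) R2R|exact: nrmS (nR _ n2) R1R].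
pose A1 := smul I R1.
have sA1 : is_subgroup A1 by apply: sg_smul => //; exact: cent_nrm.
have cA1 : compact A1 by apply: compact_smul; exact: sub_compact.
have A1N : A1 `<=` N1 by apply: smul_sub => // x [[]].
have cap1 : N1 `&` V' `<=` A1.
  move=> x [Nx V'x]; have [i Ii [r Rr e]] := V'P _ V'x.
  have er : r = i^-1 * x by rewrite -e mulKg.
  exists i => //; exists r => //; split; last by rewrite er; apply: (sgD sV); [case: Ii|exact: V'V].
  by split => //; rewrite er; apply: (sgD s1) => //; case: Ii => -[].
have cap2 : N2 `&` V' `<=` smul I R2.
  move=> x [Nx V'x]; have [i Ii [r Rr e]] := V'P _ V'x.
  have er : r = i^-1 * x by rewrite -e mulKg.
  exists i => //; exists r => //; split; last by rewrite er; apply: (sgD sV); [case: Ii|exact: V'V].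
  by split => //; rewrite er; apply: (sgD s2) => //; case: Ii => -[].
have iA1 : inS A1.
  have h := @inS_open _ S_class _ hG tG A1 N1 V'; apply/h => //.
  - exact: inS_compact S_class _ _ i1.
  - exact: onorm_nbhs oV'.
have [W nW WP] := smul_open s1 c1 N1U s2 c2 N2U n2 n1 oV'.
have A1R2 : smul N1 N2 `&` W `<=` smul A1 R2.
  move=> x /WP[a /cap1[i Ii [r Rr <-]] [b /cap2[j Ij [t Rt <-]] <-]].
  exists (i * j * r).
    by exists (i * j); [exact: sgM|exists r].
  exists t => //; rewrite -!mulgA; congr (_ * _).
  by rewrite mulgA (cIR1 j r) // mulgA.
have cA1R2 : cent A1 R2.
  move=> _ t [i Ii [r Rr <-]] Rt.
  by rewrite -!mulgA (c12' r t) // mulgA (cIR2 i t) // mulgA.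
have sA1R2 : is_subgroup (smul A1 R2) by apply: sg_smul => //; exact: cent_nrm.
have subP' : smul A1 R2 `<=` smul N1 N2.
  move=> _ [a Aa [b Rb <-]]; exists a; first exact: A1N.
  by exists b => //; case: Rb => -[].
have mA1 : meet1 A1 R2.
  move=> _ [i Ii [r Rr <-]] Rir.
  have i1' : i = 1.
    apply: mIR => //; rewrite -(mulgK r i); apply: (sgDr sR); first exact: R2R.
    exact: R1R.
  by rewrite i1' mul1g; apply: m12 => //; move: Rir; rewrite i1' mul1g.
(* If [R2] is finite, [A1] is already open in the product. If it is infinite, it belongs to S as a
   locally normal subgroup of [N2], and [A1] times [R2] is a direct product of members. *)
have [fR2|infR2] := pselect (finite_set R2).
  have [W' nW' W'R] : exists2 W', nbhs (1 : G) W' & forall x, R2 x -> W' x -> x = 1.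
    exists (~` (R2 `\` [set 1])).
      apply: open_nbhs_nbhs; split; last by move=> [_]; apply.
      apply: closed_openC; apply: (iffLR accessible_finite_set_closed).
        exact: hausdorff_accessible.
      by apply: (@sub_finite_set _ _ R2) => // x [].
    by move=> x Rx h; apply: contrapT => x1; apply: h.
  have [t tR cov] := finite_cover (sub_compact clR2 R2U) nW'.
  have [|W3 nW3 W3P] := @findex_open _ A1 (smul A1 R2) t (cpt_closed hG cA1) sA1.
    move=> _ [a Aa [r Rr <-]]; have [y yt Wy] := cov _ Rr; exists y => //.
    by rewrite -mulgA (W'R _ _ Wy) ?mulg1 //; apply: (sgDr sR2) => //; exact: tR.
  apply: (@inS_up A1 _ (W `&` W3)) => //.
  - by move=> x /(@smulSl _ _ R2 sR2) /subP'.
  - exact: filterI.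
  - by move=> x [Nx [Wx W3x]]; apply: W3P; split => //; exact: A1R2.
apply: (@inS_up (smul A1 R2) _ W) => //.
apply: inS_smul => //.
apply: (@inS_normal _ S_class _ hG tG S_mono N2 R2 V') => //.
- by move=> x [[]].
- exact: onorm_nbhs oV'.
(* [I] centralises [R2] and [R] normalises it, while [V'] lies in [I R]. *)
have nR2V : nrm R2 (smul I R).
  move=> x _ Rx [i Ii [r Rr <-]]; rewrite conjgM; apply: (nR _ n2) => //.
  by rewrite conjgE -(cIR2 i x) // mulKg.
by apply: (nrmS nR2V) => x [_ /V'P].
Qed.

End LD.

(** * Normal closures of members, and finite normal subgroups obtained from splittings *)

Section Tor.
Variable G : topGroupType.
Hypothesis (G_tdlc : tdlc G).
Hypothesis (G_LD : property_LD G).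
Variable S : topGroupType -> Prop.
Hypothesis S_class : profinite_similarity_class S.
Hypothesis S_mono : forall H, S H -> monomial H.
Implicit Types A B K L N V W U R : set G.

Local Notation inS := (inS S).

Let hG : hausdorff_space G. Proof. by case: G_tdlc. Qed.
Let tG : totally_disconnected [set: G]. Proof. by case: G_tdlc. Qed.

Lemma cposub_onorm U V : cposub U -> onorm U V -> cposub V.
Proof.
move=> [sU cU oU] oV; have [sV opV VU _] := oV; split => //.
by apply: (subclosed_compact _ cU) => //; exact: onorm_closed oV.
Qed.

Lemma conj_sub_nrm N V x U : onorm U V -> U x -> is_subgroup U -> nrm N V ->
  nrm [set y ^ x | y in N] V.
Proof.
move=> oV Ux sU nN _ v [y Ny <-] Vv; exists (y ^ (v ^ x^-1)).
  by apply: nN => //; apply: (onorm_nrm oV) => //; exact: sgV.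
by rewrite -!conjgM; congr (_ ^ _); gsimp.
Qed.

(** [N & V] is normalised by an open subgroup of finite index in [U], so it has finitely many
    [U]-conjugates up to repetition, and their product is a member normal in [U]. *)
Lemma NU_cofinal U N W : cposub U -> inS N -> N `<=` U -> nbhs (1 : G) W -> nrm N W ->
  exists M V : set G, [/\ NU U S M, onorm U V & N `&` V `<=` M].
Proof.
move=> cU iN NsU nW nN; have [sU cptU oU] := cU.
have [V oV VW] := onorm_small G_tdlc cU nW.
have cV := cposub_onorm cU oV.
pose NV := N `&` V.
have iNV : inS NV by exact: (inS_cap G_tdlc S_class iN oV).
have nNV : nrm NV V.
  by apply: nrmI; [exact: nrmS nN VW|apply: (nrmS (onorm_nrm oV)); exact: onorm_sub oV].
have [s sUs cov] := finite_cover cptU (onorm_nbhs oV).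
(* [M] is the product of the conjugates of [NV] by coset representatives of [V] in [U]. The last
   clause bounds [M] by any subgroup containing them; 1 is listed there because the product starts
   with [NV] itself. *)
have [M [[iM MV nM] M1 M2]] : exists M, [/\ NU V S M,
    forall x, x \in s -> [set y ^ x | y in NV] `<=` M &
    forall A, is_subgroup A -> (forall x, x \in 1 :: s -> [set y ^ x | y in NV] `<=` A) -> M `<=` A].
  elim: s sUs {cov} => [_|x s IH hs].
    exists NV; split => //; first by split => // x [].
    move=> A sA h; move=> y Ny; apply: (h 1); first by rewrite inE.
    by exists y; rewrite ?conjg1.
  have [|M [NM M1 M2]] := IH; first by move=> y ys; apply: hs; rewrite inE ys orbT.
  have Ux : U x by apply: hs; rewrite inE eqxx.
  have Nx : NU V S [set y ^ x | y in NV].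
    split; first exact: inS_conj.
      by move=> _ [y [_ Vy] <-]; exact: (onorm_nrm oV).
    exact: conj_sub_nrm oV Ux sU nNV.
  have sx : is_subgroup [set y ^ x | y in NV] by case: Nx => /inS_sg.
  have sM : is_subgroup M by case: NM => /inS_sg.
  exists (smul [set y ^ x | y in NV] M); split.
  - exact: (NU_smul G_tdlc cV S_class S_mono G_LD).
  - move=> y; rewrite inE => /orP[/eqP->|ys]; first exact: smulSl.
    by apply: subset_trans (M1 _ ys) _; exact: smulSr.
  - move=> A sA h; apply: smul_sub => //; first by apply: h; rewrite !inE eqxx orbT.
    apply: M2 => // y; rewrite inE => hy; apply: h.
    by move: hy; rewrite !inE => /orP[->//|->]; rewrite !orbT.
exists M, V; split => //; last first.
  have [x xs Vx] := cov 1 (sg1 sU).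
  move=> y [Ny Vy]; apply: (M1 _ xs).
  have Vx' : V x by rewrite -[x]invgK; apply: (sgV (onorm_sg oV)); move: Vx; rewrite mul1g.
  exists (y ^ x^-1); last by rewrite conjgKV.
  by apply: nNV => //; exact: (sgV (onorm_sg oV)).
split => //; first by apply: subset_trans MV _; exact: onorm_sub oV.
have sM := inS_sg iM.
(* A conjugate of [NV] depends only on a coset of [V], so conjugation by [u] sends each generating
   conjugate into one of those contained in [M]. *)
move=> m u Mm Uu; apply: (M2 [set z | M (z ^ u)]) => //.
  split; first by rewrite /= conj1g; exact: sg1.
  - by move=> a b /= Ma Mb; rewrite conjMg; exact: sgM.
  - by move=> a /= Ma; rewrite conjVg; exact: sgV.
move=> x xs _ [y Ny <-] /=; rewrite -conjgM.
have Ux : U x by move: xs; rewrite inE => /orP[/eqP->|/sUs//]; exact: sg1.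
have [z zs Vz] := cov _ (sgM sU Ux Uu).
apply: (M1 _ zs); exists (y ^ (x * u * z^-1)); first exact: nNV.
by rewrite -conjgM mulgVK.
Qed.

Section InU.
Variable U : set G.
Hypothesis cU : cposub U.

Let sU : is_subgroup U. Proof. by case: cU. Qed.
Let cptU : compact U. Proof. by case: cU. Qed.

Definition tor P := forall V, onorm U V -> exists D : set G,
  [/\ is_subgroup D, finite_set D, D `<=` P `&` V, nrm D P & exists2 x, D x & x <> 1].

(** [P] is the direct product of [P & V] and [F]. For [P] inside [U] and [onorm U V] such an [F] is
    finite, by [meet1_finite]. *)
Definition splits P V := exists F : set G,
  [/\ is_subgroup F, F `<=` P, meet1 F V, cent F (P `&` V) & P `<=` smul (P `&` V) F].

Lemma meet1_finite F V : is_subgroup F -> F `<=` U -> onorm U V -> meet1 F V ->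
  finite_set F.
Proof.
move=> sF FU oV mF.
have [s _ cov] := finite_cover cptU (onorm_nbhs oV).
apply: (@sub_finite_set _ _ (\bigcup_(x in [set` s]) [set f | F f /\ V (f * x^-1)])).
  by move=> f Ff; have [x xs Vx] := cov _ (FU _ Ff); exists x.
apply: bigcup_finite; first exact: finite_seq.
move=> x _; have [[f0 [Ff0 V0]]|n] := pselect (exists f, F f /\ V (f * x^-1)).
  apply: (@sub_finite_set _ _ [set f0]) => // f [Ff Vf] /=.
  apply: divg1_eq; apply: mF; first exact: (sgDr sF).
  by have := sgDr (onorm_sg oV) Vf V0; rewrite invgM invgK mulgA mulgVK.
by apply: (@sub_finite_set _ _ set0) => // f hf; apply: n; exists f.
Qed.

Lemma inS_nontriv P V : inS P -> onorm U V -> exists2 x, (P `&` V) x & x <> 1.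
Proof.
move=> iP oV; apply: contrapT => h.
have iPV : inS (P `&` V) by exact: (inS_cap G_tdlc S_class iP oV).
apply: (inS_infinite S_class S_mono iPV).
apply: (@sub_finite_set _ _ [set 1]) => // x Px /=.
by apply: contrapT => x1; apply: h; exists x.
Qed.

(** Given [x <> 1] in [P & V], split at some [V'] inside [V] that misses [x]. The component of [x]
    in the finite complement [F] is then nontrivial and lies in [V], and [F & V] is normal in
    [P]. *)
Lemma splits_tor P V1 : inS P -> P `<=` U -> onorm U V1 ->
  (forall V, onorm U V -> V `<=` V1 -> splits P V) -> tor P.
Proof.
move=> iP PU oV1 hs V oV.
have sP := inS_sg iP.
have [x [Px Vx] x1] := inS_nontriv iP oV.
have [V' oV' hV'] : exists2 V', onorm U V' & V' `<=` (V `&` V1) `&` [set y | y <> x].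
  apply: onorm_small => //; apply: filterI; last exact: nbhs_neq.
  by apply: filterI; [exact: onorm_nbhs oV|exact: onorm_nbhs oV1].
have [F [sF FP mF cF PF]] : splits P V' by apply: hs => // y /hV'[[]].
have sV := onorm_sg oV.
have FU : F `<=` U by apply: subset_trans FP PU.
exists (F `&` V); split.
- exact: sgI.
- by apply: sub_finite_set (meet1_finite sF FU oV' mF) => y [].
- by move=> y [/FP].
- apply: nrmI; last by apply: nrmS (onorm_nrm oV) PU.
  move=> y _ Fy /PF[w Pw [f Ff <-]]; rewrite conjgM; apply: (sgJ sF) => //.
  by rewrite conjgE (cF y w) // mulKg.
- have [w [Pw V'w] [f Ff e]] := PF _ Px; exists f.
    split => //; have -> : f = w^-1 * x by rewrite -e mulKg.
    by apply: (sgD sV) => //; case: (hV' _ V'w) => -[].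
  by move=> f1; case: (hV' _ V'w) => _; apply; rewrite -e f1 mulg1.
Qed.

(* Infinitely many independent commuting subgroups P_k shrinking to 1: since the
   closed subgroup generated by the P_k & W_k is virtually a direct factor, some
   P_k & W_k is a direct factor of P_k. *)
Lemma LD_sequence (P W D : nat -> set G) (W0 : set G) :
  (forall k, [/\ is_subgroup (P k), closed (P k), P k `<=` U & onorm U (W k)]) ->
  (forall k, [/\ is_subgroup (D k), closed (D k), D k `<=` U, cent (P k) (D k) & meet1 (P k) (D k)]) ->
  (forall k j, j != k -> P j `<=` D k) ->
  (forall V, onorm U V -> exists k, P k `<=` V) ->
  nbhs (1 : G) W0 -> nrm (cgen (\bigcup_k (P k `&` W k))) W0 ->
  exists k, splits (P k) (W k).
Proof.
move=> hP hD hPD hsmall nW0; set B := cgen _ => nB.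
have sPW k : is_subgroup (P k `&` W k) by case: (hP k) => ? _ _ /onorm_sg ?; exact: sgI.
have BP k : B `<=` smul (P k `&` W k) (D k).
  have [sP cP PU oW] := hP k; have [sD cD DU cPD mPD] := hD k.
  apply: cgen_min.
  - apply: sg_smul => //; apply: cent_nrm; apply: centS cPD => // x [].
  - apply: cpt_closed => //; apply: compact_smul; apply: (sub_compact cU) => //.
      by apply: closedI => //; exact: onorm_closed oW.
    by move=> x [/PU].
  - move=> x [j _ [Pj Wj]]; have [e|ne] := eqVneq j k.
      by move: Pj Wj; rewrite e => Pk Wk; apply: smulSl.
    by apply: smulSr => //; exact: hPD Pj.
have BU : B `<=` U.
  apply: cgen_min => //; first exact: cpt_closed.
  by move=> x [j _ [Pj _]]; case: (hP j) => _ _ + _; apply.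
have [V0 [R [oV0 sR [clR RU] [cBR mBR] hV]]] :=
  LD_split G_tdlc cU G_LD (cgen_sg _) (@cgen_closed _ _) BU nW0 nB.
have [V' oV' [V'V V'P]] := hV _ oV0 (@subset_refl _ _).
have [k PkV'] := hsmall _ oV'.
have [sP cP PU oW] := hP k; have [sD cD DU cPD mPD] := hD k.
have sV0 := onorm_sg oV0; have sB : is_subgroup B by exact: cgen_sg.
have sBV : is_subgroup (B `&` V0) by exact: sgI.
exists k.
(* [F] consists of the elements [c * r] of [P k] with [c] in [D k & B & V0] and [r] in [R]. For [x]
   in [P k], write [x = w * r] along the (LD) splitting and [w = p * c] along [BP]; then
   [p^-1 * x = c * r] is in [F]. *)
pose F := [set y | P k y /\ exists c, [/\ D k c, (B `&` V0) c & R (c^-1 * y)]].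
have PWB x : (P k `&` W k) x -> (B `&` V0) x.
  move=> [Px Wx]; split; last by apply/V'V/PkV'.
  by apply: cgen_sub; exists k.
have sF : is_subgroup F.
  split.
  - split; first exact: sg1.
    by exists 1; split; [exact: sg1|exact: sg1|rewrite mulg1 invg1; exact: sg1].
  - move=> x y [Px [c [Dc Bc Rc]]] [Py [d [Dd Bd Rd]]]; split; first exact: sgM.
    exists (d * c); split; [exact: sgM|exact: sgM|].
    have := sgM sR Rc Rd; congr R.
    rewrite invgM -!mulgA; congr (_ * _); rewrite !mulgA; congr (_ * _).
    by rewrite (cPD x d^-1) //; exact: sgV.
  - move=> x [Px [c [Dc Bc Rc]]]; split; first exact: sgV.
    exists c^-1; split; [exact: sgV|exact: sgV|].
    have := sgV sR Rc; rewrite invgM !invgK.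
    by rewrite (cPD x^-1 c) //; exact: sgV.
exists F; split => //.
- by move=> x [].
- move=> y [Py [c [Dc Bc Rc]]] Wy.
  have By : (B `&` V0) y by apply: PWB.
  have e : c^-1 * y = 1 by apply: mBR => //; exact: (sgD sBV).
  have e2 : c = y by rewrite -[c]mulg1 -e mulVKg.
  by apply: mPD => //; rewrite -e2.
- move=> y z [Py [c [Dc Bc Rc]]] hz; have [Pz _] := hz.
  have e1 : z * (c^-1 * y) = c^-1 * y * z by apply: cBR => //; exact: PWB.
  have e2 : z * c^-1 = c^-1 * z by apply: cPD => //; exact: sgV.
  by apply: (mulgI c^-1); rewrite [RHS]mulgA -e2 -[RHS]mulgA e1 mulgA.
- move=> x Px; have [w Bw [r Rr e]] := V'P _ (PkV' _ Px).
  have [Bw' _] := Bw.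
  have [p PWp [c Dc e2]] := BP k _ Bw'.
  exists p => //; exists (p^-1 * x); last by rewrite mulVKg.
  have [Pp _] := PWp.
  split; first exact: (sgD sP).
  exists c; split => //.
    have -> : c = p^-1 * w by rewrite -e2 mulKg.
    by apply: (sgD sBV) => //; exact: PWB.
  by rewrite -e -e2 -!mulgA mulKg mulKg.
Qed.

End InU.
End Tor.

(** * Ascending chains of members *)

Lemma dep_choice (T : Type) (I : nat -> T -> Prop) (R : nat -> T -> T -> Prop) t0 :
  I 0 t0 -> (forall n t, I n t -> exists2 t', I n.+1 t' & R n t t') ->
  exists u : nat -> T, forall n, I n (u n) /\ R n (u n) (u n.+1).
Proof.
move=> I0 step.
have /choice[f fP] : forall p : nat * T, exists t', I p.1 p.2 -> I p.1.+1 t' /\ R p.1 p.2 t'.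
  move=> [n t]; have [Int|nI] := pselect (I n t); last by exists t0.
  by have [t' ? ?] := step _ _ Int; exists t'.
pose fix u n := if n is m.+1 then f (m, u m) else t0.
have uI n : I n (u n) by elim: n => // n /(fP (n, u n))[].
by exists u => n; split => //; have [] := fP (n, u n) (uI n).
Qed.

Section Seq.
Variable G : topGroupType.
Hypothesis (G_tdlc : tdlc G).
Hypothesis (G_LD : property_LD G).
Variable S : topGroupType -> Prop.
Hypothesis S_class : profinite_similarity_class S.
Hypothesis S_mono : forall H, S H -> monomial H.
Implicit Types A B K L N V W R P Q : set G.

Local Notation inS := (inS S).

Let hG : hausdorff_space G. Proof. by case: G_tdlc. Qed.
Let tG : totally_disconnected [set: G]. Proof. by case: G_tdlc. Qed.

Variable U : set G.
Hypothesis cU : cposub U.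
Let sU : is_subgroup U. Proof. by case: cU. Qed.
Let cptU : compact U. Proof. by case: cU. Qed.

Variable Vb : nat -> set G.
Hypothesis Vb_onorm : forall k, onorm U (Vb k).
Hypothesis Vb_basis : forall W, nbhs (1 : G) W -> exists k, Vb k `<=` W.

(** [A] need not lie in [B]: it only has to contain [B] near 1. *)
Definition relopen A B := exists2 W, nbhs (1 : G) W & B `&` W `<=` A.

Lemma inS_down A B W : inS B -> is_subgroup A -> closed A -> A `<=` B ->
  nbhs (1 : G) W -> B `&` W `<=` A -> inS A.
Proof.
move=> iB sA cA AB nW WA; have cB := inS_compact S_class iB.
have h := @inS_open _ S_class _ hG tG A B W.
apply/h => //; last exact: inS_sg iB.
exact: subclosed_compact cB AB.
Qed.

Lemma cap_finite M A : finite_set M -> exists2 W, nbhs (1 : G) W & meet1 M W.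
Proof.
move=> fM; exists (~` (M `\` [set 1])).
  apply: open_nbhs_nbhs; split; last by move=> [_]; apply.
  apply: closed_openC; apply: (iffLR accessible_finite_set_closed).
    exact: hausdorff_accessible.
  by apply: (@sub_finite_set _ _ M) => // x [].
by move=> x Mx h; apply: contrapT => x1; apply: h.
Qed.

Lemma finite_complement K M A : is_subgroup K -> closed K -> is_subgroup M ->
  finite_set M -> A `<=` smul K M -> relopen K A.
Proof.
move=> sK clK sM fM AKM.
have [W nW mW] := cap_finite setT fM.
have [s sM' cov] := finite_cover (finite_compact fM) nW.
apply: (@findex_open _ K A s) => // a /AKM[k Kk [m Mm <-]].
have [x xs Wx] := cov _ Mm; exists x => //.
by rewrite -mulgA (mW _ _ Wx) ?mulg1 //; apply: (sgDr sM) => //; exact: sM'.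
Qed.

(** * Independent pieces split off along a chain inside an ambient group [Om] *)

Section Sequence.
Variables (Om : set G) (N : nat -> set G).
Hypotheses (sOm : is_subgroup Om) (clOm : closed Om) (OmU : Om `<=` U).
Hypothesis lnOm : forall B, is_subgroup B -> closed B -> B `<=` Om -> nrm B Om ->
  exists2 W, nbhs (1 : G) W & nrm B W.
Hypothesis hN : forall i, [/\ inS (N i), N i `<=` Om, nrm (N i) Om,
  N i `<=` N i.+1 & ~ relopen (N i) (N i.+1)].
Hypothesis split_off : forall C M V, is_subgroup C -> closed C -> C `<=` Om -> nrm C Om ->
  inS M -> M `<=` C -> nrm M Om -> onorm U V ->
  exists V1 C' : set G, [/\ onorm U V1 /\ V1 `<=` V,
    [/\ is_subgroup C', closed C', C' `<=` C & nrm C' Om],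
    meet1 (M `&` V1) C', cent (M `&` V1) C' & relopen (smul (M `&` V1) C') C].
Hypothesis not_tor : forall P, inS P -> P `<=` U -> ~ tor U P.

Let goodp Q := [/\ is_subgroup Q, closed Q, Q `<=` Om & nrm Q Om].
(** [t.1] is the product of the pieces split off so far; [t.2] commutes with it, meets it trivially,
    and supplies the next piece, the product of both being open in [Om]. *)
Let inv i (t : set G * set G) := [/\ goodp t.1, goodp t.2, t.1 `<=` N i &
  [/\ meet1 t.1 t.2, cent t.1 t.2 & relopen (smul t.1 t.2) Om]].
Let rel i (t t' : set G * set G) := exists P W : set G,
  [/\ goodp P /\ onorm U W, P `<=` t.2 /\ P `<=` Vb i, ~ splits P W,
    t'.1 = smul t.1 P & [/\ t'.2 `<=` t.2, meet1 P t'.2 & cent P t'.2]].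

(** The next piece is cut out of [N i.+1] inside the current complement [C], and [split_off]
    replaces [C] by a complement of that piece in it. *)
Let step i t : inv i t -> exists2 t', inv i.+1 t' & rel i t t'.
Proof.
case: t => Q C [/= [sQ cQ QO nQ] [sC cC CO nC] QN [mQC cQC [W nW WQC]]].
have [iN NO nN Ni nopen] := hN i; have [iN' NO' nN' _ _] := hN i.+1.
have sN' := inS_sg iN'; have clN' := inS_closed S_class hG iN'.
pose M := N i.+1 `&` C.
have sM : is_subgroup M by exact: sgI.
have clM : closed M by exact: closedI.
have MO : M `<=` Om by move=> x [/NO'].
have nM : nrm M Om by exact: nrmI.
have cap : N i.+1 `&` W `<=` smul Q M.
  move=> x [Nx Wx]; have [q Qq [c Cc e]] := WQC _ (conj (NO' _ Nx) Wx).
  exists q => //; exists c => //; split => //.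
  have -> : c = q^-1 * x by rewrite -e mulKg.
  by apply: (sgD sN') => //; apply/Ni/QN.
(* Were [M] finite, [Q], and with it [N i], would be open in [N i.+1]. *)
have infM : infinite_set M.
  move=> fM; apply: nopen; have [W' nW' h] := finite_complement sQ cQ sM fM cap.
  exists (W `&` W'); first exact: filterI.
  by move=> x [Nx [Wx W'x]]; apply: QN; apply: h.
have iM : inS M.
  apply: (@inS_normal _ S_class _ hG tG S_mono (N i.+1) M setT) => //.
  - by move=> x [].
  - exact: filterT.
  by apply: (nrmS nM) => x [/NO'].
have [V1 [C' [[oV1 V1V] [sC' clC' C'C nC'] mMC cMC [W2 nW2 h2]]]] :=
  split_off sC cC CO nC iM (fun x (h : M x) => h.2) nM (Vb_onorm i).
pose P := M `&` V1.
have iP : inS P by exact: (inS_cap G_tdlc S_class iM oV1).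
have PM : P `<=` M by move=> x [].
have PU : P `<=` U by apply: subset_trans OmU; apply: subset_trans MO.
(* By [splits_tor], splitting at every small [V] would give [P] arbitrarily small finite normal
   subgroups. The failing [W0] is kept as the witness that [LD_sequence] will contradict. *)
have [W0 oW0 nsp] : exists2 W0, onorm U W0 & ~ splits P W0.
  apply: contrapT => h; apply: (not_tor iP PU).
  apply: (splits_tor G_tdlc S_class S_mono cU iP PU (Vb_onorm 0)) => V oV _.
  by apply: contrapT => ns; apply: h; exists V.
have sP := inS_sg iP; have clP := inS_closed S_class hG iP.
have PC : P `<=` C by move=> x [[]].
have gP : goodp P.
  split => //; first exact: subset_trans PM MO.
  by apply: nrmI => //; apply: nrmS (onorm_nrm oV1) OmU.
have cQP : cent Q P by apply: centS cQC.
have PO : P `<=` Om by case: gP.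
have nP : nrm P Om by case: gP.
have sQP : is_subgroup (smul Q P) by apply: sg_smul => //; exact: cent_nrm.
have cptQ : compact Q by apply: (sub_compact cU) => //; exact: subset_trans QO OmU.
have cptC' : compact C'.
  by apply: (sub_compact cU) => //; apply: subset_trans OmU; apply: subset_trans CO.
have cptP := inS_compact S_class iP.
have cQPC : cent (smul Q P) C'.
  move=> _ c [q Qq [p Pp <-]] Cc.
  rewrite -mulgA (cMC p c) // !mulgA; congr (_ * _); apply: cQC => //; exact: C'C.
exists (smul Q P, C'); last by exists P, W0; split => //; split => // x [_ /V1V].
split => //=.
- split => //; [|exact: smul_sub|exact: nrm_smul].
  by apply: cpt_closed => //; exact: compact_smul.
- by split => //; exact: subset_trans C'C CO.
- by apply: smul_sub => // x; [move=> /QN/Ni|move=> [[]]].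
split => //.
  move=> _ [q Qq [p Pp <-]] Cqp.
  have q1 : q = 1.
    apply: mQC => //; rewrite -(mulgK p q); apply: (sgDr sC); [exact: C'C|exact: PC].
  by rewrite q1 mul1g; apply: mMC => //; move: Cqp; rewrite q1 mul1g.
have cptC : compact C by apply: (sub_compact cU) => //; exact: subset_trans CO OmU.
have [s sC0 cov] := finite_cover cptC nW2.
have [|||W3 nW3 h3] := @findex_open _ (smul (smul Q P) C') (Om `&` W) s.
- by apply: cpt_closed => //; do 2?apply: compact_smul.
- by apply: sg_smul => //; exact: cent_nrm.
- move=> a /WQC[q Qq [c Cc <-]]; have [x xs Wx] := cov _ Cc; exists x => //.
  have [p Pp [d Dd e]] : smul P C' (c * x^-1).
    by apply: h2; split => //; apply: (sgDr sC) => //; exact: sC0.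
  exists (q * p); first by exists q => //; exists p.
  by exists d => //; rewrite -!mulgA e.
exists (W `&` W3); first exact: filterI.
by move=> x [Ox [Wx W3x]]; apply: h3.
Qed.

Lemma sequence_absurd : False.
Proof.
have [|u uP] := @dep_choice _ inv rel ([set 1], Om) _ step.
  have [iN NO _ _ _] := hN 0.
  have s1 : is_subgroup [set 1 : G].
    by split => // [x y -> ->|x ->]; rewrite ?mulg1 ?invg1.
  split => //=.
  - split => //; first exact: closed1.
      by move=> x ->; exact: sg1.
    by move=> x y -> _; rewrite conj1g.
  - by split => //; exact: sg_nrm.
  - by move=> x ->; exact: (sg1 (inS_sg iN)).
  split=> //.
    by move=> x y -> _; rewrite mul1g mulg1.
  by exists setT; [exact: filterT|move=> x [Ox _]; apply: smulSr].
have /choice[P /choice[W PW]] : forall k, exists P, exists W,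
    [/\ goodp P /\ onorm U W, P `<=` (u k).2 /\ P `<=` Vb k, ~ splits P W,
    (u k.+1).1 = smul (u k).1 P & [/\ (u k.+1).2 `<=` (u k).2, meet1 P (u k.+1).2 & cent P (u k.+1).2]].
  by move=> k; have [_ [P [W h]]] := uP k; exists P, W.
have Qmono i j : (i <= j)%N -> (u i).1 `<=` (u j).1.
  move=> /subnK <-; elim: (j - i)%N => // n IH.
  apply: subset_trans IH _; rewrite addSn; have [[gP _] _ _ -> _] := PW (n + i)%N.
  by apply: smulSl; case: gP.
have Cmono i j : (i <= j)%N -> (u j).2 `<=` (u i).2.
  move=> /subnK <-; elim: (j - i)%N => // n IH.
  by apply: subset_trans _ IH; rewrite addSn; have [_ _ _ _ []] := PW (n + i)%N.
(* [D k] contains every piece other than [P k]: the earlier ones lie in the product [(u k).1], the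
   later ones in the complement [(u k.+1).2]. *)
pose D k := smul (u k).1 (u k.+1).2.
have nB : nrm (cgen (\bigcup_k (P k `&` W k))) Om.
  apply: cgen_nrm => x y [k _ [Px Wx]] Oy; have [[[_ _ _ nP] oW] _ _ _ _] := PW k.
  exists k => //; split; first exact: nP.
  by apply: (onorm_nrm oW) => //; exact: OmU.
have [|W0 nW0 nBW] := lnOm (cgen_sg _) (@cgen_closed _ _) _ nB.
  apply: cgen_min => // x [k _ [Px Wx]]; have [[[_ _ PO _] _] _ _ _ _] := PW k; exact: PO.
have [||||||k nk] := @LD_sequence G G_tdlc G_LD U cU P W D W0.
- move=> k; have [[[sP cP PO _] oW] _ _ _ _] := PW k; split => //.
  exact: subset_trans PO OmU.
- move=> k; have [[gP oW] [PC _] _ eQ [CC mPC cPC]] := PW k.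
  have [[gQ gC QN [mQC cQC _]] _] := uP k; have [[_ gC' _ _] _] := uP k.+1.
  have [sQ cQ QO nQ] := gQ; have [sC cC CO nC] := gC.
  have [sC' cC' C'O nC'] := gC'; have [sP cP PO nP] := gP.
  have cQC' : cent (u k).1 (u k.+1).2 by apply: centS cQC.
  split.
  + by apply: sg_smul => //; exact: cent_nrm.
  + apply: cpt_closed => //; apply: compact_smul; apply: (sub_compact cU) => //.
      exact: subset_trans QO OmU.
    exact: subset_trans C'O OmU.
  + by apply: smul_sub => //; apply: subset_trans OmU.
  + move=> p _ Pp [q Qq [c Cc <-]].
    by rewrite mulgA -(cQC q p) //; [rewrite -mulgA (cPC p c) // mulgA|exact: PC].
  + move=> x Px [q Qq [c Cc e]].
    have q1 : q = 1.
      apply: mQC => //; have -> : q = x * c^-1 by rewrite -e mulgK.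
      by apply: (sgDr sC); [exact: PC|exact: CC].
    by apply: mPC => //; rewrite -e q1 mul1g.
- move=> k j; rewrite neq_ltn => /orP[jk|kj] x Px.
    have [[gC _ _ _] _] := uP j; have [[gC' _ _ _] _] := uP k.+1.
    have [[_ gk _ _] _] := uP k.+1.
    apply: smulSl; first by case: gk.
    apply: (Qmono _ _ jk); have [_ _ _ -> _] := PW j; apply: smulSr => //.
    by case: gC.
  have [[gk _ _ _] _] := uP k.
  apply: smulSr; first by case: gk.
  by apply: (Cmono _ _ kj); have [_ [PC _] _ _ _] := PW j; exact: PC.
- move=> V oV; have [k kV] := Vb_basis (onorm_nbhs oV); exists k.
  by apply: subset_trans kV; have [_ [_ h] _ _ _] := PW k.
- exact: nW0.
- exact: nBW.
- by have [_ _ h _ _] := PW k; exact: h.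
Qed.

End Sequence.
End Seq.

(** * A largest member when no member has arbitrarily small finite normal subgroups *)

Section MaxOrTor.
Variable G : topGroupType.
Hypothesis (G_tdlc : tdlc G).
Hypothesis (G_LD : property_LD G).
Variable S : topGroupType -> Prop.
Hypothesis S_class : profinite_similarity_class S.
Hypothesis S_mono : forall H, S H -> monomial H.
Implicit Types A B K L N V W R P Q Y : set G.

Local Notation inS := (inS S).

Let hG : hausdorff_space G. Proof. by case: G_tdlc. Qed.
Let tG : totally_disconnected [set: G]. Proof. by case: G_tdlc. Qed.

Variable U : set G.
Hypothesis cU : cposub U.
Let sU : is_subgroup U. Proof. by case: cU. Qed.
Let cptU : compact U. Proof. by case: cU. Qed.
Let nU : nbhs (1 : G) U. Proof. by case: cU => _ _; exact: open_sg_nbhs. Qed.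
Let clU : closed U. Proof. exact: cpt_closed. Qed.

Variable Vb : nat -> set G.
Hypothesis Vb_onorm : forall k, onorm U (Vb k).
Hypothesis Vb_basis : forall W, nbhs (1 : G) W -> exists k, Vb k `<=` W.

Local Notation NU := (NU U S).

Definition max_member N0 := NU N0 /\ forall N, NU N -> relopen N0 N.

(** A witness [N'] that [M] is not largest is replaced by [M N'], which makes the chain
    ascending. *)
Lemma member_chain N : NU N -> ~ (exists N0, max_member N0) ->
  exists u : nat -> set G, forall i, [/\ NU (u i), u i `<=` u i.+1 & ~ relopen (u i) (u i.+1)].
Proof.
move=> NN nmax.
have [||u uP] := @dep_choice (set G) (fun _ (N : set G) => NU N) (fun _ (N N' : set G) => N `<=` N' /\ ~ relopen N N') N.
- exact: NN.
- move=> _ M NM; have [N' NN' nr] : exists2 N', NU N' & ~ relopen M N'.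
    apply: contrapT => h; apply: nmax; exists M; split => // N' NN'.
    by apply: contrapT => nr; apply: h; exists N'.
  have sM : is_subgroup M by case: NM => /inS_sg.
  have sN' : is_subgroup N' by case: NN' => /inS_sg.
  exists (smul M N'); first exact: (NU_smul G_tdlc cU S_class S_mono G_LD).
  split; first exact: smulSl.
  move=> [W nW h]; apply: nr; exists W => // x [Nx Wx]; apply: h; split => //.
  exact: smulSr.
by exists u => i; have [? [? ?]] := uP i.
Qed.

(** The components provided by [transfer] take values in the abelian [Y] and jointly detect 1, so
    commutators of elements near 1 vanish. *)
Lemma abelian_transfer N Y : inS N -> inS Y -> cent Y Y ->
  exists2 V, onorm U V & cent (N `&` V) (N `&` V).
Proof.
move=> iN iY cY.
have [b [g [V2 [V [[oV2 oV] gM gX [_ gI] _]]]]] := transfer S_class G_tdlc cU iN iY.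
exists V2 => // x y hx hy.
have sNV : is_subgroup (N `&` V2) by apply: sgI; [exact: inS_sg iN|exact: onorm_sg oV2].
have hxy := sgM sNV hx hy; have hyx := sgM sNV hy hx.
have hz := sgD sNV hyx hxy.
have z1 : (y * x)^-1 * (x * y) = 1.
  apply: gI => // i; apply: (mulgI (g i (y * x))).
  rewrite -gM // mulVKg mulg1 !gM //.
  by have [Yx _] := gX i _ hx; have [Yy _] := gX i _ hy; exact: cY.
by rewrite -[LHS](mulVKg (y * x)) z1 mulg1.
Qed.

Hypothesis not_tor : forall P, inS P -> P `<=` U -> ~ tor U P.

(** The complement of a piece [P] is its centraliser in [C], normalised by [U] because [P] is.
    [P & centr P] is abelian; if infinite it would belong to S, so it is a finite normal subgroup of
    [M], trivial by the choice of [V3]. (LD) is only used to see that [P] times its centraliser is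
    open. *)
Lemma max_nonabelian N : NU N -> (forall Y, inS Y -> ~ cent Y Y) ->
  exists N0, max_member N0.
Proof.
move=> NN nab; apply: contrapT => nmax.
have [u uP] := member_chain NN nmax.
apply: (@sequence_absurd G G_tdlc G_LD S S_class S_mono U cU Vb Vb_onorm Vb_basis U u) => //.
- by move=> B sB cB BU nB; exists U.
- by move=> i; have [[? ? ?] ? ?] := uP i.
move=> C M V sC cC CU nC iM MC nM oV.
have sM := inS_sg iM; have clM := inS_closed S_class hG iM.
have MU : M `<=` U by exact: subset_trans CU.
have [V0 [R [oV0 sR [clR RU] [cMR mMR] hV]]] :=
  LD_split G_tdlc cU G_LD sM clM MU nU nM.
have [V3 [oV3 hV3]] : exists V3, onorm U V3 /\ forall D, is_subgroup D -> finite_set D ->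
    D `<=` M `&` V3 -> nrm D M -> forall x, D x -> x = 1.
  apply: contrapT => h; apply: (not_tor iM MU) => V3 oV3.
  apply: contrapT => h2; apply: h; exists V3; split => // D sD fD DM nD x Dx.
  by apply: contrapT => x1; apply: h2; exists D; split => //; exists x.
pose V1 := V `&` V0 `&` V3.
have oV1 : onorm U V1 by do 2?apply: onormI.
have V1V0 : V1 `<=` V0 by move=> x [[]].
have [V' oV' [V'V1 V'P]] := hV _ oV1 V1V0.
pose P := M `&` V1; pose C' := C `&` centr P.
have nP : nrm P U by apply: nrmI => //; exact: onorm_nrm oV1.
have iP : inS P by exact: (inS_cap G_tdlc S_class iM oV1).
have sP := inS_sg iP; have clP := inS_closed S_class hG iP.
exists V1, C'; split.
- by split => // x [[]].
- split; first by apply: sgI => //; exact: sg_centr.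
  + by apply: closedI => //; exact: closed_centr.
  + by move=> x [].
  + by apply: nrmI => //; exact: nrm_centr.
- move=> x Px [_ cx].
  have sZ : is_subgroup (P `&` centr P) by apply: sgI => //; exact: sg_centr.
  have nZ : nrm (P `&` centr P) U by apply: nrmI => //; exact: nrm_centr.
  have clZ : closed (P `&` centr P) by apply: closedI => //; exact: closed_centr.
  apply: (hV3 (P `&` centr P)) => //; last first.
  + by apply: nrmS nZ MU.
  + by move=> y [[My [[_ _] V3y]] _].
  apply: contrapT => infZ; apply: (nab (P `&` centr P)).
    apply: (@inS_normal _ S_class _ hG tG S_mono M _ U) => //.
      by move=> y [[]].
    by apply: (nrmS nZ) => y [].
  by move=> y z [Py _] [_ cz]; exact: cz.
- by move=> x y Px [_ cy]; exact: cy.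
- exists V'; first exact: onorm_nbhs oV'.
  move=> x [Cx V'x]; have [p Pp [r Rr e]] := V'P _ V'x.
  exists p => //; exists r => //; split.
    have -> : r = p^-1 * x by rewrite -e mulKg.
    by apply: (sgD sC) => //; apply: MC; case: Pp.
  by move=> a [Ma V1a]; apply: cMR => //; split => //; exact: V1V0.
Qed.

(** Each term of the chain is abelian near 1, but different terms need not commute. They are trimmed
    to [L i] that do; the chain argument then runs inside an open part [Om] of the abelian group
    [Lam] they generate. *)
Lemma max_abelian N Y : NU N -> inS Y -> cent Y Y -> exists N0, max_member N0.
Proof.
move=> NN iY cY; apply: contrapT => nmax.
have [u uP] := member_chain NN nmax.
(* Shrink first to [Vi], on which [u i] is abelian, and then to a [V'] contained in [(u i & Vi) R],
   which centralises [u i & Vi]. Later terms are trimmed inside [V'], hence commute with this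
   one. *)
pose rel i V V' := exists Vi : set G, [/\ onorm U Vi, Vi `<=` V, V' `<=` Vi,
  cent (u i `&` Vi) (u i `&` Vi) & cent (u i `&` Vi) V'].
have [||v vP] := @dep_choice (set G) (fun _ => onorm U) rel U.
- exact: onormU.
- move=> i V oV; have [[iN NsU nN] _ _] := uP i.
  have sN := inS_sg iN; have clN := inS_closed S_class hG iN.
  have [Va oVa cVa] := abelian_transfer iN iY cY.
  have [V0 [R [oV0 sR [clR RU] [cNR mNR] hV]]] :=
    LD_split G_tdlc cU G_LD sN clN NsU nU nN.
  pose Vi := V `&` V0 `&` Va.
  have oVi : onorm U Vi by do 2?apply: onormI.
  have ViV0 : Vi `<=` V0 by move=> x [[]].
  have [V' oV' [V'Vi V'P]] := hV _ oVi ViV0.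
  have cVi : cent (u i `&` Vi) (u i `&` Vi).
    by apply: centS cVa => x [Nx [_ Vax]].
  exists V' => //; exists Vi; split => //; first by move=> x [[]].
  move=> x y [Nx Vx] /V'P[a Na [r Rr <-]].
  have cx : x * r = r * x by apply: cNR => //; split => //; exact: ViV0.
  by rewrite mulgA (cVi x a) // -mulgA cx mulgA.
have /choice[vi {}vP] : forall i, exists Vi, [/\ onorm U (v i) /\ onorm U Vi,
    Vi `<=` v i, v i.+1 `<=` Vi,
    cent (u i `&` Vi) (u i `&` Vi) & cent (u i `&` Vi) (v i.+1)].
  by move=> i; have [oV [Vi [? ? ? ? ?]]] := vP i; exists Vi.
have vmono i j : (i <= j)%N -> v j `<=` v i.
  move=> /subnK <-; elim: (j - i)%N => // n IH.
  apply: subset_trans _ IH; rewrite addSn; have [_ h1 h2 _ _] := vP (n + i)%N.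
  exact: subset_trans h2 h1.
pose L i := u i `&` vi i.
have cLL i j : cent (L i) (L j).
  wlog ij : i j / (i <= j)%N.
    move=> h; have [/h//|/ltnW/h c] := leqP i j; exact: cent_sym.
  move: ij; rewrite leq_eqVlt => /orP[/eqP->|ij].
    by have [_ _ _ h _] := vP j.
  have [_ _ _ _ h] := vP i; apply: centS h => // x [_ /= hx].
  by apply: (vmono _ _ ij); have [_ h _ _ _] := vP j; exact: h.
pose Lam := cgen (\bigcup_i L i).
have cLam : cent Lam Lam.
  apply: cgen_cent => //; apply: cent_sym; apply: cgen_cent => //.
  by move=> x y [i _ Lx] [j _ Ly]; exact: (cLL i j).
have sLam : is_subgroup Lam by exact: cgen_sg.
have clLam : closed Lam by exact: cgen_closed.
have LamU : Lam `<=` U.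
  by apply: cgen_min => // x [i _ [ux _]]; have [[_ h _] _ _] := uP i; exact: h.
have nLam : nrm Lam U.
  apply: cgen_nrm => x y [i _ [ux vx]] Uy; exists i => //.
  have [[_ _ h] _ _] := uP i; have [[_ o] _ _ _ _] := vP i.
  by split; [exact: h|exact: (onorm_nrm o)].
have [V0 [R [oV0 sR [clR RU] [cLR mLR] hV]]] :=
  LD_split G_tdlc cU G_LD sLam clLam LamU nU nLam.
have [V' oV' [V'V0 V'P]] := hV _ oV0 (@subset_refl _ _).
have sV0 := onorm_sg oV0; have clV0 := onorm_closed oV0.
(* [V'] lies in [Om R]; as [Om] is abelian and commutes with [R], [V'] centralises [Om], and every
   subgroup of [Om] is locally normal. *)
pose Om := Lam `&` V0.
have sOm : is_subgroup Om by exact: sgI.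
have clOm : closed Om by exact: closedI.
have OmU : Om `<=` U by move=> x [/LamU].
have cOm : cent Om Om by apply: centS cLam => x [].
have nrmV' B : B `<=` Om -> nrm B V'.
  move=> BO x y Bx /V'P[a Oa [r Rr <-]]; have Ox := BO _ Bx.
  by rewrite conjgM [x ^ a]conjgE (cOm x a) // mulKg conjgE (cLR x r) // mulKg.
have nOm B : B `<=` Om -> nrm B Om.
  by move=> BO; apply: cent_nrm; exact: centS cOm.
pose N' i := u i `&` Om.
have capN i : u i `&` (vi i `&` V0) `<=` N' i.
  by move=> x [ux [vx V0x]]; split => //; split => //; apply: cgen_sub; exists i.
have nb i : nbhs (1 : G) (vi i `&` V0).
  by have [[_ o] _ _ _ _] := vP i; apply: filterI; [exact: onorm_nbhs o|exact: onorm_nbhs oV0].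
apply: (@sequence_absurd G G_tdlc G_LD S S_class S_mono U cU Vb Vb_onorm Vb_basis Om N') => //.
- by move=> B sB cB BO _; exists V'; [exact: onorm_nbhs oV'|exact: nrmV'].
- move=> i; have [[iN NsU nN] ui nr] := uP i.
  have iN' : inS (N' i).
    apply: (inS_down G_tdlc S_class iN _ _ _ (nb i) (capN i)).
    - by apply: sgI => //; exact: inS_sg iN.
    - by apply: closedI => //; exact: (inS_closed S_class hG iN).
    - by move=> x [].
  split => //.
  - by move=> x [].
  - by apply: nOm => x [].
  - by move=> x [ux Ox]; split => //; exact: ui.
  move=> [W nW h]; apply: nr; exists (W `&` (vi i.+1 `&` V0)).
    exact: filterI.
  move=> x [ux [Wx hx]]; have N'x : N' i.+1 x by exact: capN.
  by have [] := h _ (conj N'x Wx).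
move=> C M V sC cC CO nC iM MC nM oV.
have sM := inS_sg iM; have clM := inS_closed S_class hG iM.
have MO : M `<=` Om by exact: subset_trans CO.
have MU : M `<=` U by exact: subset_trans OmU.
have [V0m [Rm [oV0m sRm [clRm RmU] [cMR mMR] hVm]]] :=
  LD_split G_tdlc cU G_LD sM clM MU (onorm_nbhs oV') (nrmV' _ MO).
pose V1 := V `&` V0m.
have oV1 : onorm U V1 by exact: onormI.
have V1V0 : V1 `<=` V0m by move=> x [].
have [V'' oV'' [V''V1 V''P]] := hVm _ oV1 V1V0.
have MV1 : M `&` V1 `<=` M `&` V0m by move=> x [Mx /V1V0].
exists V1, (C `&` Rm); split.
- by split => // x [].
- split; [exact: sgI|exact: closedI|by move=> x []|].
  by apply: nOm => x [/CO].
- by move=> x /MV1 Mx [_ Rx]; exact: mMR.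
- by move=> x y /MV1 Mx [_ Ry]; exact: cMR.
- exists V''; first exact: onorm_nbhs oV''.
  move=> x [Cx V''x]; have [p Pp [r Rr e]] := V''P _ V''x.
  exists p => //; exists r => //; split => //.
  have -> : r = p^-1 * x by rewrite -e mulKg.
  by apply: (sgD sC) => //; apply: MC; case: Pp.
Qed.

End MaxOrTor.

(** * Finite simple groups and residually simple groups *)

Lemma finite_minimal (T : eqType) (Pr : set T -> Prop) (D : set T) :
  finite_set D -> Pr D ->
  exists D', [/\ D' `<=` D, Pr D' & forall D'', D'' `<=` D' -> Pr D'' -> D' `<=` D''].
Proof.
move=> /finite_seqP[s ->]; have [n ns] := ubnP (size s).
elim: n s ns => // n IH s ns Ps.
have [[D'' [sD PD nD]]|h] := pselect (exists D'', [/\ D'' `<=` [set` s], Pr D'' & ~ [set` s] `<=` D'']); last first.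
  exists [set` s]; split => // D'' sD PD; apply: contrapT => nD; apply: h.
  by exists D''.
pose t := [seq x <- s | x \in D''].
have et : D'' = [set` t].
  apply/seteqP; split => x /=; rewrite mem_filter.
    by move=> Dx; rewrite (mem_set Dx); exact: sD.
  by move=> /andP[/set_mem].
have st : (size t < n)%N.
  suff h : (size t < size s)%N by exact: (leq_trans h ns).
  rewrite size_filter.
  rewrite ltn_neqAle count_size andbT -all_count.
  apply/negP => /allP h; apply: nD => x /= /h; exact: set_mem.
have [|D' [D'D PD' hm]] := IH t st; first by rewrite -et.
exists D'; split => //; apply: subset_trans sD; by rewrite et.
Qed.

Section Simple.
Variable G : topGroupType.
Implicit Types A B D E K M P V W : set G.

Definition nontriv A := exists2 x, A x & x <> 1.

(** Groups of prime order are included. *)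
Definition simpleg E := [/\ is_subgroup E, finite_set E, nontriv E &
  forall K, is_subgroup K -> K `<=` E -> nrm K E -> nontriv K -> E `<=` K].

Definition giso E E' := exists h : G -> G,
  [/\ forall x y, E x -> E y -> h (x * y) = h x * h y,
      forall x y, E x -> E y -> h x = h y -> x = y & h @` E = E'].

Lemma giso_sym E E' : is_subgroup E -> giso E E' -> giso E' E.
Proof.
move=> sE [h [hM hI hE]].
have /choice[k kP] : forall y, exists x, E' y -> E x /\ h x = y.
  move=> y; have [|n] := pselect (E' y); last by exists 1.
  by rewrite -{1}hE => -[x Ex <-]; exists x.
have kh x : E x -> k (h x) = x.
  move=> Ex; have [|Ek e] := kP (h x); first by rewrite -hE; exists x.
  exact: hI.
exists k; split.
- move=> x y; rewrite -hE => -[a Ea <-] [b Eb <-].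
  by rewrite -hM // !kh //; exact: sgM.
- by move=> x y; rewrite -hE => -[a Ea <-] [b Eb <-]; rewrite !kh // => ->.
- apply/seteqP; split => x.
    by move=> [y E'y <-]; have [] := kP _ E'y.
  by move=> Ex; exists (h x); [rewrite -hE; exists x|exact: kh].
Qed.

Lemma giso_trans E1 E2 E3 : giso E1 E2 -> giso E2 E3 -> giso E1 E3.
Proof.
move=> [h [hM hI hE]] [k [kM kI kE]].
have hin x : E1 x -> E2 (h x) by move=> Ex; rewrite -hE; exists x.
exists (k \o h); split.
- by move=> x y Ex Ey /=; rewrite hM // kM //; exact: hin.
- by move=> x y Ex Ey /= e; apply: hI => //; apply: kI => //; exact: hin.
- by rewrite -kE -hE image_comp.
Qed.

Lemma hom1 (p : G -> G) A : is_subgroup A ->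
  (forall x y, A x -> A y -> p (x * y) = p x * p y) -> p 1 = 1.
Proof.
by move=> sA pM; apply: (mulgI (p 1)); rewrite -pM ?mulg1 //; exact: sg1.
Qed.

Lemma homV (p : G -> G) A x : is_subgroup A ->
  (forall x y, A x -> A y -> p (x * y) = p x * p y) -> A x -> p x^-1 = (p x)^-1.
Proof.
move=> sA pM Ax; apply: (mulgI (p x)).
by rewrite -pM ?mulgV ?(hom1 sA) //; exact: sgV.
Qed.

Lemma homJ (p : G -> G) A x y : is_subgroup A ->
  (forall x y, A x -> A y -> p (x * y) = p x * p y) -> A x -> A y ->
  p (x ^ y) = p x ^ p y.
Proof.
move=> sA pM Ax Ay; rewrite !conjgE !pM ?(homV sA pM) //; first exact: sgV.
exact: sgM.
Qed.

Lemma hom_sg (p : G -> G) A : is_subgroup A ->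
  (forall x y, A x -> A y -> p (x * y) = p x * p y) -> is_subgroup (p @` A).
Proof.
move=> sA pM; split.
- by exists 1; [exact: sg1|exact: hom1 pM].
- by move=> _ _ [x Ax <-] [y Ay <-]; exists (x * y); [exact: sgM|exact: pM].
- by move=> _ [x Ax <-]; exists x^-1; [exact: sgV|exact: homV pM _].
Qed.

Lemma simple_hom_inj (h : G -> G) E : simpleg E ->
  (forall x y, E x -> E y -> h (x * y) = h x * h y) ->
  (exists2 e, E e & h e <> 1) -> forall x y, E x -> E y -> h x = h y -> x = y.
Proof.
move=> [sE fE _ sim] hM [e Ee he] x y Ex Ey hxy.
pose K := [set z | E z /\ h z = 1].
have [[z Kz z1]|triv] := pselect (nontriv K).
  have EK : E `<=` K.
    apply: sim.
    - split; first by split; [exact: sg1|exact: hom1 hM].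
      + move=> a b [Ea ha] [Eb hb]; split; first exact: sgM.
        by rewrite hM // ha hb mulg1.
      + move=> a [Ea ha]; split; first exact: sgV.
        by rewrite (homV sE hM) // ha invg1.
    - by move=> a [].
    - move=> a b [Ea ha] Eb; split; first exact: sgJ.
      by rewrite (homJ sE hM) // ha conj1g.
    - by exists z.
  by case: (EK _ Ee) => _ /he.
apply: divg1_eq; apply: contrapT => n1; apply: triv; exists (x * y^-1) => //.
split; first exact: sgDr.
by rewrite hM ?(homV sE hM) ?hxy ?mulgV //; exact: sgV.
Qed.

Lemma simple_hom_giso (h : G -> G) E E' : simpleg E -> simpleg E' ->
  (forall x y, E x -> E y -> h (x * y) = h x * h y) ->
  (exists2 e, E e & h e <> 1) -> h @` E `<=` E' -> nrm (h @` E) E' -> giso E E'.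
Proof.
move=> sE [sE' _ _ sim'] hM nt hEE nh; exists h; split => //.
  exact: simple_hom_inj.
case: sE => sgE _ _ _; apply/seteqP; split => //; apply: sim' => //.
  exact: hom_sg.
by case: nt => e Ee he; exists (h e) => //; exists e.
Qed.

(** The last clause is continuity at 1 for the discrete topology on [E]. *)
Definition qhom A E (p : G -> G) := [/\
  forall x y, A x -> A y -> p (x * y) = p x * p y, p @` A = E &
  exists2 W, nbhs (1 : G) W & forall x, A x -> W x -> p x = 1].

Hypothesis G_tdlc : tdlc G.
Let hG : hausdorff_space G. Proof. by case: G_tdlc. Qed.
Variable U : set G.
Hypothesis cU : cposub U.

(** Take [M] maximal among the normal subgroups of [A] that contain [A & V] and omit [r]. By
    maximality [r] lies in [E M] for every [E] of [Sig] outside [M]. This forces [A] to be the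
    product of [M] and one such [E0], with trivial intersection, and [p] is the projection to
    [E0]. *)
Lemma simple_quotient A (Sig : set (set G)) r : is_subgroup A -> closed A -> A `<=` U ->
  A `<=` cgen (\bigcup_(E in Sig) E) ->
  (forall E, Sig E -> [/\ simpleg E, E `<=` A & nrm E A]) ->
  A r -> r <> 1 -> exists E p, [/\ Sig E, qhom A E p & p r <> 1].
Proof.
move=> sA clA AU gA hS Ar r1.
have [V oV Vr] := onorm_small G_tdlc cU (nbhs_neq hG r1).
have nVr : ~ V r by move=> /Vr; apply.
have sV := onorm_sg oV; have nV := onorm_nrm oV.
pose Pm M := [/\ is_subgroup M, M `<=` A, nrm M A, A `&` V `<=` M & ~ M r].
have P0 : Pm (A `&` V).
  split; [exact: sgI|by move=> x []| |by []|by move=> []].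
  by apply: nrmI; [exact: sg_nrm|exact: nrmS nV AU].
pose Pz M := M = set0 \/ Pm M.
have [|M [PM maxM]] := @Zorn_bigcup G Pz.
  move=> F FP tF.
  have [[M0 FM0 neM0]|e] := pselect (exists2 M0, F M0 & M0 !=set0); last first.
    left; apply/seteqP; split => // x [M FM Mx]; exfalso; apply: e.
    by exists M => //; exists x.
  have PF M x : F M -> M x -> Pm M.
    by move=> FM Mx; case: (FP _ FM) => // e0; move: Mx; rewrite e0.
  right; have [x0 M0x0] := neM0; have [sM0 _ _ VM0 _] := PF _ _ FM0 M0x0.
  split.
  - split; first by exists M0 => //; exact: sg1.
    + move=> x y [M1 F1 M1x] [M2 F2 M2y].
      have [h|h] := tF _ _ F1 F2.
        exists M2 => //; have [s2 _ _ _ _] := PF _ _ F2 M2y.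
        by apply: sgM => //; exact: h.
      exists M1 => //; have [s1 _ _ _ _] := PF _ _ F1 M1x.
      by apply: sgM => //; exact: h.
    + move=> x [M1 F1 M1x]; exists M1 => //.
      by have [s1 _ _ _ _] := PF _ _ F1 M1x; exact: sgV.
  - by move=> x [M1 F1 M1x]; have [_ h _ _ _] := PF _ _ F1 M1x; exact: h.
  - move=> x a [M1 F1 M1x] Aa; exists M1 => //.
    by have [_ _ h _ _] := PF _ _ F1 M1x; exact: h.
  - by move=> x hx; exists M0 => //; exact: VM0.
  - by move=> [M1 F1 M1r]; have [_ _ _ _] := PF _ _ F1 M1r; apply.
have {PM} [sM MA nM VM nMr] : Pm M.
  case: PM => // e; exfalso; apply: (maxM (A `&` V)); last by right.
  split; first by rewrite e.
  rewrite e => h; have [] := h 1; split; exact: sg1.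
have nbV := onorm_nbhs oV.
have clM : closed M by exact: (@sg_closed _ M A V).
have big E : Sig E -> ~ E `<=` M -> smul E M r.
  move=> SE nEM; have [[sE fE ntE simE] EA nE] := hS _ SE.
  have sEM : is_subgroup (smul E M) by apply: sg_smul => //; exact: nrmS nE MA.
  apply: contrapT => nr; apply: (maxM (smul E M)).
    split; first exact: smulSr.
    move=> h; apply: nEM; apply: subset_trans h; exact: smulSl.
  right; split => //; first exact: smul_sub.
    exact: nrm_smul.
  by move=> x /VM; exact: smulSr.
have [E0 SE0 nE0] : exists2 E, Sig E & ~ E `<=` M.
  apply: contrapT => h; apply: nMr; apply: (gA _ Ar); split => //.
  move=> x [E SE Ex]; have := contrapT (fun n => h (ex_intro2 _ _ E SE n)).
  exact.
have [[sE0 fE0 ntE0 simE0] E0A nE0A] := hS _ SE0.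
have sEM : is_subgroup (smul E0 M) by apply: sg_smul => //; exact: nrmS nE0A MA.
have cE0 : compact E0 by exact: finite_compact.
(* If [E] is not inside [M], then [r = e * m] with [e] in [E]; this [e = r * m^-1] also lies in
   [E0 M], and simplicity of [E] puts all of [E] there. *)
have AE : A `<=` smul E0 M.
  apply: subset_trans gA _; apply: cgen_min => //.
    apply: cpt_closed => //; apply: compact_smul => //.
    by apply: (sub_compact cU) => //; exact: subset_trans MA AU.
  move=> x [E SE Ex].
  have [[sE fE ntE simE] EA nE] := hS _ SE.
  have [EM|nEM] := pselect (E `<=` M); first by apply: smulSr => //; exact: EM.
  have [e Ee [m Mm er]] := big _ SE nEM.
  have er' : e = r * m^-1 by rewrite -er mulgK.
  suff : E `<=` E `&` smul E0 M by move=> /(_ _ Ex)[].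
  apply: simE.
  - exact: sgI.
  - by move=> z [].
  - apply: nrmI; first exact: sg_nrm.
    by apply: (nrmS _ EA); apply: nrm_smul.
  - exists e; last first.
      by move=> e1; apply: nMr; rewrite -er e1 mul1g.
    split => //; rewrite er'; apply: (sgDr sEM); first exact: big.
    exact: smulSr.
have mEM : meet1 E0 M.
  move=> x Ex Mx; apply: contrapT => x1.
  apply: nE0; suff : E0 `<=` E0 `&` M by move=> h z /h[].
  apply: simE0; [exact: sgI|by move=> z []| |by exists x].
  by apply: nrmI; [exact: sg_nrm|exact: nrmS nM E0A].
have /choice[p pP] : forall x, exists e, A x -> E0 e /\ M (e^-1 * x).
  move=> x; have [/AE[e Ee [m Mm <-]]|n] := pselect (A x); last by exists 1.
  by exists e; rewrite mulKg.
have punique x e : A x -> E0 e -> M (e^-1 * x) -> p x = e.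
  move=> Ax Ee Mx; have [Ep Mp] := pP _ Ax.
  have h : M (e^-1 * x * ((p x)^-1 * x)^-1) by exact: sgDr.
  symmetry; apply/esym; apply: (mulgI e^-1); rewrite mulVg.
  apply: mEM; first exact: sgD.
  by move: h; rewrite invgM invgK mulgA mulgK.
exists E0, p; split => //; last first.
  move=> pr; have [_] := pP _ Ar; rewrite pr invg1 mul1g; exact: nMr.
split.
- move=> x y Ax Ay; have [Ex Mx] := pP _ Ax; have [Ey My] := pP _ Ay.
  apply: punique; [exact: sgM|exact: sgM|].
  have -> : (p x * p y)^-1 * (x * y) = ((p x)^-1 * x) ^ (p y) * ((p y)^-1 * y) by gsimp.
  by apply: sgM => //; apply: nM => //; exact: E0A.
- apply/seteqP; split => [_ [x Ax <-]|e Ee]; first by have [] := pP _ Ax.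
  exists e; first exact: E0A.
  by apply: punique => //; [exact: E0A|rewrite mulVg; exact: sg1].
- exists V => // x Ax Vx; apply: punique => //; first exact: sg1.
  by rewrite invg1 mul1g; exact: VM.
Qed.

End Simple.

(** * Simple subgroups of finite normal subgroups *)

Section TorSeq.
Variable G : topGroupType.
Hypothesis (G_tdlc : tdlc G).
Variable S : topGroupType -> Prop.
Hypothesis S_class : profinite_similarity_class S.
Hypothesis S_mono : forall H, S H -> monomial H.
Implicit Types A B D E K L N V W R P Q T X Y : set G.

Local Notation inS := (inS S).

Let hG : hausdorff_space G. Proof. by case: G_tdlc. Qed.
Let tG : totally_disconnected [set: G]. Proof. by case: G_tdlc. Qed.

Variable U : set G.
Hypothesis cU : cposub U.
Let sU : is_subgroup U. Proof. by case: cU. Qed.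
Let cptU : compact U. Proof. by case: cU. Qed.

Variable Vb : nat -> set G.
Hypothesis Vb_onorm : forall k, onorm U (Vb k).
Hypothesis Vb_basis : forall W, nbhs (1 : G) W -> exists k, Vb k `<=` W.

Lemma fin_closed E : finite_set E -> closed E.
Proof.
move=> fE; apply: (iffLR accessible_finite_set_closed) => //.
exact: hausdorff_accessible.
Qed.

Definition goodpair P D E := [/\ [/\ is_subgroup D, finite_set D, D `<=` P & nrm D P],
  E `<=` D, nrm E D & simpleg E].

(* A minimal normal subgroup of a minimal finite normal subgroup D of P is simple:
   D is generated by its P-conjugates, all of which are absorbed by E M, where M is
   a maximal normal subgroup of D meeting E trivially. *)
Lemma minimal_goodpair P D0 : is_subgroup P -> is_subgroup D0 -> finite_set D0 ->
  D0 `<=` P -> nrm D0 P -> nontriv D0 -> exists D E, goodpair P D E /\ D `<=` D0.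
Proof.
move=> sP sD0 fD0 DP nD0 ntD0.
have [D [DD0 [sD nD ntD] minD]] := @finite_minimal G
  (fun D => [/\ is_subgroup D, nrm D P & nontriv D]) D0 fD0 (And3 sD0 nD0 ntD0).
have fD : finite_set D by exact: sub_finite_set DD0 fD0.
have DP' : D `<=` P by exact: subset_trans DP.
have [E [ED [sE nE ntE] minE]] := @finite_minimal G
  (fun E => [/\ is_subgroup E, nrm E D & nontriv E]) D fD
  (And3 sD (sg_nrm sD) ntD).
have fE : finite_set E by exact: sub_finite_set ED fD.
pose Pm M := [/\ is_subgroup M, M `<=` D, nrm M D & meet1 M E].
have s1 : is_subgroup [set 1 : G].
  by split => // [x y -> ->|x ->]; rewrite ?mulg1 ?invg1.
(* A maximal [M] is obtained as the complement in [D] of a minimal [X]. *)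
have [||X [XD PX minX]] := @finite_minimal G (fun X => Pm (D `\` X)) (D `\` [set 1]).
- by apply: sub_finite_set fD => x [].
- have -> : D `\` (D `\` [set 1]) = [set 1].
    apply/seteqP; split => [x [Dx h]|x ->].
      by apply: contrapT => x1; apply: h.
    by split; [exact: sg1|move=> [_]; apply].
  split => //; first by move=> x ->; exact: sg1.
    by move=> x y -> _; rewrite conj1g.
pose M := D `\` X; rewrite -/M in PX.
have maxM M' : Pm M' -> M `<=` M' -> M' `<=` M.
  move=> PM' MM'; have M'D : M' `<=` D by case: PM'.
  move=> x M'x; split; first exact: M'D.
  suff XM : X `<=` D `\` M' by move=> /XM[].
  apply: minX.
    by move=> y [Dy nM'y]; apply: contrapT => nX; apply: nM'y; exact: MM'.
  have -> // : D `\` (D `\` M') = M'.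
  apply/seteqP; split => [y [Dy hy]|y M'y].
    by apply: contrapT => nM'; apply: hy.
  by split; [exact: M'D|move=> [_]; apply].
have [sM MD nM mM] := PX.
have sEM : is_subgroup (smul E M) by apply: sg_smul => //; exact: nrmS nE MD.
have nEM : nrm (smul E M) D by exact: nrm_smul.
have conjEM x : P x -> [set y ^ x | y in E] `<=` smul E M.
  move=> Px; set Ex := [set y ^ x | y in E].
  have sEx : is_subgroup Ex.
    by apply: hom_sg => // a b _ _; exact: conjMg.
  have ExD : Ex `<=` D by move=> _ [y Ey <-]; apply: nD => //; exact: ED.
  have nEx : nrm Ex D.
    move=> _ d [y Ey <-] Dd; exists (y ^ (d ^ x^-1)).
      by apply: nE => //; apply: nD => //; exact: sgV.
    by rewrite -!conjgM; congr (_ ^ _); gsimp.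
  have [nt|tr] := pselect (nontriv (Ex `&` smul E M)).
    pose K := [set y | E y /\ smul E M (y ^ x)].
    have EK : E `<=` K.
      apply: minE.
      - by move=> y [].
      split.
      - split; first by split; [exact: sg1|rewrite conj1g; exact: sg1].
        + by move=> a b [Ea ha] [Eb hb]; split; [exact: sgM|rewrite conjMg; exact: sgM].
        + by move=> a [Ea ha]; split; [exact: sgV|rewrite conjVg; exact: sgV].
      - move=> a d [Ea ha] Dd; split; first exact: nE.
        have -> : (a ^ d) ^ x = (a ^ x) ^ (d ^ x) by rewrite conjJg.
        by apply: nEM => //; exact: nD.
      - have [_ [[y Ey <-] hy] y1] := nt; exists y => // e.
        by apply: y1; rewrite e conj1g.
    by move=> _ [y /EK[_ hy] <-].
  apply: subset_trans (@smulSr _ _ _ sE); apply: subset_trans (@smulSl _ _ _ sM) _.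
  apply: maxM; last exact: smulSr.
  split.
  - by apply: sg_smul => //; exact: nrmS nEx MD.
  - exact: smul_sub.
  - exact: nrm_smul.
  - move=> e [y Exy [m Mm e1]] Ee; have y1 : y = 1.
      apply: contrapT => y1; apply: tr; exists y => //; split => //.
      exists e => //; exists m^-1; first exact: sgV.
      by rewrite -e1 mulgK.
    by apply: mM => //; rewrite -e1 y1 mul1g.
pose K := generated (\bigcup_(x in P) [set y ^ x | y in E]).
have KD : D `<=` K.
  apply: minD.
    apply: smallest_sub => //; move=> _ [x Px [y Ey <-]]; apply: nD => //; exact: ED.
  split.
  - split; first by move=> A [sA _]; exact: sg1.
    + by move=> a b Ka Kb A hA; have [sA _] := hA; apply: sgM => //; [exact: Ka|exact: Kb].
    + by move=> a Ka A hA; have [sA _] := hA; apply: sgV => //; exact: Ka.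
  - move=> a z Ka Pz A [sA hA]; apply: (Ka [set b | A (b ^ z)]); split.
      split; first by rewrite /= conj1g; exact: sg1.
        by move=> b c /= Ab Ac; rewrite conjMg; exact: sgM.
      by move=> b /= Ab; rewrite conjVg; exact: sgV.
    move=> _ [x Px [y Ey <-]] /=; rewrite -conjgM; apply: hA.
    by exists (x * z); [exact: sgM|exists y].
  - have [y Ey y1] := ntE; exists y => // A [sA hA]; apply: hA.
    by exists 1; [exact: sg1|exists y => //; rewrite conjg1].
have DEM : D `<=` smul E M.
  apply: subset_trans KD _; apply: smallest_sub => // y [x Px]; exact: conjEM.
have cEM : cent M E.
  by apply: meet1_cent => //; [exact: nrmS nM ED|exact: nrmS nE MD].
exists D, E; split => //; split => //; split => // K' sK' K'E nK' ntK'.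
apply: minE => //; split => // k d Kk /DEM[e Ee [m Mm <-]].
rewrite conjgM [_ ^ m]conjgE -(cEM m) ?mulKg; first exact: nK'.
  by [].
by apply: K'E; exact: nK'.
Qed.

End TorSeq.

(** * Sequences of commuting finite normal subgroups shrinking to 1 *)

Section TorSeq2.
Variable G : topGroupType.
Hypothesis (G_tdlc : tdlc G).
Variable S : topGroupType -> Prop.
Hypothesis S_class : profinite_similarity_class S.
Hypothesis S_mono : forall H, S H -> monomial H.
Implicit Types A B K L V W R Q T X Y : set G.

Local Notation inS := (inS S).

Let hG : hausdorff_space G. Proof. by case: G_tdlc. Qed.
Let tG : totally_disconnected [set: G]. Proof. by case: G_tdlc. Qed.

Variable U : set G.
Hypothesis cU : cposub U.
Let sU : is_subgroup U. Proof. by case: cU. Qed.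
Let cptU : compact U. Proof. by case: cU. Qed.

Variable Vb : nat -> set G.
Hypothesis Vb_onorm : forall k, onorm U (Vb k).
Hypothesis Vb_basis : forall W, nbhs (1 : G) W -> exists k, Vb k `<=` W.

Variable P : set G.
Hypotheses (iP : inS P) (PU : P `<=` U) (torP : tor U P).
Let sP : is_subgroup P. Proof. exact: inS_sg iP. Qed.
Let clP : closed P. Proof. exact: (inS_closed S_class hG iP). Qed.

Lemma goodpair_small V : onorm U V -> exists D E, goodpair P D E /\ D `<=` V.
Proof.
move=> oV; have [D0 [sD0 fD0 D0P nD0 ntD0]] := torP oV.
have [|D [E [gDE DD0]]] := @minimal_goodpair G P D0 sP sD0 fD0 _ nD0 ntD0.
  by move=> x /D0P[].
by exists D, E; split => // x /DD0 /D0P[].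
Qed.

(** For [x] in [P] near 1, [d^-1 * d ^ x] lies in [D] and in a neighbourhood that meets [D] only in
    1. *)
Lemma finite_centralised D : is_subgroup D -> finite_set D -> nrm D P ->
  exists2 V, onorm U V & cent D (P `&` V).
Proof.
move=> sD fD nD; have [W nW mW] := cap_finite G_tdlc setT fD.
have h : \forall x \near (1 : G), D `<=` [set d | W (d^-1 * d ^ x)].
  apply: (iffLR (compact_near_coveringP _) (finite_compact fD)) => d Dd.
  have : nbhs (d, (1 : G)) [set q | W (q.1^-1 * q.1 ^ q.2)].
    apply: (@nbhs_comp _ _ (fun q : G * G => q.1^-1 * q.1 ^ q.2) (d, 1) W).
      have c1 : continuous (fst : G * G -> G) by move=> q; exact: cvg_fst.
      have c2 : continuous (snd : G * G -> G) by move=> q; exact: cvg_snd.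
      have c3 := continuous_mulg c1 c2.
      have c4 := continuous_mulg (continuous_invg c2) c3.
      exact: (continuous_mulg (continuous_invg c1) c4).
    by rewrite /= conjg1 mulVg.
  by apply: filterS.
have [V oV VW] := onorm_small G_tdlc cU h.
exists V => // d x Dd [Px Vx].
have e : d^-1 * d ^ x = 1.
  apply: mW; last exact: (VW _ Vx).
  by apply: sgD => //; exact: nD.
apply/commgP; by rewrite commgEl e.
Qed.

(** Each [v k.+1] is chosen so that its part in [P] centralises [D k]; all later groups lie there,
    so the [D k] commute pairwise. [Ex] is an extra condition stable under shrinking [V]: that the
    isomorphism type of [E] does not recur below [V], or that [E] is isomorphic to a fixed [T]. *)
Lemma tor_sequence (Ex : set G -> set G -> Prop) :
  (forall E V V', Ex E V -> V' `<=` V -> Ex E V') ->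
  (forall V, onorm U V -> exists D E V', [/\ goodpair P D E, D `<=` V, onorm U V' & Ex E V']) ->
  exists D E v : nat -> set G, forall k,
  [/\ onorm U (v k) /\ goodpair P (D k) (E k), D k `<=` v k,
    v k.+1 `<=` v k /\ v k.+1 `<=` Vb k, cent (D k) (P `&` v k.+1) & Ex (E k) (v k.+1)].
Proof.
move=> Exm hEx.
pose rel k V V' := exists D E, [/\ goodpair P D E, D `<=` V, V' `<=` V /\ V' `<=` Vb k,
  cent D (P `&` V') & Ex E V'].
have [||v vP] := @dep_choice (set G) (fun _ => onorm U) rel U.
- exact: onormU.
- move=> k V oV; have [D [E [V1 [gDE DV oV1 EV1]]]] := hEx _ oV.
  have [[sD fD DP nD] _ _ _] := gDE.
  have [V2 oV2 cV2] := finite_centralised sD fD nD.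
  exists (V `&` V1 `&` V2 `&` Vb k); first by do 3?apply: onormI.
  exists D, E; split => //.
  + by split => [x [[[]]]|x []].
  + by apply: centS cV2 => // x [Px [[_ ?] _]].
  + by apply: Exm EV1 _ => x [[[]]].
have /choice[D /choice[E h]] : forall k, exists D E, [/\ goodpair P D E, D `<=` v k,
    v k.+1 `<=` v k /\ v k.+1 `<=` Vb k, cent D (P `&` v k.+1) & Ex E (v k.+1)].
  by move=> k; have [_ [D [E h]]] := vP k; exists D, E.
by exists D, E, v => k; have [? _] := vP k; have [? ? ? ? ?] := h k.
Qed.

Section Sequence.
Variables (D E v : nat -> set G).
Hypothesis seqP : forall k,
  [/\ onorm U (v k) /\ goodpair P (D k) (E k), D k `<=` v k,
    v k.+1 `<=` v k /\ v k.+1 `<=` Vb k & cent (D k) (P `&` v k.+1)].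

Lemma seq_mono i j : (i <= j)%N -> v j `<=` v i.
Proof.
move=> /subnK <-; elim: (j - i)%N => // n IH.
by apply: subset_trans _ IH; rewrite addSn; have [_ _ [h _] _] := seqP (n + i)%N.
Qed.

Lemma seq_cent i j : i != j -> cent (D i) (D j).
Proof.
wlog ij : i j / (i < j)%N.
  move=> h; rewrite neq_ltn => /orP[ij|ji]; first by apply: h => //; rewrite neq_ltn ij.
  by apply: cent_sym; apply: h => //; rewrite neq_ltn ji.
move=> _; have [_ _ _ c] := seqP i; apply: centS c => // x Dx.
have [[_ [[_ _ DP _] _ _ _]] Dv _ _] := seqP j.
by split; [exact: DP|apply: (seq_mono ij); exact: Dv].
Qed.

Lemma seq_small V : nbhs (1 : G) V -> exists n, forall k, (n <= k)%N -> D k `<=` V.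
Proof.
move=> /Vb_basis[n nV]; exists n.+1 => k nk.
have [_ Dv _ _] := seqP k; apply: subset_trans Dv _.
apply: subset_trans (seq_mono nk) _; have [_ _ [_ h] _] := seqP n.
exact: subset_trans h nV.
Qed.

Definition XJ (J : set nat) := cgen (\bigcup_(k in J) E k).

Lemma seq_ED k : E k `<=` D k. Proof. by have [[_ []]] := seqP k. Qed.
Lemma seq_simple k : simpleg (E k). Proof. by have [[_ []]] := seqP k. Qed.
Lemma seq_DP k : D k `<=` P. Proof. by have [[_ [[_ _ h _]]]] := seqP k. Qed.

Lemma seq_nED i j : nrm (E i) (D j).
Proof.
have [->|ij] := eqVneq i j; first by have [[_ []]] := seqP j.
apply: cent_nrm; apply: centS (seq_cent ij) => //; exact: seq_ED.
Qed.

Lemma infinite_small X : (forall V, nbhs (1 : G) V -> exists2 x, (X `&` V) x & x <> 1) ->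
  infinite_set X.
Proof.
move=> h fX; have [W nW mW] := cap_finite G_tdlc setT fX.
by have [x [Xx Wx] x1] := h _ nW; apply: x1; exact: mW.
Qed.

Definition unbounded (J : set nat) := forall n, exists2 k, J k & (n <= k)%N.

Lemma XJ_small J V : unbounded J -> nbhs (1 : G) V -> exists2 k, J k & E k `<=` V.
Proof.
move=> uJ nV; have [n nD] := seq_small nV; have [k Jk nk] := uJ n.
by exists k => //; apply: subset_trans (nD _ nk); exact: seq_ED.
Qed.

Lemma XJ_sub J k : J k -> E k `<=` XJ J.
Proof. by move=> Jk x Ex; apply: cgen_sub; exists k. Qed.

Lemma XJ_P J : XJ J `<=` P.
Proof. by apply: cgen_min => // x [k _] /seq_ED; exact: seq_DP. Qed.

Lemma XJ_nrm J k : nrm (E k) (XJ J).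
Proof.
have [sE fE _ _] := seq_simple k.
apply: cgen_normal.
- by move=> x y Ex [j Jj Ey]; apply: (seq_nED (j := j)) => //; exact: seq_ED.
- move=> x _ Ex [y [j Jj Ey] <-]; apply: (seq_nED (j := j)) => //; apply: seq_ED.
  by apply: sgV => //; have [] := seq_simple j.
- exact: fin_closed.
Qed.

(** Membership descends in two normal steps, since [E k] need not be normal in [P]: the closed group
    [Y] generated by all [D k] is normal in [P], and [XJ J] is normal in [Y]. *)
Lemma XJ_inS J : unbounded J -> inS (XJ J).
Proof.
move=> uJ.
pose Y := cgen (\bigcup_k D k).
have sY : is_subgroup Y by exact: cgen_sg.
have YP : Y `<=` P by apply: cgen_min => // x [k _]; exact: seq_DP.
have nY : nrm Y P.
  apply: cgen_nrm => x y [k _ Dx] Py; exists k => //.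
  by have [[_ [[_ _ _ h] _ _ _]] _ _ _] := seqP k; exact: h.
have XY : XJ J `<=` Y by apply: cgenS => x [k _ Ex]; exists k => //; exact: seq_ED.
have infX : infinite_set (XJ J).
  apply: infinite_small => V /(XJ_small uJ)[k Jk EV].
  have [_ _ [x Ex x1] _] := seq_simple k; exists x => //.
  by split; [exact: (XJ_sub Jk)|exact: EV].
have iY : inS Y.
  apply: (@inS_normal _ S_class _ hG tG S_mono P Y setT) => //.
  - exact: cgen_closed.
  - exact: filterT.
  - by apply: (nrmS nY) => x [].
  - by move=> fY; apply: infX; exact: sub_finite_set XY fY.
apply: (@inS_normal _ S_class _ hG tG S_mono Y (XJ J) setT) => //.
- exact: cgen_sg.
- exact: cgen_closed.
- exact: filterT.
apply: (@nrmS _ _ Y) => [|x []//].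
have nXD j : nrm (XJ J) (D j).
  by apply: cgen_nrm => x y [k Jk Ex] Dy; exists k => //; exact: (seq_nED Ex Dy).
apply: cgen_normal; last exact: cgen_closed.
  by move=> x y Xx [j _ Dy]; exact: (nXD j).
move=> x _ Xx [y [j _ Dy] <-]; apply: (nXD j) => //.
by apply: sgV => //; have [[_ [[]]]] := seqP j.
Qed.

Lemma XJ_quotient J r : XJ J r -> r <> 1 ->
  exists k p, [/\ J k, qhom (XJ J) (E k) p & p r <> 1].
Proof.
move=> Xr r1.
have [|||E' [p [[k Jk <-] qp pr]]] := @simple_quotient G G_tdlc U cU (XJ J) (E @` J) r
  (cgen_sg _) (@cgen_closed _ _) _ _ _ Xr r1.
- exact: subset_trans (@XJ_P J) PU.
- by apply: cgenS => x [k Jk Ex]; exists (E k) => //; exists k.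
- move=> _ [k Jk <-]; split; [exact: seq_simple|exact: XJ_sub|exact: XJ_nrm].
- by exists k, p.
Qed.

(* Two disjoint infinite subsequences give similar groups, so some simple factor of
   one occurs in the other. *)
Lemma seq_giso J1 J2 : unbounded J1 -> unbounded J2 ->
  exists i j, [/\ J1 i, J2 j & giso (E i) (E j)].
Proof.
move=> u1 u2; have i1 := XJ_inS u1; have i2 := XJ_inS u2.
have [b [g [V2 [V [[oV2 oV] gM gX [_ gI] gn]]]]] := transfer S_class G_tdlc cU i1 i2.
have [i J1i EV] := XJ_small u1 (onorm_nbhs oV2).
have sEi := seq_simple i; have [sgE fE [e Ee e1] _] := sEi.
have EX : E i `<=` XJ J1 `&` V2.
  by move=> x Ex; split; [exact: (XJ_sub J1i)|exact: EV].
have [m gm] : exists m, g m e <> 1.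
  apply: contrapT => h; apply: e1; apply: gI; first exact: EX.
  by move=> m; apply: contrapT => n; apply: h; exists m.
have [Xe Ve] := gX m _ (EX _ Ee).
have [j [p [J2j [pM pE _] pe]]] := XJ_quotient Xe gm.
exists i, j; split => //.
have sX2 : is_subgroup (XJ J2) by exact: cgen_sg.
have sXV : is_subgroup (XJ J2 `&` V) by apply: sgI => //; exact: onorm_sg oV.
have pMV x y : (XJ J2 `&` V) x -> (XJ J2 `&` V) y -> p (x * y) = p x * p y.
  by move=> [Xx _] [Xy _]; exact: pM.
have pXE : p @` (XJ J2 `&` V) `<=` E j.
  by move=> _ [x [Xx _] <-]; rewrite -pE; exists x.
have sEj := seq_simple j; have [sgj _ _ simj] := sEj.
have XU2 : XJ J2 `<=` U by exact: subset_trans (@XJ_P J2) PU.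
(* The open part [XJ J2 & V], which is all that [transfer] controls, still maps onto [E j]; hence
   the image of [E i] is normal in the whole of [E j]. *)
have EpX : E j `<=` p @` (XJ J2 `&` V).
  apply: simj => //.
  - exact: hom_sg.
  - rewrite -{1}pE => _ _ [x [Xx Vx] <-] [y Xy <-].
    exists (x ^ y); last exact: (homJ sX2).
    by split; [exact: (sgJ sX2 Xx Xy)|apply: (onorm_nrm oV) => //; exact: XU2].
  - by exists (p (g m e)) => //; exists (g m e).
apply: (@simple_hom_giso _ (p \o g m)) => //.
- move=> x y Ex Ey /=; rewrite gM; [|exact: EX..].
  by apply: pMV; apply: gX; exact: EX.
- by exists e.
- by move=> _ [x Ex <-]; apply: pXE; exists (g m x) => //; apply: gX; exact: EX.
- move=> _ _ [x Ex <-] /EpX[y Xy <-].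
  have nE : nrm (E i) (XJ J1) by exact: XJ_nrm.
  have : (g m @` E i) (g m x ^ y) by apply: (gn m _ EX nE) => //; exists x.
  move=> [z Ez e3]; exists z => //=; rewrite e3.
  by apply: (homJ sXV pMV) => //; exact: (gX m x (EX _ Ex)).
Qed.

End Sequence.

(** If every isomorphism type stopped recurring below some neighbourhood, one could choose a
    sequence of pairwise nonisomorphic [E k]. Its even and odd terms contradict [seq_giso]. *)
Lemma recurrent_simple : exists T, simpleg T /\
  forall V, onorm U V -> exists D E, [/\ goodpair P D E, D `<=` V & giso T E].
Proof.
apply: contrapT => nrec.
pose Ex E V := forall D' E', goodpair P D' E' -> D' `<=` V -> ~ giso E E'.
have [||D [E [v h]]] := @tor_sequence Ex.
- move=> E V V' hE V'V D' E' g D'V; apply: hE g _; exact: subset_trans V'V.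
- move=> V oV; have [D [E [gDE DV]]] := goodpair_small oV.
  have [V' [oV' hV']] : exists V', onorm U V' /\ Ex E V'.
    apply: contrapT => n; apply: nrec; exists E; split; first by case: gDE.
    move=> V' oV'; apply: contrapT => n2; apply: n; exists V'; split => //.
    move=> D' E' g D'V gi; apply: n2; by exists D', E'.
  by exists D, E, V'.
have sq k : [/\ onorm U (v k) /\ goodpair P (D k) (E k), D k `<=` v k,
    v k.+1 `<=` v k /\ v k.+1 `<=` Vb k & cent (D k) (P `&` v k.+1)].
  by have [? ? ? ? ?] := h k.
have [||i [j [/= ei oj gij]]] := @seq_giso D E v sq (fun k => ~~ odd k) (fun k => odd k).
- by move=> n; exists n.*2; [rewrite odd_double|rewrite -addnn leq_addr].
- by move=> n; exists n.*2.+1; [rewrite /= odd_double|rewrite -addnn; apply: leqW; rewrite leq_addr].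
have gp k : goodpair P (D k) (E k) by have [[]] := sq k.
have nij i' j' : (i' < j')%N -> ~ giso (E i') (E j').
  move=> ij; have [_ _ _ _ hx] := h i'; apply: (hx (D j')) => //.
  have [_ Dv _ _ _] := h j'; apply: subset_trans Dv _; exact: (seq_mono sq).
have [ij|ji|e] := ltngtP i j.
- exact: (nij _ _ ij).
- apply: (nij _ _ ji); apply: giso_sym => //.
  by have [[_ [_ _ _ []]]] := sq i.
- by move: ei; rewrite e oj.
Qed.

Lemma simple_member : exists (T X : set G) (E : nat -> set G),
  [/\ simpleg T, inS X, X `<=` U, X = cgen (\bigcup_k E k) &
  forall k, [/\ simpleg (E k), giso T (E k) & nrm (E k) X]].
Proof.
have [T [sT hT]] := recurrent_simple.
have [||D [E [v h]]] := @tor_sequence (fun E _ => giso T E).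
- by [].
- by move=> V oV; have [D [E [g DV gi]]] := hT _ oV; exists D, E, V.
have sq k : [/\ onorm U (v k) /\ goodpair P (D k) (E k), D k `<=` v k,
    v k.+1 `<=` v k /\ v k.+1 `<=` Vb k & cent (D k) (P `&` v k.+1)].
  by have [? ? ? ? ?] := h k.
exists T, (XJ E setT), E; split => //.
- by apply: (XJ_inS sq) => n; exists n.
- exact: subset_trans (@XJ_P D E v sq _) PU.
- move=> k; split; first exact: (seq_simple sq).
    by have [_ _ _ _] := h k.
  exact: (XJ_nrm sq).
Qed.

End TorSeq2.

(** * Groups whose points are separated by homomorphisms onto a finite simple group *)

Section Resid.
Variable G : topGroupType.
Hypothesis (G_tdlc : tdlc G).
Implicit Types A B E K V W X : set G.

Let hG : hausdorff_space G. Proof. by case: G_tdlc. Qed.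
Let tG : totally_disconnected [set: G]. Proof. by case: G_tdlc. Qed.

Variable U : set G.
Hypothesis cU : cposub U.
Let sU : is_subgroup U. Proof. by case: cU. Qed.
Let cptU : compact U. Proof. by case: cU. Qed.

Variable Vb : nat -> set G.
Hypothesis Vb_onorm : forall k, onorm U (Vb k).
Hypothesis Vb_basis : forall W, nbhs (1 : G) W -> exists k, Vb k `<=` W.

Variable T : set G.
Hypothesis sT : simpleg T.
Let sgT : is_subgroup T. Proof. by case: sT. Qed.

Definition resid A := forall r, A r -> r <> 1 -> exists2 p, qhom A T p & p r <> 1.

Definition nfactor A E := [/\ simpleg E, giso T E, E `<=` A & nrm E A].

Definition semisimple A := A `<=` cgen (\bigcup_(E in nfactor A) E).

Lemma qhom_nontriv A K p : is_subgroup A -> qhom A T p -> is_subgroup K -> K `<=` A ->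
  nrm K A -> (exists2 x, K x & p x <> 1) -> p @` K = T.
Proof.
move=> sA [pM pT _] sK KA nK [x Kx px].
have pKM a b : K a -> K b -> p (a * b) = p a * p b by move=> /KA ? /KA ?; exact: pM.
have [_ _ _ simT] := sT.
apply/seteqP; split; first by move=> _ [a Ka <-]; rewrite -pT; exists a => //; exact: KA.
apply: simT.
- exact: hom_sg.
- by move=> _ [a Ka <-]; rewrite -pT; exists a => //; exact: KA.
- rewrite -{1}pT => _ _ [a Ka <-] [b Ab <-]; exists (a ^ b); first exact: nK.
  by apply: (homJ sA) => //; exact: KA.
- by exists (p x) => //; exists x.
Qed.

Lemma qhomS A K p : qhom A T p -> K `<=` A -> p @` K = T -> qhom K T p.
Proof.
move=> [pM _ [W nW h]] KA pK; split => //.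
  by move=> x y /KA Ax /KA Ay; exact: pM.
by exists W => // x /KA; exact: h.
Qed.

Lemma resid_normal A K : is_subgroup A -> resid A -> is_subgroup K -> K `<=` A -> nrm K A ->
  resid K.
Proof.
move=> sA rA sK KA nK r Kr r1; have [p qp pr] := rA r (KA _ Kr) r1.
by exists p => //; apply: (qhomS qp KA); apply: (qhom_nontriv sA qp) => //; exists r.
Qed.

Lemma semisimple_resid A : is_subgroup A -> closed A -> A `<=` U -> semisimple A -> resid A.
Proof.
move=> sA clA AU ssA r Ar r1.
have [|E [p [[sE gE EA nE] [pM pE pW] pr]]] :=
  simple_quotient G_tdlc cU sA clA AU ssA _ Ar r1.
  by move=> E [].
have [sgE _ _ _] := sE.
have [h [hM hI hT]] := giso_sym sgT gE.
have Ep x : A x -> E (p x) by move=> Ax; rewrite -pE; exists x.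
exists (h \o p); last first.
  by move=> /= e; apply: pr; apply: hI; [exact: Ep|exact: sg1|rewrite e (hom1 sgE)].
split.
- by move=> x y Ax Ay /=; rewrite pM // hM //; exact: Ep.
- by rewrite -hT -pE image_comp.
- by case: pW => W nW hW; exists W => // x Ax Wx /=; rewrite hW // (hom1 sgE).
Qed.

Lemma qhom_closed A p t : is_subgroup A -> closed A -> qhom A T p ->
  closed [set x | A x /\ p x = t].
Proof.
move=> sA clA [pM _ [W nW hW]] x cx.
have Ax : A x by apply: clA => V /cx[y [[Ay _] Vy]]; exists y.
have : nbhs x [set y | W (x^-1 * y)].
  by apply: (@nbhs_comp _ _ (fun y => x^-1 * y) x W (@mulgl_cont _ _)); rewrite mulVg.
move=> /cx[y [[Ay py] /= Wy]]; split => //.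
have := hW _ (sgD sA Ax Ay) Wy; rewrite pM //; last exact: sgV.
by rewrite (homV sA pM) // py => /(congr1 (mul (p x))); rewrite mulVKg mulg1.
Qed.

Section Tower.
Variable A : set G.
Hypotheses (sA : is_subgroup A) (clA : closed A) (AU : A `<=` U).
Let cA : compact A. Proof. exact: (sub_compact cU). Qed.

(** The second clause says that [p n] maps the common kernel of the earlier maps onto [T]. For
    compact [A] the tuple of all [p n] identifies [A] with the countable power of [T]. *)
Definition tower (p : nat -> G -> G) := [/\ forall n, qhom A T (p n),
  forall n t, T t -> exists x, [/\ A x, forall i, (i < n)%N -> p i x = 1 & p n x = t]
  & forall x, A x -> (forall n, p n x = 1) -> x = 1].

(** The common kernels of sequences of homomorphisms are closed, and directed because two sequences
    can be interleaved. If all of them met the compact set [A \ V], a point [x <> 1] of it would be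
    killed by every homomorphism. *)
Lemma separating_near V : resid A -> nontriv A -> onorm U V ->
  exists2 p : nat -> G -> G, forall n, qhom A T (p n) &
    forall x, A x -> (forall n, p n x = 1) -> V x.
Proof.
move=> rA [x0 Ax0 x01] oV; apply: contrapT => h.
have [p0 qp0 _] := rA _ Ax0 x01.
have sV := onorm_sg oV.
have cAV : compact (A `\` V).
  apply: (subclosed_compact _ cA) => [|x []//].
  by apply: closedI => //; apply: open_closedC; case: oV.
pose ker (p : nat -> G -> G) := [set x | A x /\ forall n, p n x = 1].
have [||K K'|K|x [Ax nVx] hx] := @compact_directed _ _
    [set K | exists2 p : nat -> G -> G, (forall n, qhom A T (p n)) & K = ker p] cAV.
- by exists (ker (fun=> p0)); exists (fun=> p0).
- move=> _ [p qp ->].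
  have -> : ker p = \bigcap_n [set x | A x /\ p n x = 1].
    apply/seteqP; split => x; first by move=> [Ax px] n _; split.
    by move=> hx; split; [case: (hx 0%N Logic.I)|move=> n; case: (hx n Logic.I)].
  by apply: closed_bigI => n _; exact: qhom_closed.
- move=> [p qp ->] [p' qp' ->].
  pose p'' n := if odd n then p' n./2 else p n./2.
  exists (ker p''); first by exists p'' => // n; rewrite /p''; case: ifP.
  move=> x [Ax hx]; split; split => // n.
    by have := hx n.*2; rewrite /p'' odd_double doubleK.
  by have := hx n.*2.+1; rewrite /p'' /= odd_double /= uphalf_double.
- move=> [p qp ->]; apply: contrapT => ne; apply: h; exists p => // x Ax px.
  by apply: contrapT => nVx; apply: ne; exists x.
have x1 : x <> 1 by move=> x1; apply: nVx; rewrite x1; exact: sg1.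
have [p qp px] := rA _ Ax x1.
have [_ /(_ 0%N)] : ker (fun=> p) x by apply: hx; exists (fun=> p).
exact: px.
Qed.

Lemma separating : resid A -> nontriv A ->
  exists2 q : nat -> G -> G, forall n, qhom A T (q n) &
    forall x, A x -> (forall n, q n x = 1) -> x = 1.
Proof.
move=> rA ntA.
have /choice[p pP] : forall k, exists p : nat -> G -> G, (forall n, qhom A T (p n)) /\
    forall x, A x -> (forall n, p n x = 1) -> Vb k x.
  by move=> k; have [p ? ?] := separating_near rA ntA (Vb_onorm k); exists p.
(* All the sequences are merged into one by decoding [n] as a pair; numbers that code no pair repeat
   the entry [(0, 0)]. *)
exists (fun n => let ki := odflt (0, 0)%N (unpickle n) in p ki.1 ki.2).
  by move=> n /=; have [h _] := pP (odflt (0, 0)%N (unpickle n)).1; exact: h.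
move=> x Ax hx; apply: contrapT => x1.
have [k kV] := Vb_basis (nbhs_neq hG x1).
have [_ h] := pP k; apply: (kV x) => //; apply: h => // i.
by have := hx (pickle (k, i)); rewrite pickleK.
Qed.

(** Thin a separating sequence [q]. On the current kernel [K], use [q n] if it is nontrivial there;
    otherwise [K] is already inside its kernel, and any [q m] nontrivial on [K] serves. [K] is open
    in the infinite compact [A], so it is never trivial. Restricted to the normal subgroup [K], the
    chosen map is onto [T]. *)
Lemma resid_tower : resid A -> infinite_set A -> exists p, tower p.
Proof.
move=> rA infA.
have smallA W : nbhs (1 : G) W -> exists2 x, (A `&` W) x & x <> 1.
  move=> nW; have [V oV VW] := onorm_small G_tdlc cU nW.
  apply: contrapT => h; apply: infA; apply: (meet1_finite cU sA AU oV).
  move=> x Ax Vx; apply: contrapT => x1; apply: h; exists x => //.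
  by split => //; exact: VW.
have ntA : nontriv A.
  by have [x [Ax _] x1] := smallA _ (@filterT _ (nbhs (1 : G)) _); exists x.
have [q qq qsep] := separating rA ntA.
(* The clause for [n = 0] records that the sequence starts at [A], which [dep_choice] does not
   return. *)
pose Inv n K := [/\ is_subgroup K, K `<=` A, nrm K A, relopen K A &
  (n = 0%N -> K = A) /\ forall i x, (i < n)%N -> K x -> q i x = 1].
pose rel (n : nat) K K' := exists p, [/\ qhom A T p, p @` K = T & K' = K `&` [set x | p x = 1]].
have [||u uP] := @dep_choice (set G) Inv rel A.
- split => //; first exact: sg_nrm.
  by exists setT; [exact: filterT|move=> x []].
- move=> n K [sK KA nK [W nW hW] [_ hq]].
  have [p [qp [z Kz pz] hp]] : exists p, [/\ qhom A T p, exists2 x, K x & p x <> 1 &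
      forall x, K x -> p x = 1 -> q n x = 1].
    have [[x Kx qx]|tr] := pselect (exists2 x, K x & q n x <> 1).
      by exists (q n); split => //; exists x.
    have [x Kx x1] := smallA _ nW.
    have [m qm] : exists m, q m x <> 1.
      apply: contrapT => h; apply: x1; apply: qsep; first by case: Kx.
      by move=> m; apply: contrapT => qm; apply: h; exists m.
    exists (q m); split => //; first by exists x => //; exact: hW.
    by move=> y Ky _; apply: contrapT => qy; apply: tr; exists y.
  have [pM pT [W' nW' hW']] := qp.
  exists (K `&` [set x | p x = 1]); last first.
    by exists p; split => //; apply: (qhom_nontriv sA qp) => //; exists z.
  split.
  + split; first by split; [exact: sg1|exact: (hom1 sA pM)].
    * move=> x y [Kx px] [Ky py]; split; first exact: sgM.
      by rewrite /= pM ?px ?py ?mulg1 //; exact: KA.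
    * move=> x [Kx px]; split; first exact: sgV.
      by rewrite /= (homV sA pM) ?px ?invg1 //; exact: KA.
  + by move=> x [/KA].
  + move=> x y [Kx px] Ay; split; first exact: nK.
    by rewrite /= (homJ sA pM) ?px ?conj1g //; exact: KA.
  + exists (W `&` W'); first exact: filterI.
    by move=> x [Ax [Wx W'x]]; split; [exact: hW|exact: hW'].
  + split => // i x; rewrite ltnS leq_eqVlt => /orP[/eqP-> [Kx px]|ilt [Kx _]].
      exact: hp.
    exact: hq.
have /choice[p pP] : forall n, exists p,
    [/\ qhom A T p, p @` u n = T & u n.+1 = u n `&` [set x | p x = 1]].
  by move=> n; have [_] := uP n.
have u0 : u 0%N = A by have [[_ _ _ _ [h _]] _] := uP 0%N; exact: h.
have uK n x : u n x -> A x /\ forall i, (i < n)%N -> p i x = 1.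
  elim: n => [|n IH]; first by rewrite u0.
  have [_ _ ->] := pP n; move=> [/IH[Ax h] px]; split => // i.
  by rewrite ltnS leq_eqVlt => /orP[/eqP->|/h].
exists p; split.
- by move=> n; have [] := pP n.
- move=> n t; have [_ <- _] := pP n; move=> [x ux <-].
  by have [Ax h] := uK _ _ ux; exists x.
- move=> x Ax hx; have ux n : u n x.
    elim: n => [|n IH]; first by rewrite u0.
    by have [_ _ ->] := pP n; split.
  apply: qsep => // n; have [[_ _ _ _ [_ h]] _] := uP n.+1; exact: (h n).
Qed.

Variable p : nat -> G -> G.
Hypothesis tp : tower p.

(** Finitely many coordinates are prescribed one at a time, correcting by an element of the common
    kernel of the earlier maps; compactness gives all of them at once. *)
Lemma tower_realize (t : nat -> G) : (forall n, T (t n)) ->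
  exists2 x, A x & forall n, p n x = t n.
Proof.
move=> Tt; have [qp sp _] := tp.
have fin n : exists2 x, A x & forall i, (i < n)%N -> p i x = t i.
  elim: n => [|n [x Ax hx]]; first by exists 1 => //; exact: sg1.
  have [pM pT _] := qp n.
  have [y [Ay hy py]] : exists y, [/\ A y, forall i, (i < n)%N -> p i y = 1 &
      p n y = (p n x)^-1 * t n].
    by apply: sp; apply: sgD => //; rewrite -pT; exists x.
  exists (x * y); first exact: sgM.
  move=> i; rewrite ltnS leq_eqVlt => /orP[/eqP->|il].
    by rewrite pM // py mulVKg.
  by have [pM' _ _] := qp i; rewrite pM' // hx // hy // mulg1.
pose C n := [set x | A x /\ forall i, (i < n)%N -> p i x = t i].
have [||K K'|K|x Ax hx] := @compact_directed _ _ [set K | exists n, K = C n] cA.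
- by exists (C 0%N); exists 0%N.
- move=> _ [n ->].
  have -> : C n = A `&` \bigcap_(i in [set i | (i < n)%N]) [set x | A x /\ p i x = t i].
    apply/seteqP; split => x; first by move=> [Ax h]; split => // i il; split => //; exact: h.
    by move=> [Ax h]; split => // i il; have [] := h i il.
  by apply: closedI => //; apply: closed_bigI => i _; exact: qhom_closed.
- move=> [n ->] [m ->]; exists (C (maxn n m)); first by exists (maxn n m).
  by move=> x [Ax h]; split; split => // i il; apply: h; rewrite leq_max il ?orbT.
- by move=> [n ->]; have [x Ax h] := fin n; exists x.
exists x => // n; have [_ h] : C n.+1 x by apply: hx; exists n.+1.
exact: h.
Qed.

Lemma tower_nbhs n : exists2 W, nbhs (1 : G) W &
  forall x, A x -> W x -> forall i, (i < n)%N -> p i x = 1.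
Proof.
have [qp _ _] := tp.
elim: n => [|n [W nW h]]; first by exists setT => //; exact: filterT.
have [_ _ [W' nW' h']] := qp n.
exists (W `&` W'); first exact: filterI.
move=> x Ax [Wx W'x] i; rewrite ltnS leq_eqVlt => /orP[/eqP->|]; first exact: h'.
exact: h.
Qed.

(** The common kernels of the first [n] maps are closed and decrease to 1; by compactness one of
    them is inside [W]. *)
Lemma tower_small W : nbhs (1 : G) W -> exists n, forall x, A x ->
  (forall i, (i < n)%N -> p i x = 1) -> W x.
Proof.
have [qp _ sp] := tp => nW; have [V oV VW] := onorm_small G_tdlc cU nW.
apply: contrapT => h.
pose C n := [set x | A x /\ forall i, (i < n)%N -> p i x = 1].
have cAV : compact (A `\` V).
  apply: (subclosed_compact _ cA) => [|x []//].
  by apply: closedI => //; apply: open_closedC; case: oV.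
have [||K K'|K|x [Ax nVx] hx] := @compact_directed _ _ [set K | exists n, K = C n] cAV.
- by exists (C 0%N); exists 0%N.
- move=> _ [n ->].
  have -> : C n = A `&` \bigcap_(i in [set i | (i < n)%N]) [set x | A x /\ p i x = 1].
    apply/seteqP; split => x; first by move=> [Ax h']; split => // i il; split => //; exact: h'.
    by move=> [Ax h']; split => // i il; have [] := h' i il.
  by apply: closedI => //; apply: closed_bigI => i _; exact: qhom_closed.
- move=> [n ->] [m ->]; exists (C (maxn n m)); first by exists (maxn n m).
  by move=> x [Ax h']; split; split => // i il; apply: h'; rewrite leq_max il ?orbT.
- move=> [n ->]; apply: contrapT => ne; apply: h; exists n => x Ax hx.
  apply: VW; apply: contrapT => nVx; apply: ne; exists x; split => //.
have x1 : x = 1.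
  apply: sp => // n; have [_ h'] : C n.+1 x by apply: hx; exists n.+1.
  exact: h'.
by apply: nVx; rewrite x1; exact: (sg1 (onorm_sg oV)).
Qed.

End Tower.

Lemma tower_iso A B p p' : is_subgroup A -> closed A -> A `<=` U ->
  is_subgroup B -> closed B -> B `<=` U -> tower A p -> tower B p' ->
  exists f : G -> G, [/\ forall x y, A x -> A y -> f (x * y) = f x * f y,
     forall x y, A x -> A y -> f x = f y -> x = y,
     forall W, nbhs (1 : G) W -> exists2 V, nbhs (1 : G) V &
       forall x, A x -> V x -> W (f x) & f @` A = B].
Proof.
move=> sA clA AU sB clB BU tA tB.
have [qA _ sepA] := tA; have [qB _ sepB] := tB.
have pT (C : set G) (q : nat -> G -> G) n x : tower C q -> C x -> T (q n x).
  by move=> [qq _ _] Cx; have [_ <- _] := qq n; exists x.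
have sepD (C : set G) (q : nat -> G -> G) x y : is_subgroup C -> tower C q -> C x -> C y ->
    (forall n, q n x = q n y) -> x = y.
  move=> sC tC Cx Cy h; have [qq _ sp] := tC.
  apply: divg1_eq; apply: sp; first exact: sgDr.
  move=> n; have [qM _ _] := qq n.
  by rewrite qM ?(homV sC qM) ?h ?mulgV //; exact: sgV.
have /choice[f fP] : forall x, exists y, A x -> B y /\ forall n, p' n y = p n x.
  move=> x; have [Ax|n] := pselect (A x); last by exists 1.
  have [y By hy] := tower_realize sB clB BU tB (fun n => pT A p n x tA Ax).
  by exists y.
exists f; split.
- move=> x y Ax Ay; have [Bx hx] := fP _ Ax; have [By hy] := fP _ Ay.
  have [Bxy hxy] := fP _ (sgM sA Ax Ay).
  apply: (sepD B p') => //; first exact: sgM.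
  move=> n; have [pM _ _] := qA n; have [pM' _ _] := qB n.
  by rewrite hxy pM' // hx hy pM.
- move=> x y Ax Ay e; have [_ hx] := fP _ Ax; have [_ hy] := fP _ Ay.
  by apply: (sepD A p) => // n; rewrite -hx e hy.
- move=> W /(tower_small sB clB BU tB)[n hn].
  have [V nV hV] := tower_nbhs tA n; exists V => // x Ax Vx.
  have [Bx hx] := fP _ Ax; apply: hn => // i il; rewrite hx; exact: hV il.
- apply/seteqP; split => [_ [x Ax <-]|y By]; first by have [] := fP _ Ax.
  have [x Ax hx] := tower_realize sA clA AU tA (fun n => pT B p' n y tB By).
  have [Bx h] := fP _ Ax; exists x => //.
  by apply: (sepD B p') => // n; rewrite h hx.
Qed.

Lemma giso_simple E E' : simpleg E -> giso E E' -> simpleg E'.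
Proof.
move=> [sE fE [x Ex x1] simE] [h [hM hI hE]].
have sE' : is_subgroup E' by rewrite -hE; exact: hom_sg.
have h1 := hom1 sE hM.
split => //.
- by rewrite -hE; exact: finite_image.
- exists (h x); first by rewrite -hE; exists x.
  by rewrite -h1 => /hI e; apply: x1; apply: e => //; exact: sg1.
move=> K sK KE nK [y Ky y1].
have EK : E `<=` [set z | E z /\ K (h z)].
  apply: simE.
  - split; first by split; [exact: sg1|rewrite h1; exact: sg1].
    + by move=> a b [Ea Ka] [Eb Kb]; split; [exact: sgM|rewrite hM //; exact: sgM].
    + by move=> a [Ea Ka]; split; [exact: sgV|rewrite (homV sE hM) //; exact: sgV].
  - by move=> z [].
  - move=> a b [Ea Ka] Eb; split; first exact: sgJ.
    by rewrite (homJ sE hM) //; apply: nK => //; rewrite -hE; exists b.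
  - have : E' y by exact: KE.
    rewrite -hE => -[z Ez e]; exists z; first by rewrite /= e.
    by move=> z1; apply: y1; rewrite -e z1.
by rewrite -hE => _ [z /EK[_ Kz] <-].
Qed.

Variable S : topGroupType -> Prop.
Hypothesis S_class : profinite_similarity_class S.
Hypothesis S_mono : forall H, S H -> monomial H.
Local Notation inS := (inS S).

(** Compose the components from [transfer] with homomorphisms of [X] onto [T]. The composites
    separate points, and their images are nontrivial normal subgroups of [T], hence all of [T]. *)
Lemma resid_transfer N X : inS N -> N `<=` U -> inS X -> X `<=` U -> resid X ->
  exists2 V0, onorm U V0 & forall V, onorm U V -> V `<=` V0 -> resid (N `&` V).
Proof.
move=> iN NsU iX XU rX.
have sN := inS_sg iN; have sX := inS_sg iX.
have [b [g [V2 [V1 [[oV2 oV1] gM gX [gc gI] gn]]]]] := transfer S_class G_tdlc cU iN iX.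
have sNV : is_subgroup (N `&` V2) by apply: sgI => //; exact: onorm_sg oV2.
have rN : resid (N `&` V2).
  move=> r hr r1.
  have [i gr] : exists i, g i r <> 1.
    apply: contrapT => h; apply: r1; apply: gI => // i.
    by apply: contrapT => n; apply: h; exists i.
  have [Xr Vr] := gX i _ hr.
  have [p qp pr] := rX _ Xr gr.
  have [pM pT [W nW hW]] := qp.
  have sXV : is_subgroup (X `&` V1) by apply: sgI => //; exact: onorm_sg oV1.
  have pXV : p @` (X `&` V1) = T.
    apply: (qhom_nontriv sX qp) => //.
      by apply: nrmI; [exact: sg_nrm|exact: nrmS (onorm_nrm oV1) XU].
    by exists (g i r).
  have pM' x y : (X `&` V1) x -> (X `&` V1) y -> p (x * y) = p x * p y.
    by move=> [Xx _] [Xy _]; exact: pM.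
  have qM x y : (N `&` V2) x -> (N `&` V2) y -> p (g i (x * y)) = p (g i x) * p (g i y).
    by move=> hx hy; rewrite gM // pM'; [|exact: gX..].
  exists (p \o g i); last by [].
  split; first exact: qM.
    have [_ _ _ simT] := sT.
    apply/seteqP; split; first by move=> _ [x hx <-]; rewrite -pXV; exists (g i x) => //; exact: gX.
    apply: simT.
    - exact: (@hom_sg _ (p \o g i)).
    - by move=> _ [x hx <-]; rewrite -pXV; exists (g i x) => //; exact: gX.
    - rewrite -{1}pXV => _ _ [x hx <-] [y hy <-].
      have nNV : nrm (N `&` V2) N.
        by apply: nrmI; [exact: sg_nrm|exact: nrmS (onorm_nrm oV2) NsU].
      have : (g i @` (N `&` V2)) (g i x ^ y).
        by apply: (gn i _ (@subset_refl _ _) nNV) => //; exists x.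
      move=> [z hz e]; exists z => //=; rewrite e.
      by apply: (homJ sXV pM') => //; exact: gX.
    - by exists (p (g i r)) => //; exists r.
  have [W' nW' hW'] := gc i _ nW.
  by exists W' => // x hx W'x /=; apply: hW; [case: (gX i _ hx)|apply: hW' => //; case: hx].
exists V2 => // V oV VV2; apply: (resid_normal sNV rN).
- by apply: sgI => //; exact: onorm_sg oV.
- by move=> x [Nx /VV2].
- apply: nrmI; first by apply: nrmS (sg_nrm sN) _ => x [].
  by apply: nrmS (onorm_nrm oV) _ => x [/NsU].
Qed.

Variables (X : set G) (Ek : nat -> set G).
Hypotheses (iX : inS X) (XU : X `<=` U) (XE : X = cgen (\bigcup_k Ek k))
  (EkP : forall k, [/\ simpleg (Ek k), giso T (Ek k) & nrm (Ek k) X]).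
Let sX : is_subgroup X. Proof. exact: inS_sg iX. Qed.
Let clX : closed X. Proof. exact: (inS_closed S_class hG iX). Qed.

Lemma member_resid : resid X.
Proof.
apply: semisimple_resid => //; rewrite /semisimple {1}XE; apply: cgenS => x [k _ Ex].
have [sE gE nE] := EkP k; exists (Ek k) => //; split => // y Ey.
by rewrite XE; apply: cgen_sub; exists k.
Qed.

(** [A] and [X] both carry towers over the same [T], so they are isomorphic as topological groups.
    This puts [A] in S, and it carries the factors [Ek k] that generate [X] to factors that generate
    [A]. *)
Lemma resid_member A : is_subgroup A -> closed A -> A `<=` U -> resid A -> infinite_set A ->
  inS A /\ semisimple A.
Proof.
move=> sA clA AU rA infA.
have [p tA] := resid_tower sA clA AU rA infA.
have [p' tX] := resid_tower sX clX XU member_resid (inS_infinite S_class S_mono iX).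
have [f [fM fI fc fA]] := tower_iso sX clX XU sA clA AU tX tA.
split.
  by apply: (inS_iso S_class hG tG iX _ fM fI fc fA); exact: (sub_compact cU).
rewrite /semisimple; set C := cgen _.
have EX k : Ek k `<=` X by move=> x Ex; rewrite XE; apply: cgen_sub; exists k.
have fac k : nfactor A (f @` Ek k).
  have [sE gE nE] := EkP k.
  have gf : giso (Ek k) (f @` Ek k).
    exists f; split => //; first by move=> x y /EX Xx /EX Xy; exact: fM.
    by move=> x y /EX Xx /EX Xy; exact: fI.
  split.
  - exact: giso_simple gf.
  - exact: giso_trans gf.
  - by move=> _ [x /EX Xx <-]; rewrite -fA; exists x.
  - move=> _ a [x Ex <-]; rewrite -fA => -[y Xy <-].
    exists (x ^ y); first exact: nE.
    by apply: (homJ sX fM) => //; exact: (EX k).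
have sC : is_subgroup C by exact: cgen_sg.
have clC : closed C by exact: cgen_closed.
suff : X `<=` [set x | X x /\ C (f x)].
  by move=> h; rewrite -fA => _ [x /h[_ Cx] <-].
rewrite {1}XE; apply: cgen_min.
- split; first by split; [exact: sg1|rewrite (hom1 sX fM); exact: (sg1 sC)].
  + by move=> x y [Xx Cx] [Xy Cy]; split; [exact: sgM|rewrite fM //; exact: (sgM sC)].
  + by move=> x [Xx Cx]; split; [exact: sgV|rewrite (homV sX fM) //; exact: (sgV sC)].
- move=> x cx.
  have Xx : X x by apply: clX => V /cx[y [[Xy _] Vy]]; exists y.
  split => //; apply: clC => W /nbhs_translate/fc[V nV hV].
  have : nbhs x [set y | V (x^-1 * y)].
    by apply: (@nbhs_comp _ _ (fun y => x^-1 * y) x V (@mulgl_cont _ _)); rewrite mulVg.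
  move=> /cx[y [[Xy Cy] /= Vy]]; exists (f y); split => //.
  have /= := hV _ (sgD sX Xx Xy) Vy.
  by rewrite fM ?(homV sX fM) ?mulVKg //; exact: sgV.
- move=> x [k _ Ex]; split; first exact: (EX k).
  by apply: cgen_sub; exists (f @` Ek k); [exact: fac|exists x].
Qed.

End Resid.

(** * The largest member *)

Section TorMax.
Variable G : topGroupType.
Hypothesis (G_tdlc : tdlc G).
Hypothesis (G_LD : property_LD G).
Variable S : topGroupType -> Prop.
Hypothesis S_class : profinite_similarity_class S.
Hypothesis S_mono : forall H, S H -> monomial H.
Implicit Types A B E K N V W Y Z : set G.

Local Notation inS := (inS S).

Let hG : hausdorff_space G. Proof. by case: G_tdlc. Qed.
Let tG : totally_disconnected [set: G]. Proof. by case: G_tdlc. Qed.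

Variable U : set G.
Hypothesis cU : cposub U.
Let sU : is_subgroup U. Proof. by case: cU. Qed.
Let cptU : compact U. Proof. by case: cU. Qed.
Let nbU : nbhs (1 : G) U. Proof. by case: cU => _ _; exact: open_sg_nbhs. Qed.

Variable Vb : nat -> set G.
Hypothesis Vb_onorm : forall k, onorm U (Vb k).
Hypothesis Vb_basis : forall W, nbhs (1 : G) W -> exists k, Vb k `<=` W.

Local Notation NU := (NU U S).

Section WithSimple.
Variables (T X : set G) (Ek : nat -> set G).
Hypothesis sT : simpleg T.
Hypotheses (iX : inS X) (XU : X `<=` U) (XE : X = cgen (\bigcup_k Ek k))
  (EkP : forall k, [/\ simpleg (Ek k), giso T (Ek k) & nrm (Ek k) X]).

Local Notation nfac := (nfactor T).
Local Notation semisimple := (semisimple T).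

Definition snormal N := [/\ is_subgroup N, closed N, N `<=` U, nrm N U & semisimple N].

Lemma NU_snormal N : NU N -> exists2 V0, onorm U V0 &
  forall V, onorm U V -> V `<=` V0 -> snormal (N `&` V).
Proof.
move=> [iN NsU nN].
have rX : resid T X by exact: (member_resid G_tdlc cU sT S_class iX XU XE EkP).
have [V0 oV0 h] := resid_transfer G_tdlc cU sT S_class iN NsU iX XU rX.
exists V0 => // V oV VV0.
have iNV := inS_cap G_tdlc S_class iN oV.
have sNV := inS_sg iNV; have clNV := inS_closed S_class hG iNV.
have NVU : N `&` V `<=` U by move=> x [/NsU].
have [_ ss] := resid_member G_tdlc cU Vb_onorm Vb_basis sT S_class S_mono iX XU XE EkP
  sNV clNV NVU (h _ oV VV0) (inS_infinite S_class S_mono iNV).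
by split => //; apply: nrmI => //; exact: onorm_nrm oV.
Qed.

(** Since two factors coincide or commute, each is normal in the closed group [A] generated by them
    all. So [A] is residually [T], and [resid_member] applies however many members contributed. For
    nonabelian [T] the family is all of [snormal]; for abelian [T] it must be restricted. *)
Lemma family_max (fam : set (set G)) : (exists N, NU N) ->
  (forall N, fam N -> snormal N) ->
  (forall N, NU N -> exists2 V, onorm U V & fam (N `&` V)) ->
  (forall N E N' E', fam N -> nfac N E -> fam N' -> nfac N' E' ->
    E = E' \/ cent E E') ->
  exists A, max_member S U A.
Proof.
move=> [N0 NN0] fs fN fE.
pose Sig := [set E | exists2 N, fam N & nfac N E].
pose A := cgen (\bigcup_(E in Sig) E).
have sA : is_subgroup A by exact: cgen_sg.
have clA : closed A by exact: cgen_closed.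
have EU E : Sig E -> E `<=` U.
  by move=> [N /fs[_ _ NsU _ _] [_ _ EN _]]; exact: subset_trans EN NsU.
have AU : A `<=` U.
  by apply: cgen_min => //; [exact: cpt_closed|move=> x [E SE Ex]; exact: (EU E)].
have Sfac E : Sig E -> nfac A E.
  move=> SE; have [N fNN [sE gE EN nE]] := SE.
  have EA : E `<=` A by move=> x Ex; apply: cgen_sub; exists E.
  split => //; have [sgE fiE _ _] := sE.
  have nEE E' : Sig E' -> nrm E E'.
    move=> [N' fNN' hE']; have [<-|c] := fE _ _ _ _ fNN (And4 sE gE EN nE) fNN' hE'.
      exact: sg_nrm.
    exact: cent_nrm.
  apply: cgen_normal.
  - by move=> x y Ex [E' SE' E'y]; exact: (nEE E').
  - move=> x _ Ex [y [E' SE' E'y] <-]; apply: (nEE E') => //; apply: sgV => //.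
    by case: SE' => N' _ [[]].
  - exact: (fin_closed G_tdlc).
have ssA : semisimple A.
  by apply: cgenS => x [E SE Ex]; exists E => //; exact: Sfac.
have nA : nrm A U.
  apply: cgen_nrm => x u [E SE Ex] Uu; exists [set y ^ u | y in E]; last by exists x.
  have [N fNN [sE gE EN nE]] := SE; have [sN _ NsU nN _] := fs _ fNN.
  have gEu : giso E [set y ^ u | y in E].
    exists (fun y => y ^ u); split => //; first by move=> a b _ _; exact: conjMg.
    by move=> a b _ _ /conjg_inj.
  exists N => //; split.
  - exact: giso_simple gEu.
  - exact: giso_trans gEu.
  - by move=> _ [y Ey <-]; apply: nN => //; exact: EN.
  - move=> _ n [y Ey <-] Nn; exists (y ^ (n ^ u^-1)).
      by apply: nE => //; apply: nN => //; exact: sgV.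
    by rewrite -!conjgM; congr (_ ^ _); gsimp.
have famA N : fam N -> N `<=` A.
  move=> fNN; have [_ _ _ _ ss] := fs _ fNN; apply: subset_trans ss _.
  by apply: cgenS => x [E hE Ex]; exists E => //; exists N.
have infA : infinite_set A.
  have [V oV fNV] := fN _ NN0; move=> fA.
  have iN : inS (N0 `&` V) by apply: (inS_cap G_tdlc S_class _ oV); case: NN0.
  apply: (inS_infinite S_class S_mono iN); apply: sub_finite_set fA; exact: famA.
have rA : resid T A by apply: (semisimple_resid G_tdlc cU sT).
have [iA _] := resid_member G_tdlc cU Vb_onorm Vb_basis sT S_class S_mono iX XU XE EkP
  sA clA AU rA infA.
exists A; split; first by split.
move=> N NN; have [V oV fNV] := fN _ NN.
by exists V; [exact: onorm_nbhs oV|exact: famA].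
Qed.

Lemma factor_trivial N E K : nfac N E -> is_subgroup K -> nrm K E ->
  E `<=` K \/ meet1 E K.
Proof.
move=> [[sE _ _ simE] _ EN nE] sK nK.
have [nt|tr] := pselect (nontriv (E `&` K)).
  left; suff : E `<=` E `&` K by move=> h x /h[].
  apply: simE; [exact: sgI|by move=> x []| |exact: nt].
  by apply: nrmI => //; exact: sg_nrm.
right => x Ex Kx; apply: contrapT => x1; apply: tr; by exists x.
Qed.

(** If [E] lies in [N'], then either both factors lie in [I] and simplicity decides, or [E'] meets
    [I] trivially and so centralises it. If [E] meets [N'] trivially, it centralises [I], and
    comparing [E] with its conjugates under [N'] shows that it centralises [N']. *)
Lemma nonabelian_factors N E N' E' : ~ cent T T -> snormal N -> nfac N E ->
  snormal N' -> nfac N' E' -> E = E' \/ cent E E'.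
Proof.
move=> naT [sN clN NsU nN _] fE [sN' clN' N'U nN' _] fE'.
have [[sE _ _ simE] gE EN nE] := fE; have [[sE' _ _ simE'] gE' EN' nE'] := fE'.
have EU : E `<=` U by exact: subset_trans EN NsU.
have EU' : E' `<=` U by exact: subset_trans EN' N'U.
pose I := N `&` N'.
have sI : is_subgroup I by exact: sgI.
have nI : nrm I U by exact: nrmI.
have IN : I `<=` N by move=> x [].
have IN' : I `<=` N' by move=> x [].
have [EsN'|mEN'] := factor_trivial fE sN' (nrmS nN' EU).
  have EI : E `<=` I by move=> x Ex; split; [exact: EN|exact: EsN'].
  have [E'I|mE'I] := factor_trivial fE' sI (nrmS nI EU').
    have nEE' : nrm E E' by apply: nrmS nE _ => x /E'I /IN.
    have nE'E : nrm E' E by apply: nrmS nE' _ => x /EI /IN'.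
    have [h|m] := factor_trivial fE sE' nE'E; last by right; exact: meet1_cent.
    have [h'|m] := factor_trivial fE' sE nEE'; first by left; apply/seteqP.
    by right; apply: meet1_cent => // x Ex E'x; exact: m.
  right; apply: cent_sym; apply: (@centS _ E' I) => //; apply: meet1_cent => //.
    exact: nrmS nE' IN'.
  exact: nrmS nI EU'.
right.
have cEI : cent E I.
  apply: meet1_cent => //; [exact: nrmS nE IN|exact: nrmS nI EU|].
  by move=> x Ex [_ N'x]; exact: mEN'.
suff cEN' : cent E N' by apply: centS cEN'.
move=> e n Ee N'n.
pose F := [set y ^ n | y in E].
have Un := N'U _ N'n.
(* Both [N] and [N'] are normal in [U], so this commutator lies in their intersection, which [E]
   centralises. *)
have theta y : E y -> I (y^-1 * y ^ n).
  move=> Ey; split.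
    by apply: sgD => //; [exact: EN|apply: nN => //; exact: EN].
  rewrite -commgEl commgEr; apply: sgM => //.
  by apply: nN'; [exact: sgV|exact: EU].
have nF : nrm F N.
  move=> _ m [y Ey <-] Nm; exists (y ^ (m ^ n^-1)).
    by apply: nE => //; apply: nN => //; exact: sgV.
  by rewrite -!conjgM; congr (_ ^ _); gsimp.
have sF : is_subgroup F by apply: hom_sg => // a b _ _; exact: conjMg.
have FN : F `<=` N by move=> _ [y Ey <-]; apply: nN => //; exact: EN.
have [EF|mEF] := factor_trivial fE sF (nrmS nF EN).
  have gEF : giso E F.
    by exists (fun y => y ^ n); split => //; [move=> a b _ _; exact: conjMg|move=> a b _ _ /conjg_inj].
  have fF : nfac N F.
    by split => //; [apply: giso_simple gEF; case: fE|exact: giso_trans gE gEF].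
  have [FE|m] := factor_trivial fF sE (nrmS nE FN); last first.
    exfalso; have [[_ _ [x Ex x1] _] _ _ _] := fE; apply: x1; apply: m => //; exact: EF.
  have : e^-1 * e ^ n = 1.
    apply: mEN'; last by case: (theta _ Ee).
    by apply: sgD => //; apply: FE; exists e.
  by rewrite -commgEl => /eqP/commgP.
(* Here [E] commutes with its conjugate [F]. For [y] in [E], both [y ^ n] and [y^-1 * y ^ n] commute
   with [E], hence so does [y], and [E] would be abelian. *)
exfalso; apply: naT.
have cEF : cent E F by apply: meet1_cent => //; [exact: nrmS nE FN|exact: nrmS nF EN].
have cEE : cent E E.
  move=> f y Ef Ey.
  have h1 : f * (y ^ n) = y ^ n * f by apply: cEF => //; exists y.
  have h2 : f * (y^-1 * y ^ n) = y^-1 * y ^ n * f by apply: cEI => //; exact: theta.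
  have h3 : y * (y^-1 * y ^ n) = y ^ n by rewrite mulVKg.
  apply: (mulIg (y^-1 * y ^ n)).
  by rewrite -!mulgA h2 h3 h1 -!mulgA mulVKg.
have [h [hM hI hT]] := gE; have [sgT _ _ _] := sT.
move=> x y Tx Ty; apply: hI; [exact: sgM|exact: sgM|].
by rewrite !hM //; apply: cEE; rewrite -hT; [exists x|exists y].
Qed.

Lemma abelian_snormal N : cent T T -> snormal N -> cent N N.
Proof.
move=> cT [sN clN NsU nN ss].
have cE E : nfac N E -> cent E E.
  move=> [_ [h [hM hI hT]] _ _]; rewrite -hT => _ _ [x Tx <-] [y Ty <-].
  by rewrite -!hM // cT.
have c : cent (\bigcup_(E in nfac N) E) (\bigcup_(E in nfac N) E).
  move=> x y [E fE Ex] [E' fE' E'y].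
  have [[sE _ _ _] _ EN nE] := fE; have [[sE' _ _ _] _ EN' nE'] := fE'.
  have nEE' : nrm E E' by exact: nrmS nE EN'.
  have nE'E : nrm E' E by exact: nrmS nE' EN.
  have [h|m] := factor_trivial fE sE' nE'E; last exact: (meet1_cent sE sE').
  by apply: (cE _ fE') => //; exact: h.
apply: (centS ss ss); apply: cgen_cent => //; apply: cent_sym; exact: cgen_cent.
Qed.

(** Otherwise there are noncommuting pairs [N k], [N' k] shrinking to 1, each centralised by
    everything later. The intersections [Z k] generate a closed abelian group [Q] that commutes with
    all of them, and (LD) splits [Q] off. For [a] and [b] in a late pair, the commutator lies in
    [Z k], hence in [Q]; it also equals the commutator of their components in [R], so it is 1. *)
Lemma abelian_family (cT : cent T T) : exists2 V, onorm U V &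
  forall N N', snormal N -> snormal N' -> N `<=` V -> N' `<=` V ->
    relopen (centr N) U -> relopen (centr N') U -> cent N N'.
Proof.
apply: contrapT => nV.
pose good N V := [/\ snormal N, N `<=` V & relopen (centr N) U].
pose rel k V V' := exists N N' : set G, [/\ good N V /\ good N' V, ~ cent N N',
  V' `<=` V /\ V' `<=` Vb k, cent N V' & cent N' V'].
have [||v vP] := @dep_choice (set G) (fun _ => onorm U) rel U.
- exact: onormU.
- move=> k V oV.
  have [N [N' [gN gN' nc]]] : exists N N', [/\ good N V, good N' V & ~ cent N N'].
    apply: contrapT => h; apply: nV; exists V => // N N' s s' NV N'V c c'.
    by apply: contrapT => nc; apply: h; exists N, N'; split.
  have [_ _ [W nW hW]] := gN; have [_ _ [W' nW' hW']] := gN'.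
  have [V' oV' hV'] := onorm_small G_tdlc cU (filterI (filterI nW nW') (filterI (onorm_nbhs oV) (onorm_nbhs (Vb_onorm k)))).
  have V'U := onorm_sub oV'.
  exists V' => //; exists N, N'; split => //.
  + by split => x /hV'[_ []].
  + by move=> x y Nx V'y; apply: (hW y) => //; split; [exact: V'U|case: (hV' _ V'y) => -[]].
  + by move=> x y Nx V'y; apply: (hW' y) => //; split; [exact: V'U|case: (hV' _ V'y) => -[]].
have /choice[N /choice[N' h]] : forall k, exists N N' : set G, [/\ good N (v k) /\ good N' (v k),
    ~ cent N N', v k.+1 `<=` v k /\ v k.+1 `<=` Vb k, cent N (v k.+1) & cent N' (v k.+1)].
  by move=> k; have [_ hk] := vP k.
have vmono i j : (i <= j)%N -> v j `<=` v i.
  move=> /subnK <-; elim: (j - i)%N => // n IH.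
  by apply: subset_trans _ IH; rewrite addSn; have [_ _ [h1 _] _ _] := h (n + i)%N.
pose Z k := N k `&` N' k.
have cNZ M k j : M = N k \/ M = N' k -> cent M (Z j).
  have [[[sk vk _] [sk' vk' _]] _ _ ck ck'] := h k.
  have [[[sj vj _] [sj' vj' _]] _ _ cj cj'] := h j.
  have Mv : M = N k \/ M = N' k -> M `<=` v k by case=> ->.
  move=> hM; have [kj|jk|<-] := ltngtP k j.
  - have Zv : Z j `<=` v k.+1 by move=> x [/vj vx _]; exact: (vmono _ _ kj).
    by case: hM => ->; [exact: centS ck|exact: centS ck'].
  - apply: cent_sym; apply: (centS _ _ cj); first by move=> x [].
    by apply: subset_trans (Mv hM) _; exact: vmono.
  - case: hM => ->.
      by apply: centS (abelian_snormal cT sk) => // x [].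
    by apply: centS (abelian_snormal cT sk') => // x [].
pose Q := cgen (\bigcup_k Z k).
have cMQ M k : M = N k \/ M = N' k -> cent M Q.
  move=> hM; apply: cent_sym; apply: cgen_cent => // x y [j _ Zx] My.
  by symmetry; apply: (cNZ M k j).
have cQQ : cent Q Q.
  apply: cgen_cent => // x y [j _ [Nx _]] Qy; exact: (cMQ (N j) j (or_introl erefl)).
have sQ : is_subgroup Q by exact: cgen_sg.
have clQ : closed Q by exact: cgen_closed.
have QU : Q `<=` U.
  apply: cgen_min => //; first exact: cpt_closed.
  by move=> x [k _ [Nx _]]; have [[[[_ _ NsU _ _] _ _] _] _ _ _ _] := h k; exact: NsU.
have nQ : nrm Q U.
  apply: cgen_nrm => x u [k _ [Nx N'x]] Uu; exists k => //.
  have [[[[_ _ _ n _] _ _] [[_ _ _ n' _] _ _]] _ _ _ _] := h k.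
  by split; [exact: n|exact: n'].
have [V0 [R [oV0 sR [clR RU] [cQR mQR] hV]]] :=
  LD_split G_tdlc cU G_LD sQ clQ QU nbU nQ.
have [V' oV' [V'V0 V'P]] := hV _ oV0 (@subset_refl _ _).
have [k kV] := Vb_basis (onorm_nbhs oV').
(* The pair of index [k.+1] is used because [v k.+1], not [v k], is contained in [Vb k]. *)
have [[[s1 v1 _] [s2 v2 _]] nc _ _ _] := h k.+1.
have vV' : v k.+1 `<=` V'.
  by apply: subset_trans kV; have [_ _ [_ hb] _ _] := h k.
apply: nc => a b Na N'b.
have [w [Qw V0w] [r Rr ea]] := V'P _ (vV' _ (v1 _ Na)).
have [w' [Qw' V0w'] [r' Rr' eb]] := V'P _ (vV' _ (v2 _ N'b)).
have [sN _ NsU nN _] := s1; have [sN' _ N'U nN' _] := s2.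
have sZc : (Z k.+1) (a^-1 * a ^ b).
  split; first by apply: sgD => //; apply: nN => //; exact: N'U.
  rewrite -commgEl commgEr; apply: sgM => //.
  by apply: nN'; [exact: sgV|exact: NsU].
have caw x : Q x -> a * x = x * a by exact: (cMQ (N k.+1) k.+1 (or_introl erefl)).
have cbw x : Q x -> b * x = x * b by exact: (cMQ (N' k.+1) k.+1 (or_intror erefl)).
have er : r = w^-1 * a by rewrite -ea mulKg.
have er' : r' = w'^-1 * b by rewrite -eb mulKg.
have Qv x : Q x -> Q x^-1 by exact: sgV.
have e1 : r * r' = (w^-1 * w'^-1) * (a * b).
  rewrite er er' -!mulgA; congr (_ * _); rewrite !mulgA; congr (_ * _).
  by apply: caw; exact: Qv.
have e2 : r' * r = (w^-1 * w'^-1) * (b * a).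
  rewrite er er' (cQQ w^-1 w'^-1); [|exact: Qv..].
  rewrite -!mulgA; congr (_ * _); rewrite !mulgA; congr (_ * _).
  by apply: cbw; exact: Qv.
have e3 : (r' * r)^-1 * (r * r') = a^-1 * a ^ b.
  by rewrite e1 e2; gsimp.
have : a^-1 * a ^ b = 1.
  apply: mQR; last by rewrite -e3; apply: sgD => //; exact: sgM.
  split; first by apply: cgen_sub; exists k.+1.
  by apply: V'V0; apply: vV'; apply: v1; case: sZc.
by rewrite -commgEl => /eqP/commgP.
Qed.

Lemma simple_max : (exists N, NU N) -> exists A, max_member S U A.
Proof.
move=> exN.
have [cT|naT] := pselect (cent T T); last first.
  apply: (@family_max snormal) => //.
    by move=> N /NU_snormal[V0 oV0 h]; exists V0 => //; exact: h.
  by move=> N E N' E' *; exact: (@nonabelian_factors N E N' E').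
have [V oV hV] := abelian_family cT.
(* For abelian [T] only subgroups inside [V] with open centraliser are kept. Every member has an
   open subgroup of this kind: near 1, [U] lies in the product of that abelian subgroup and an (LD)
   complement commuting with it. *)
apply: (@family_max [set N | [/\ snormal N, N `<=` V & relopen (centr N) U]]) => //.
- by move=> N [].
- move=> N NN; have [V0 oV0 h0] := NU_snormal NN.
  have [iN NsU nN] := NN; have sN := inS_sg iN; have clN := inS_closed S_class hG iN.
  have [V1 [R [oV1 sR [clR RU] [cNR mNR] hR]]] := LD_split G_tdlc cU G_LD sN clN NsU nbU nN.
  pose V2 := V `&` V0 `&` V1.
  have oV2 : onorm U V2 by do 2?apply: onormI.
  have V20 : V2 `<=` V0 by move=> x [[]].
  have V21 : V2 `<=` V1 by move=> x [].
  have sn := h0 _ oV2 V20.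
  exists V2 => //; split => //; first by move=> x [_ [[]]].
  have [V' oV' [_ V'P]] := hR _ oV2 V21.
  exists V'; first exact: onorm_nbhs oV'.
  move=> x [_ /V'P[y Ny [r Rr <-]]] a Na.
  have c1 : a * y = y * a by exact: (abelian_snormal cT sn).
  have c2 : a * r = r * a by case: Na => Na /V21 V1a; exact: cNR.
  by rewrite mulgA c1 -mulgA c2 mulgA.
- move=> N E N' E' [sn NV c] [_ _ EN _] [sn' N'V c'] [_ _ E'N _]; right.
  by apply: (centS EN E'N); exact: hV.
Qed.

End WithSimple.

Lemma exists_max : (exists N, NU N) -> exists A, max_member S U A.
Proof.
move=> exN; have [N NN] := exN.
have [[P [iP PU tP]]|nt] := pselect (exists P, [/\ inS P, P `<=` U & tor U P]).
  have [T [X [E [sT iX XU XE EP]]]] :=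
    simple_member G_tdlc S_class S_mono cU Vb_onorm Vb_basis iP PU tP.
  exact: (simple_max sT iX XU XE EP exN).
have nt' P : inS P -> P `<=` U -> ~ tor U P.
  by move=> iP PU tP; apply: nt; exists P.
have [[Y iY cY]|na] := pselect (exists2 Y : set G, inS Y & cent Y Y).
  exact: (max_abelian G_tdlc G_LD S_class S_mono cU Vb_onorm Vb_basis nt' NN iY cY).
apply: (max_nonabelian G_tdlc G_LD S_class S_mono cU Vb_onorm Vb_basis nt' NN).
by move=> Y iY cY; apply: na; exists Y.
Qed.

End TorMax.

(** * The group G_S *)

(** [fd_base_conj] says that each element of the group conjugates the base into itself near 1. This
    is what makes the topology with [fd_base] open a group topology, conjugations being continuous
    at 1. *)
Record fine_data (G : topGroupType) := FineData {
  fd_group : subgroup G;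
  fd_base : set G;
  fd_base_sg : is_subgroup fd_base;
  fd_base_sub : fd_base `<=` fd_group;
  fd_base_conj : forall g, sg_set fd_group g -> exists2 W, nbhs (1 : G) W &
    forall x, fd_base x -> W x -> fd_base (x ^ g)
}.

(* A record, so that the subspace topology of [set_type] is not inferred on it. *)
Record fine (G : topGroupType) (d : fine_data G) := Fine { unfine : topsub (fd_group d) }.

Section Fine.
Variables (G : topGroupType) (d : fine_data G).
Local Notation T := (fine d).
Local Notation N0 := (fd_base d).

Lemma unfineK : cancel (@unfine G d) (@Fine G d). Proof. by case. Qed.

HB.instance Definition _ := Choice.copy T (can_type unfineK).

Definition fine_one : T := Fine 1.
Definition fine_mul (x y : T) : T := Fine (unfine x * unfine y).
Definition fine_inv (x : T) : T := Fine (unfine x)^-1.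

Lemma fine_mulA : associative fine_mul.
Proof. by move=> x y z; rewrite /fine_mul /= mulgA. Qed.
Lemma fine_mul1 : left_id fine_one fine_mul.
Proof. by case=> x; rewrite /fine_mul /= mul1g. Qed.
Lemma fine_mulr1 : right_id fine_one fine_mul.
Proof. by case=> x; rewrite /fine_mul /= mulg1. Qed.
Lemma fine_mulV : left_inverse fine_one fine_inv fine_mul.
Proof. by case=> x; rewrite /fine_mul /= mulVg. Qed.
Lemma fine_mulrV : right_inverse fine_one fine_inv fine_mul.
Proof. by case=> x; rewrite /fine_mul /= mulgV. Qed.

HB.instance Definition _ :=
  isGroup.Build T fine_mulA fine_mul1 fine_mulr1 fine_mulV fine_mulrV.

Definition fval (x : T) : G := set_val (unfine x).

(** The topology in which the left translates [w (N0 & V)] form the neighbourhoods of [w], with [V]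
    running over the neighbourhoods of 1 in [G]. *)
Definition fine_open (W : set T) := forall w, W w -> exists2 V, nbhs (1 : G) V &
  forall x : T, N0 (fval x) -> V (fval x) -> W (w * x).

Lemma fine_openT : fine_open setT.
Proof. by move=> w _; exists setT => //; exact: filterT. Qed.

Lemma fine_openI : setI_closed fine_open.
Proof.
move=> A B oA oB w [/oA[V nV hV] /oB[W nW hW]]; exists (V `&` W).
  exact: filterI.
by move=> x N0x [Vx Wx]; split; [exact: hV|exact: hW].
Qed.

Lemma fine_open_bigU (I : Type) (f : I -> set T) : (forall i, fine_open (f i)) ->
  fine_open (\bigcup_i f i).
Proof.
move=> h w [i _ /h[V nV hV]]; exists V => // x N0x Vx; exists i => //; exact: hV.
Qed.

HB.instance Definition _ := isOpenTopological.Build T fine_openT fine_openI fine_open_bigU.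

Let s0 : is_subgroup N0. Proof. exact: fd_base_sg. Qed.

Lemma fvalM (x y : T) : fval (x * y) = fval x * fval y. Proof. by []. Qed.
Lemma fval1 : fval 1 = 1. Proof. by []. Qed.
Lemma fvalP (x : T) : sg_set (fd_group d) (fval x).
Proof. exact: (@subP _ (fd_group d)). Qed.
Lemma fval_inj : injective fval.
Proof. by move=> [x] [y] /(@val_injS _ (fd_group d)) /= ->. Qed.
Definition tofine (g : G) : T := Fine (tosub (fd_group d) g).
Lemma tofineK g : sg_set (fd_group d) g -> fval (tofine g) = g.
Proof. exact: valK_tosub. Qed.
Lemma fvalK x : tofine (fval x) = x.
Proof. by apply: fval_inj; rewrite tofineK //; exact: fvalP. Qed.

Lemma fine_nbhs (w : T) (A : set T) : nbhs w A <-> exists2 V, nbhs (1 : G) V &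
  forall x : T, N0 (fval x) -> V (fval x) -> A (w * x).
Proof.
split.
  rewrite nbhsE => -[B [oB Bw] BA]; have [V nV hV] := oB w Bw.
  by exists V => // x N0x Vx; apply: BA; exact: hV.
move=> [V nV hV].
pose B := [set y : T | exists2 V, nbhs (1 : G) V &
  forall x : T, N0 (fval x) -> V (fval x) -> A (y * x)].
rewrite nbhsE; exists B; last first.
  move=> y [V' nV' h]; rewrite -[y]mulg1; apply: h; rewrite fval1; first exact: sg1.
  exact: nbhs_singleton.
split; last by exists V.
move=> y [V1 nV1 h1]; have [V2 nV2 h2] := nbhs1M nV1.
exists V2 => // x N0x V2x; exists V2 => // z N0z V2z.
rewrite -mulgA; apply: h1; rewrite fvalM; [exact: sgM|exact: h2].
Qed.

Lemma fine_mul_continuous : continuous (fun p : T * T => p.1 * p.2).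
Proof.
move=> [a b] W nW; have [V nV hV] := iffLR (fine_nbhs (a * b) W) nW.
have [V3 nV3 h3] := nbhs1M nV.
(* The product is rewritten as [a * x * (b * y) = a * b * (x ^ b * y)], so [x ^ b] has to stay in
   the base for small [x] in it. *)
have [V4 nV4 h4] := fd_base_conj (fvalP b).
have nV1 : nbhs (1 : G) (V4 `&` [set x | V3 (x ^ fval b)]).
  apply: filterI => //.
  apply: (@nbhs_comp G G (fun x => x ^ fval b) 1 V3 (@conjg_cont G _)).
  by rewrite conj1g.
exists ([set y | exists2 x, [/\ N0 (fval x), V4 (fval x) & V3 (fval x ^ fval b)] & y = a * x],
        [set y | exists2 x, N0 (fval x) /\ V3 (fval x) & y = b * x]).
  split; apply/fine_nbhs.
    exists (V4 `&` [set x | V3 (x ^ fval b)]) => // x N0x [V4x V3x].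
    by exists x.
  by exists V3 => // x N0x V3x; exists x.
move=> [_ _] [/= [x [N0x V4x V3x] ->] [y [N0y V3y] ->]].
have -> : a * x * (b * y) = a * b * (x ^ b * y) by gsimp.
have e : fval (x ^ b * y) = fval x ^ fval b * fval y by [].
apply: hV; rewrite e; last exact: h3.
by apply: sgM => //; exact: h4.
Qed.

Lemma fine_inv_continuous : continuous (fun x : T => x^-1).
Proof.
move=> a W nW; have [V nV hV] := iffLR (fine_nbhs a^-1 W) nW.
have [V4 nV4 h4] := fd_base_conj (fvalP a^-1).
have nV1 : nbhs (1 : G) (V4 `&` [set x | V (x^-1 ^ (fval a)^-1)]).
  apply: filterI => //.
  apply: (@nbhs_comp G G (fun x => x^-1 ^ (fval a)^-1) 1 V).
    move=> x; apply: (@continuous_comp G G G (fun x => x^-1) (fun x => x ^ (fval a)^-1)).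
      exact: invg_continuous.
    exact: conjg_cont.
  by rewrite invg1 conj1g.
rewrite nbhs_simpl /=; apply/fine_nbhs; exists (V4 `&` [set x | V (x^-1 ^ (fval a)^-1)]) => //.
move=> x N0x [V4x Vx] /=.
have -> : (a * x)^-1 = a^-1 * (x^-1 ^ a^-1) by gsimp.
apply: hV; last exact: Vx.
have e : fval (x^-1 ^ a^-1) = (fval x ^ (fval a)^-1)^-1 by rewrite -conjVg.
by rewrite e; apply: sgV => //; exact: h4.
Qed.

HB.instance Definition _ := isTopGroup.Build T fine_mul_continuous fine_inv_continuous.

Definition fine_group : topGroupType := T.

Lemma fval_continuous : continuous (fval : fine_group -> G).
Proof.
move=> w W /nbhs_translate nW; rewrite nbhs_simpl /=; apply/fine_nbhs.
by exists [set y | W (fval w * y)].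
Qed.

Lemma tofine_continuous (X : topGroupType) (f : X -> G) W : {morph f : x y / x * y} ->
  continuous f -> (forall x, sg_set (fd_group d) (f x)) -> nbhs (1 : G) W ->
  (forall x, W (f x) -> N0 (f x)) -> continuous (tofine \o f : X -> fine_group).
Proof.
move=> fM cf fG nW WN.
have fv x : fval (tofine (f x)) = f x by apply: tofineK.
apply: hom_continuous => [x y|O /fine_nbhs[V nV hV]].
  by apply: fval_inj; rewrite fvalM /= !fv fM.
have nVW : nbhs (1 : X) [set x | (V `&` W) (f x)].
  apply: (@nbhs_comp _ _ f 1 (V `&` W) cf).
  rewrite (@morph_in1 _ _ f setT) //; exact: filterI.
apply: (filterS _ nVW) => x [Vx Wx] /=; rewrite -[tofine _]mul1g.
by apply: hV; rewrite fv //; exact: WN.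
Qed.

(** Near 1 the set [A] lies in the base, so the inclusion of [A] with its topology from [G] is
    continuous for the finer one. *)
Lemma fine_compact (A : set G) W : is_subgroup A -> compact A -> A `<=` fd_group d ->
  nbhs (1 : G) W -> A `&` W `<=` N0 -> compact [set x : fine_group | A (fval x)].
Proof.
move=> sA cA AG nW AW.
pose K := Subgroup sA.
have vA (x : topsub K) : A (set_val x) by exact: (@subP _ K).
have -> : [set x : fine_group | A (fval x)] = (tofine \o (set_val : topsub K -> G)) @` setT.
  apply/seteqP; split => x.
    move=> Ax; exists (tosub K (fval x)) => //=.
    by rewrite (@valK_tosub _ K) // fvalK.
  by move=> [y _ <-] /=; rewrite tofineK //; exact: AG.
apply: compact_image; last exact: (@compact_topsub _ K).
apply: (@tofine_continuous (topsub K) set_val W) => //.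
- exact: sg_val_continuous.
- by move=> x; exact: AG.
- by move=> x Wx; exact: AW.
Qed.

Lemma fine_tdlc : tdlc G -> compact N0 -> tdlc fine_group.
Proof.
move=> [hG lG tG] cN0.
have hF : hausdorff_space fine_group.
  exact: (inj_hausdorff fval_continuous fval_inj).
split => //; last exact: (inj_td fval_continuous fval_inj).
have cN : compact [set x : fine_group | N0 (fval x)].
  by apply: (@fine_compact N0 setT) => //; [exact: fd_base_sub|exact: filterT].
have nN : nbhs (1 : fine_group) [set x : fine_group | N0 (fval x)].
  apply/fine_nbhs; exists setT; first exact: filterT.
  by move=> x N0x _; rewrite mul1g.
move=> x _; exists ((fun y => x * y) @` [set x : fine_group | N0 (fval x)]).
  apply/(@fine_nbhs x); exists setT; first exact: filterT.
  by move=> y N0y _ _; exists y.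
have cI : compact ((fun y => x * y) @` [set x : fine_group | N0 (fval x)]).
  by apply: compact_image => //; exact: mulgl_cont.
by split => //; exact: cpt_closed.
Qed.

Lemma fine_first_countable (Vb : nat -> set G) :
  (forall k, nbhs (1 : G) (Vb k)) -> (forall W, nbhs (1 : G) W -> exists k, Vb k `<=` W) ->
  first_countable fine_group.
Proof.
move=> nVb bVb x.
pose b k := [set x * y | y in [set y : fine_group | N0 (fval y) /\ Vb k (fval y)]].
exists (range b); first exact: card_image_le.
apply/seteqP; split => A.
  move=> nA; have [V nV hV] := iffLR (fine_nbhs x A) nA; have [k kV] := bVb _ nV.
  exists (b k); first by exists k.
  by move=> _ [y [N0y Vy] <-]; apply: hV => //; exact: kV.
move=> [_ [k _ <-] bA]; apply/fine_nbhs; exists (Vb k) => // y N0y Vy.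
by apply: bA; exists y.
Qed.

End Fine.

Definition lnS (S : topGroupType -> Prop) (G : topGroupType) (M : set G) :=
  inS S M /\ exists2 W, nbhs (1 : G) W & nrm M W.

(** The clauses of [lociso] for a given map and domain. *)
Definition open_embedding_on (X Y : topGroupType) (f : X -> Y) (R : set X) :=
  [/\ is_subgroup R /\ nbhs (1 : X) R, {in R &, {morph f : x y / x * y}},
     {in R &, injective f},
     forall W, nbhs (1 : Y) W -> nbhs (1 : X) (f @^-1` W)
   & forall W, nbhs (1 : X) W -> nbhs (1 : Y) (f @` (R `&` W))].

Lemma sg_setT (G : groupType) : is_subgroup [set: G]. Proof. by split. Qed.

Section Image.
Variable S : topGroupType -> Prop.
Hypothesis S_class : profinite_similarity_class S.

(** Applied both to the inclusion of an open subgroup and to an automorphism of one, regarded as a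
    partial map of [G]. *)
Lemma lnS_image (X Y : topGroupType) (f : X -> Y) (R M : set X) : tdlc Y ->
  open_embedding_on f R -> M `<=` R -> lnS S M -> lnS S (f @` M).
Proof.
move=> [hY _ tY] [[sR nR] fM fI fc fo] MR [iM [W nW nMW]]; have sM := inS_sg iM.
have fM' : {in M &, {morph f : x y / x * y}}.
  by move=> x y /set_mem/MR/mem_set Rx /set_mem/MR/mem_set Ry; exact: fM.
have fMM x y : M x -> M y -> f (x * y) = f x * f y.
  by move=> Mx My; apply: fM'; exact: mem_set.
have fIM x y : M x -> M y -> f x = f y -> x = y.
  by move=> /MR/mem_set Rx /MR/mem_set Ry; exact: fI.
have sB : is_subgroup (f @` M) by exact: sg_image.
have cM := inS_compact S_class iM.
split; last first.
  exists (f @` (R `&` W)); first exact: fo.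
  move=> _ _ [m Mm <-] [w [Rw Ww] <-].
  by rewrite -(morph_inJ sR fM) //; [exists (m ^ w) => //; exact: nMW|exact: MR].
have fcM V : nbhs (1 : Y) V -> exists2 V', nbhs (1 : X) V' &
    forall x, M x -> V' x -> V (f x).
  by move=> nV; exists (f @^-1` V); [exact: fc|].
have [sM' SM] := iM.
have cB : compact (f @` M).
  pose K := Subgroup sM'.
  have vM (x : topsub K) : M (set_val x) by exact: (@subP _ K).
  have -> : f @` M = (f \o (set_val : topsub K -> X)) @` setT.
    apply/seteqP; split => _ [x Mx <-]; last by exists (set_val x).
    by exists (tosub K x) => //=; rewrite (@valK_tosub _ K).
  apply: compact_image; last exact: (@compact_topsub _ K).
  apply: hom_continuous => [x y|V /fc nV]; first by rewrite /= fMM.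
  by apply/sub_nbhs; exists (f @^-1` V).
apply: (@S_lociso_inS _ S_class Y hY tY (topsub (Subgroup sM')) _ sB) => //.
apply: (@sub_lociso X Y f M (f @` M) setT) => //; exact: filterT.
Qed.

End Image.

(** * The group generated by the locally normal members, with its finer topology *)

Section Core.
Variables (G : topGroupType) (S : topGroupType -> Prop).
Hypotheses (G_tdlc : tdlc G) (S_class : profinite_similarity_class S).
Variable N0 : set G.
Hypothesis lnN0 : lnS S N0.
Hypothesis N0_max : forall N, lnS S N -> relopen N0 N.

Let hG : hausdorff_space G. Proof. by case: G_tdlc. Qed.
Let tG : totally_disconnected [set: G]. Proof. by case: G_tdlc. Qed.
Let sN0 : is_subgroup N0. Proof. by case: lnN0 => /inS_sg. Qed.
Let cN0 : compact N0. Proof. by case: lnN0 => /(inS_compact S_class). Qed.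

Lemma lnS_conj (N : set G) g : lnS S N -> lnS S [set x ^ g | x in N].
Proof.
move=> [iN [W nW nN]]; split; first exact: inS_conj.
exists [set w | W (w ^ g^-1)].
  apply: (@nbhs_comp G G (fun w => w ^ g^-1) 1 W (@conjg_cont G _)).
  by rewrite conj1g.
move=> _ w [x Nx <-] /= Ww; exists (x ^ (w ^ g^-1)); first exact: nN.
by rewrite -!conjgM; congr (_ ^ _); gsimp.
Qed.

Definition core_set : set G := generated (\bigcup_(N in [set N : set G | lnS S N]) N).

Lemma core_sg : is_subgroup core_set.
Proof.
split.
- by move=> A [sA _]; exact: sg1.
- by move=> x y cx cy A hA; have [sA _] := hA; apply: sgM => //; [exact: cx|exact: cy].
- by move=> x cx A hA; have [sA _] := hA; apply: sgV => //; exact: cx.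
Qed.

Lemma lnS_core (N : set G) : lnS S N -> N `<=` core_set.
Proof. by move=> lN x Nx A [_ h]; apply: h; exists N. Qed.

Lemma core_min (A : set G) : is_subgroup A -> (forall N : set G, lnS S N -> N `<=` A) -> core_set `<=` A.
Proof. by move=> sA h x; apply; split => // y [N lN]; exact: h. Qed.

(** The conjugate of [N0] by [g] is again a locally normal member, so near 1 it lies in [N0] by
    maximality. *)
Lemma N0_conj g : exists2 W, nbhs (1 : G) W & forall x, N0 x -> W x -> N0 (x ^ g).
Proof.
have [W nW WN] := N0_max (lnS_conj g lnN0).
exists [set x | W (x ^ g)].
  by apply: (@nbhs_comp G G (fun w => w ^ g) 1 W (@conjg_cont G _)); rewrite conj1g.
by move=> x N0x Wx; apply: WN; split => //; exists x.
Qed.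

Definition core_data : fine_data G := @FineData G (Subgroup core_sg) N0 sN0
  (lnS_core lnN0) (fun g _ => N0_conj g).

Definition core : topGroupType := fine_group core_data.
Definition core_val : core -> G := @fval G core_data.

Lemma core_valP x : core_set (core_val x). Proof. exact: (@fvalP _ core_data). Qed.

Lemma core_val_continuous : continuous core_val.
Proof. exact: (@fval_continuous G core_data). Qed.

Lemma range_core : range core_val = core_set.
Proof.
apply/seteqP; split => [_ [x _ <-]|x cx]; first exact: core_valP.
by exists (@tofine G core_data x) => //; exact: (@tofineK _ core_data).
Qed.

Lemma core_compact N : is_subgroup N -> compact N -> N `<=` core_set -> relopen N0 N ->
  compact (core_val @^-1` N).
Proof.
by move=> sN cN Nc [W nW WN]; exact: (@fine_compact G core_data N W).
Qed.

Lemma core_preimage_sg A : is_subgroup A -> is_subgroup (core_val @^-1` A).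
Proof.
move=> sA; split => [|x y Ax Ay|x Ax]; first exact: (sg1 sA).
  exact: (sgM sA).
exact: (sgV sA).
Qed.

(** The elements of [N0] whose [N]-conjugates all stay in [N0] form a subgroup [M] normalised by
    [N], and [M N] is the group sought. [M] is open in [N0] because finitely many cosets of a part
    of [N] inside [N0] cover [N], so only finitely many conjugations impose a condition. *)
Lemma compact_open_over (N : set G) : lnS S N -> exists P : set core,
  [/\ is_subgroup P, compact P, open P & core_val @^-1` N `<=` P].
Proof.
move=> lN; have [iN _] := lN; have sN := inS_sg iN; have cN := inS_compact S_class iN.
have roN := N0_max lN; have [V nV VN] := roN.
have [s sN' cov] := finite_cover cN nV.
pose M := [set x | N0 x /\ forall n, N n -> N0 (x ^ n)].
have sM : is_subgroup M.
  split.
  - by split => [|n _]; rewrite ?conj1g; exact: sg1.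
  - move=> x y [Nx hx] [Ny hy]; split => [|n Nn]; first exact: sgM.
    by rewrite conjMg; apply: sgM => //; [exact: hx|exact: hy].
  - move=> x [Nx hx]; split => [|n Nn]; first exact: sgV.
    by rewrite conjVg; apply: sgV => //; exact: hx.
have nMN : nrm M N.
  move=> x n [Nx hx] Nn; split => [|m Nm]; first exact: hx.
  by rewrite -conjgM; apply: hx; exact: sgM.
have [W nW hW] : exists2 W, nbhs (1 : G) W &
    forall x, N0 x -> W x -> forall y, y \in s -> N0 (x ^ y^-1).
  elim: {sN' cov} s => [|y s [W nW h]]; first by exists setT => //; exact: filterT.
  have [W1 nW1 h1] := N0_conj y^-1.
  exists (W `&` W1); first exact: filterI.
  move=> x N0x [Wx W1x] z; rewrite inE => /orP[/eqP->|]; first exact: h1.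
  exact: h.
have WM : N0 `&` W `<=` M.
  move=> x [N0x Wx]; split => // n Nn.
  have [y ys Vy] := cov _ (sgV sN Nn).
  have Ny := sN' _ ys.
  have N0v : N0 (n^-1 * y^-1).
    by apply: VN; split => //; apply: sgDr => //; exact: sgV.
  have -> : x ^ n = (x ^ y^-1) ^ (n^-1 * y^-1)^-1.
    by rewrite -conjgM; congr (_ ^ _); gsimp.
  by apply: sgJ => //; [exact: hW Wx _ ys|exact: sgV].
have MN0 : M `<=` N0 by move=> x [].
have clM : closed M by apply: (sg_closed sM _ MN0 sN0 nW WM); exact: cpt_closed.
have cM : compact M by exact: subclosed_compact clM cN0 MN0.
have Mc : M `<=` core_set by move=> x /MN0; exact: lnS_core.
have Nc := lnS_core lN.
exists (smul (core_val @^-1` M) (core_val @^-1` N)).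
have sP : is_subgroup (smul (core_val @^-1` M) (core_val @^-1` N)).
  apply: sg_smul; [exact: core_preimage_sg..|].
  by move=> x n Mx Nn; exact: nMN.
have sM1 := core_preimage_sg sM; have sN1 := core_preimage_sg sN.
split => //; last exact: smulSr.
- apply: compact_smul; last exact: core_compact.
  by apply: core_compact => //; exists setT; [exact: filterT|move=> x [/MN0]].
- apply: sg_open => //; apply/(@fine_nbhs G core_data); exists W => // x N0x Wx.
  by rewrite mul1g; apply: (smulSl sN1); apply: WM; split.
Qed.

(** Generation follows from [compact_open_over]. A compact open [P] belongs to S because its image
    meets [N0] in a relatively open subgroup [D], a member that is locally isomorphic to [P]. *)
Lemma core_generated : generated_by_compact_opens S core.
Proof.
split.
  apply/seteqP; split => // x _ A [sA hA].
  suff /(_ _ (core_valP x)) [a Aa /(@fval_inj G core_data) <-] : core_set `<=` core_val @` A by [].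
  apply: core_min.
    by apply: sg_image => // y z _ _.
  move=> N lN y Ny; have [P [sP cP oP NP]] := compact_open_over lN.
  have e : core_val (@tofine G core_data y) = y.
    by apply: (@tofineK G core_data); exact: lnS_core Ny.
  exists (@tofine G core_data y) => //; apply: hA; exists (Subgroup sP) => //.
  by apply: NP; rewrite /= e.
move=> [P sP] /= cP oP.
have hC : hausdorff_space core := inj_hausdorff (@fval_continuous G core_data) (@fval_inj G core_data) hG.
have tC : totally_disconnected [set: core] :=
  inj_td (@fval_continuous G core_data) (@fval_inj G core_data) tG.
have nP : nbhs (1 : core) P by exact: open_sg_nbhs.
have [V nV VP] := iffLR (@fine_nbhs G core_data 1 _) nP.
have tK x : N0 x -> core_val (@tofine G core_data x) = x.
  by move=> N0x; apply: (@tofineK G core_data); exact: lnS_core N0x.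
pose D := N0 `&` core_val @` P.
have sB : is_subgroup (core_val @` P) by apply: sg_image => // x y _ _.
have sD : is_subgroup D by exact: sgI.
have tP x : N0 x -> V x -> P (@tofine G core_data x).
  move=> N0x Vx; rewrite -[tofine _ _]mul1g.
  by apply: VP; rewrite -[fval _]/(core_val _) tK.
have VD : N0 `&` V `<=` D.
  move=> x [N0x Vx]; split => //.
  by exists (@tofine G core_data x); [exact: tP|exact: tK].
have DN0 : D `<=` N0 by move=> x [].
have clD : closed D by apply: (sg_closed sD _ DN0 sN0 nV VD); exact: cpt_closed.
have iD : inS S D.
  by apply: (inS_down G_tdlc S_class _ sD clD DN0 nV VD); case: lnN0.
have cD : compact D by exact: subclosed_compact clD cN0 DN0.
have tM x y : D x -> D y ->
    @tofine G core_data (x * y) = tofine core_data x * tofine core_data y.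
  move=> /DN0 Nx /DN0 Ny; apply: (@fval_inj G core_data).
  by rewrite fvalM -![fval _]/(core_val _) !tK //; exact: sgM.
apply: (@inS_lociso_S _ S_class G _ D sD) => //; first exact: topsub_profinite.
apply: lociso_sym.
apply: (@sub_lociso G core (@tofine G core_data) D P (core_val @^-1` N0) sD sP) => //.
- by move=> x y /DN0 Nx /DN0 Ny /(congr1 core_val); rewrite !tK.
- move=> W /(@fine_nbhs G core_data)[V' nV' h]; exists V' => // x /DN0 Nx V'x.
  by rewrite -[tofine _ _]mul1g; apply: h; rewrite -[fval _]/(core_val _) tK.
- move=> x [Nx [p Pp e]].
  suff -> : tofine core_data x = p by [].
  by apply: (@fval_inj G core_data); rewrite -![fval _]/(core_val _) tK.
- apply/(@fine_nbhs G core_data); exists setT; first exact: filterT.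
  by move=> x N0x _; rewrite mul1g.
- move=> p [Pp Np]; exists (core_val p); last exact: (@fvalK G core_data).
  by split => //; exists p.
Qed.

(** * Properties (ii) and (iii) relative to an open embedding [i] of [H] into [G] *)

Section Embedding.
Variables (H : topGroupType) (i : H -> G) (j : core -> H).
Hypotheses (iM : {morph i : x y / x * y}) (iI : injective i) (ci : continuous i).
Hypothesis i_open : forall W, nbhs (1 : H) W -> nbhs (1 : G) (i @` W).
Hypothesis ij : forall x, i (j x) = core_val x.

Let i1 : i 1 = 1. Proof. by apply: (@morph_in1 _ _ i setT) => // x y _ _. Qed.

Let nbhs_i W : nbhs (1 : G) W -> nbhs (1 : H) (i @^-1` W).
Proof. by move=> nW; apply: (@nbhs_comp _ _ i 1 W ci); rewrite i1. Qed.

Lemma open_embedding_total : open_embedding_on i setT.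
Proof.
split => //; first by split; [exact: sg_setT|exact: filterT].
- by move=> x y _ _; exact: iI.
- by move=> W nW; rewrite setTI; exact: i_open.
Qed.

Lemma embedding_morph : {morph j : x y / x * y}.
Proof. by move=> x y; apply: iI; rewrite iM !ij. Qed.

Lemma embedding_continuous : continuous j.
Proof.
apply: (@hom_continuous core H j embedding_morph) => W /i_open nW.
have n1 : nbhs (1 : core) (core_val @^-1` (i @` W)).
  exact: (nbhs_comp (x := 1) core_val_continuous nW).
by apply: (filterS _ n1) => x [h Wh]; rewrite -ij => /iI hj; rewrite /= -hj.
Qed.

(** The image of [N] in [G] is a locally normal member, so near 1 it is contained in [N0]; hence the
    finer topology induces the original one on it. *)
Lemma core_homeomorphic : homeomorphic_over S j.
Proof.
move=> [N sN] /= cN nN SN.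
have cM : compact (i @` N) by apply: compact_image.
have sM : is_subgroup (i @` N) by apply: sg_image => // x y _ _.
have lM : lnS S (i @` N).
  apply: (lnS_image S_class G_tdlc open_embedding_total) => //.
  split; first by exists sN.
  exists (normr N); last exact: nrm_normr.
  move: nN; rewrite /locally_normal normalizerE /= => oN.
  by apply: open_sg_nbhs => //; exact: sg_normr.
have [W nW WN] := N0_max lM.
pose P := j @^-1` N.
have sP : is_subgroup P.
  have -> : P = core_val @^-1` (i @` N).
    apply/seteqP; split => x /=; first by move=> Nx; exists (j x) => //; exact: ij.
    by move=> [n Nn]; rewrite -ij => /iI nj; rewrite /P /= -nj.
  exact: core_preimage_sg.
pose KN := Subgroup sN; pose KP := Subgroup sP.
have vN (y : topsub KN) : N (set_val y) by exact: (@subP _ KN).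
have vP (x : topsub KP) : N (j (set_val x)) by exact: (@subP _ KP).
pose g (x : topsub KP) : topsub KN := tosub KN (j (set_val x)).
have gv x : set_val (g x) = j (set_val x) by exact: (@valK_tosub _ KN).
pose t (y : topsub KN) : core := @tofine G core_data (i (set_val y)).
have tv y : core_val (t y) = i (set_val y).
  apply: (@tofineK G core_data); apply: (lnS_core lM); by exists (set_val y).
have jt y : j (t y) = set_val y by apply: iI; rewrite ij tv.
pose h (y : topsub KN) : topsub KP := tosub KP (t y).
have hv y : set_val (h y) = t y.
  by apply: (@valK_tosub _ KP); rewrite /= /P /= jt.
exists g => //; split.
  apply: (@continuous_to_sg H KN).
  have -> : set_val \o g = j \o (set_val : topsub KP -> core) by apply/funext => x /=.
  move=> x; apply: continuous_comp; first exact: sg_val_continuous.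
  exact: embedding_continuous.
exists h; split.
- move=> x; apply: (@val_injS _ KP); rewrite hv; apply: (@fval_inj G core_data).
  by rewrite -![fval _]/(core_val _) tv gv ij.
- by move=> y; apply: (@val_injS _ KN); rewrite gv hv jt.
- apply: (@continuous_to_sg core KP).
  have -> : set_val \o h = @tofine G core_data \o (i \o set_val) by apply/funext => y /=.
  apply: (@tofine_continuous G core_data (topsub KN) (i \o set_val) W) => //.
  + by move=> x y /=; rewrite iM.
  + move=> x; apply: continuous_comp; first exact: sg_val_continuous.
    exact: ci.
  + by move=> x /=; apply: (lnS_core lM); exists (set_val x).
  + by move=> x /= Wx; apply: WN; split => //; exists (set_val x).
Qed.

(** An automorphism of [H] becomes a partial map [g] of [G] on the open subgroup [range i], which
    contains every locally normal member. It sends such members to such members, so it preserves the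
    group they generate; the inverse automorphism gives the other inclusion. *)
Lemma core_characteristic : characteristic (range j).
Proof.
have rj : range j = i @^-1` core_set.
  rewrite -range_core; apply/seteqP; split => h /=.
    by move=> [x _ <-]; exists x => //; rewrite ij.
  by move=> [x _]; rewrite -ij => /iI jx; exists x.
have sR : is_subgroup (range i).
  by apply: sg_image => //; exact: sg_setT.
have jR : core_set `<=` range i.
  by rewrite -range_core => _ [x _ <-]; exists (j x) => //; exact: ij.
have /choice[k kP] : forall x, exists h, range i x -> i h = x.
  move=> x; have [[h _ <-]|n] := pselect (range i x); first by exists h.
  by exists 1.
have kK h : k (i h) = h by apply: iI; apply: kP; exists h.
have sub f : topgroup_iso f -> f @` range j `<=` range j.
  move=> [fM [cf [f' [fK f'K cf']]]].
  pose g x := i (f (k x)).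
  have gi h : g (i h) = i (f h) by rewrite /g kK.
  have f1 : f 1 = 1 by apply: (@morph_in1 _ _ f setT) => //; exact: sg_setT.
  have gE : open_embedding_on g (range i).
    split.
    - by split => //; apply: i_open; exact: filterT.
    - by move=> _ _ /set_mem[x _ <-] /set_mem[y _ <-]; rewrite -iM !gi fM iM.
    - by move=> _ _ /set_mem[x _ <-] /set_mem[y _ <-]; rewrite !gi => /iI/(can_inj fK) ->.
    - move=> W /nbhs_i nW.
      have /i_open : nbhs (1 : H) (f @^-1` (i @^-1` W)).
        by apply: (@nbhs_comp _ _ f 1 _ cf); rewrite f1.
      by apply: filterS => _ [h Wh <-]; rewrite /= gi.
    - move=> W /nbhs_i nW.
      have /i_open : nbhs (1 : H) (f' @^-1` (i @^-1` W)).
        by apply: (@nbhs_comp _ _ f' 1 _ cf'); rewrite -f1 fK.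
      apply: filterS => _ [h Wh <-]; exists (i (f' h)); last by rewrite gi f'K.
      by split => //; exists (f' h).
  have gc x : core_set x -> core_set (g x).
    move=> cx.
    suff : core_set `<=` [set x | range i x /\ core_set (g x)] by move=> /(_ _ cx)[].
    have gM := let: And5 _ m _ _ _ := gE in m.
    apply: core_min.
      split.
      - split; first exact: sg1.
        by rewrite (morph_in1 sR gM); exact: (sg1 core_sg).
      - move=> y z [Ry cy] [Rz cz]; split; first exact: sgM.
        by rewrite gM; [exact: (sgM core_sg)|exact: mem_set|exact: mem_set].
      - move=> y [Ry cy]; split; first exact: sgV.
        by rewrite (morph_inV sR gM) //; exact: (sgV core_sg).
    move=> N lN y Ny; have NR : N `<=` range i by move=> z /(lnS_core lN)/jR.
    split; first exact: NR.
    by apply: (lnS_core (lnS_image S_class G_tdlc gE NR lN)); exists y.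
  by rewrite rj => _ [h ch <-]; rewrite /= -gi; exact: gc.
move=> f iso_f; apply/seteqP; split; first exact: sub.
have [fM [cf [f' [fK f'K cf']]]] := iso_f.
have iso_f' : topgroup_iso f'.
  split; first by move=> x y; apply: (can_inj fK); rewrite f'K fM !f'K.
  by split => //; exists f.
move=> y ry; exists (f' y); last exact: f'K.
by apply: (sub f') => //; exists y.
Qed.

End Embedding.

Lemma core_properties (H : topGroupType) (i : H -> G) (j : core -> H) :
  {morph i : x y / x * y} -> injective i -> continuous i ->
  (forall W, nbhs (1 : H) W -> nbhs (1 : G) (i @` W)) ->
  (forall x, i (j x) = core_val x) -> monomial_core_properties S j.
Proof.
move=> iM iI ci io ij; split; [exact: core_generated|exact: (core_homeomorphic iM iI ci io ij)|].
move=> U oU jU.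
have jr : set_val @^-1` range j = range (tosub U \o j).
  apply/seteqP; split => h /=.
    by move=> [x _ e]; exists x => //; rewrite e tosubK.
  by move=> [x _ <-]; exists x => //; rewrite valK_tosub //; apply: jU; exists x.
rewrite jr.
(* Property (iii) for an open subgroup [U] of [H] is the previous lemma for the composite embedding
   of [U] into [G]. *)
apply: (@core_characteristic (topsub U) (i \o set_val) (tosub U \o j)).
- by move=> x y /=; rewrite iM.
- by move=> x y /= /iI; exact: val_injS.
- by move=> x; apply: continuous_comp; [exact: sg_val_continuous|exact: ci].
- move=> W /sub_nbhs[V nV VW].
  have nU : nbhs (1 : H) U by apply: open_sg_nbhs => //; exact: sg_subgroup.
  have /io : nbhs (1 : H) (V `&` U) by exact: filterI.
  apply: filterS => _ [h [Vh Uh] <-]; exists (tosub U h) => /=; last by rewrite valK_tosub.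
  by apply: VW; rewrite valK_tosub.
- by move=> x /=; rewrite valK_tosub ?ij //; apply: jU; exists x.
Qed.

End Core.

Lemma countable_onorm_basis (G : topGroupType) (U : set G) : tdlc G ->
  first_countable G -> cposub U -> exists Vb : nat -> set G,
    (forall k, onorm U (Vb k)) /\ forall W, nbhs (1 : G) W -> exists k, Vb k `<=` W.
Proof.
move=> G_tdlc fG cU; have [B /countable_injP[f fI] eB] := fG 1.
have /choice[Vb VbP] : forall k, exists V,
    onorm U V /\ forall b, B b -> f b = k -> V `<=` b.
  move=> k; have [[b Bb fb]|n] := pselect (exists2 b, B b & f b = k); last first.
    (* Default value at indices that code no element of [B]. *)
    exists U; split; first exact: onormU.
    by move=> b Bb fb; case: n; exists b.
  have nb : nbhs (1 : G) b by rewrite eB; exists b.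
  have [V oV Vb] := onorm_small G_tdlc cU nb.
  exists V; split => // b' Bb' fb'.
  suff -> : b' = b by [].
  by apply: fI; [exact: mem_set|exact: mem_set|rewrite fb'].
exists Vb; split; first by move=> k; case: (VbP k).
move=> W; rewrite eB => -[b Bb bW]; exists (f b).
by have [_ /(_ b Bb erefl) h] := VbP (f b); exact: subset_trans bW.
Qed.

(** * Existence of a largest locally normal member *)

Section MaximalMember.
Variables (G : topGroupType) (S : topGroupType -> Prop).
Hypotheses (G_tdlc : tdlc G) (G_fc : first_countable G) (G_LD : property_LD G).
Hypothesis G_S : monomial_constituent G S.

Let S_class : profinite_similarity_class S. Proof. by case: G_S. Qed.
Let S_mono : forall H, S H -> monomial H. Proof. by case: G_S. Qed.
Let hG : hausdorff_space G. Proof. by case: G_tdlc. Qed.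
Let tG : totally_disconnected [set: G]. Proof. by case: G_tdlc. Qed.

Lemma lnS_exists : exists N : set G, lnS S N.
Proof.
have [_ _ [H SH [[K sK] nK [f [fM [cf [f' [fK f'K cf']]]]]]]] := G_S.
have [_ cH _] := S_profinite S_class SH.
have cK : compact [set: topsub (Subgroup sK)].
  have -> : [set: topsub (Subgroup sK)] = f @` setT.
    by apply/seteqP; split => // x _; exists (f' x).
  exact: compact_image.
exists K; split.
  apply: (@S_lociso_inS _ S_class G hG tG H K sK SH).
    exact: (@topsub_compact _ (Subgroup sK)).
  exact: (lociso_iso fM fK f'K cf cf').
exists (normr K); last exact: nrm_normr.
move: nK; rewrite /locally_normal normalizerE /= => oN.
by apply: open_sg_nbhs => //; exact: sg_normr.
Qed.

Lemma NU_under (U N : set G) : cposub U -> lnS S N ->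
  exists2 M, NU U S M & relopen M N.
Proof.
move=> cU [iN [W nW nN]]; have [sU cptU oU] := cU.
have iNU : inS S (N `&` U).
  have clU : closed U by exact: cpt_closed.
  apply: (inS_down G_tdlc S_class iN (W := U)) => //.
  - by apply: sgI => //; exact: inS_sg iN.
  - by apply: closedI => //; exact: (inS_closed S_class hG iN).
  - exact: open_sg_nbhs.
have nWU : nbhs (1 : G) (W `&` U) by apply: filterI => //; exact: open_sg_nbhs.
have nNU : nrm (N `&` U) (W `&` U).
  by apply: nrmI; [apply: nrmS nN _ => x []|apply: nrmS (sg_nrm sU) _ => x []].
have NUU : N `&` U `<=` U by move=> x [].
have [M [V [MM oV VM]]] := NU_cofinal G_tdlc G_LD S_class S_mono cU iNU NUU nWU nNU.
exists M => //; exists (U `&` V); last by move=> x [Nx [Ux Vx]]; apply: VM.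
by apply: filterI; [exact: open_sg_nbhs|exact: onorm_nbhs oV].
Qed.

(** By [NU_under] every locally normal member is contained, near 1, in a member normal in [U], so a
    largest one among the latter is largest among all. *)
Lemma lnS_maximal : exists N0 : set G, lnS S N0 /\ forall N, lnS S N -> relopen N0 N.
Proof.
have [U [sU oU cptU _]] := van_dantzig G_tdlc filterT.
have cU : cposub U by [].
have [Vb [Vb_onorm Vb_basis]] := countable_onorm_basis G_tdlc G_fc cU.
have [N lN] := lnS_exists; have [M NM _] := NU_under cU lN.
have [N0 [NN0 max0]] : exists A, max_member S U A.
  by apply: (exists_max G_tdlc G_LD S_class S_mono cU Vb_onorm Vb_basis); exists M.
exists N0; split.
  have [iN0 _ nN0] := NN0; split => //; exists U => //; exact: open_sg_nbhs.
move=> N' lN'; have [M' NM' [W nW WM']] := NU_under cU lN'.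
have [W' nW' WN0] := max0 _ NM'.
exists (W `&` W'); first exact: filterI.
by move=> x [Nx [Wx W'x]]; apply: WN0; split => //; exact: WM'.
Qed.

End MaximalMember.

Unset Implicit Arguments.

Theorem proposition4p6 (G : topGroupType) (S : topGroupType -> Prop)
    (G_tdlc : tdlc G) (G_first_countable : first_countable G)
    (G_LD : property_LD G) (S_constituent : monomial_constituent G S) :
  exists (GS : topGroupType) (phi : GS -> G),
    [/\ tdlc GS /\ first_countable GS,
        [/\ {morph phi : x y / x * y}, continuous phi & injective phi],
        monomial_core_properties S phi
      & forall K : subgroup G, open K -> range phi `<=` K ->
          exists2 phiK : GS -> topsub K,
            forall x, set_val (phiK x) = phi x & monomial_core_properties S phiK].
Proof.
have S_class : profinite_similarity_class S by case: S_constituent.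
have [U [sU oU cptU _]] := van_dantzig G_tdlc filterT.
have cU : cposub U by [].
have [Vb [Vb_onorm Vb_basis]] := countable_onorm_basis G_tdlc G_first_countable cU.
have [N0 [lN0 max0]] := lnS_maximal G_tdlc G_first_countable G_LD S_constituent.
pose GS := core G_tdlc S_class lN0 max0.
pose phi : GS -> G := @core_val G S G_tdlc S_class N0 lN0 max0.
exists GS, phi; split.
- split; first by apply: fine_tdlc => //; have [/(inS_compact S_class)] := lN0.
  by apply: (fine_first_countable _ Vb_basis) => k; exact: onorm_nbhs (Vb_onorm k).
- split => //; [exact: core_val_continuous|exact: fval_inj].
- apply: (core_properties (i := id)) => // [x //|W nW].
  by apply: (filterS _ nW) => x Wx; exists x.
- move=> K oK rK; have sK := sg_subgroup K.
  have kE x : set_val (tosub K (phi x)) = phi x.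
    by rewrite valK_tosub //; apply: rK; exists x.
  (* The same group serves for [K], with the inclusion of [K] into [G] as the open embedding. *)
  exists (tosub K \o phi) => //.
  apply: (core_properties (i := set_val)) => //.
  + exact: sg_val_continuous.
  + move=> W /sub_nbhs[V nV VW].
    have nVK : nbhs (1 : G) (V `&` K) by apply: filterI => //; exact: open_sg_nbhs.
    apply: (filterS _ nVK) => x [Vx Kx]; exists (tosub K x) => /=; last by rewrite valK_tosub.
    by apply: VW; rewrite valK_tosub.
Qed.
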